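(* Let $\gamma$ be an analytic Jordan curve in $\mathbb{C}$ and let $\phi:\mathbb{D}\to\mathbb{C}$ be a conformal mapping from the open unit disc $\mathbb{D}$ onto the interior of $\gamma$; $\phi$ denotes also its conformal extension to a disc $\{z\in\mathbb{C}:|z|<r\}$ with $r>1$, so that $\gamma$ is the curve $\phi(e^{it})$, $t\in\mathbb{R}$. Let $s:\mathbb{R}\to\mathbb{R}$ be the arc length function of this curve, i.e. $s'(t)=\left|\frac{d}{dt}\phi(e^{it})\right|$ for all $t\in\mathbb{R}$. For a function $f:\gamma\to\mathbb{C}$ (defined on the image of $\gamma$) the following are equivalent: (i) $f$ is analytic at every point of $\gamma$ with respect to the parameter $t$, i.e. $t\mapsto f(\phi(e^{it}))$ is real analytic on $\mathbb{R}$; (ii) $f$ is analytic at every point of $\gamma$ with respect to the arc length $\tau=s(t)$, i.e. $\tau\mapsto f(\phi(e^{i s^{-1}(\tau)}))$ is real analytic on $\mathbb{R}$; (iii) $f$ can be holomorphically extended to an open set $V$ with $\gamma\subset V\subset\mathbb{C}$.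
   Context: A conformal mapping on an open set is an injective holomorphic function. A Jordan curve $\gamma$ in $\mathbb{C}$ is an analytic Jordan curve if there exist $0<r_1<1<r_2<+\infty$ and an injective holomorphic function $F:\{z\in\mathbb{C}: r_1<|z|<r_2\}\to\mathbb{C}$ with $\gamma=F(\mathbb{T})$, where $\mathbb{T}=\{z\in\mathbb{C}:|z|=1\}$. The interior of $\gamma$ is the bounded component of $\mathbb{C}\setminus\gamma$. It is a known fact that for an analytic Jordan curve $\gamma$ any conformal mapping of $\mathbb{D}$ onto the interior of $\gamma$ extends to a conformal mapping on a disc $\{|z|<r\}$ with $r>1$. The arc length function $s$ is a bijection $\mathbb{R}\to\mathbb{R}$. A complex-valued function $g$ on $\mathbb{R}$ is real analytic if near each $t_0\in\mathbb{R}$ it is the sum of a convergent power series $\sum_{n\ge0}a_n(t-t_0)^n$ with $a_n\in\mathbb{C}$. *)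

(* Defs.v *)
From Stdlib Require Import Reals ClassicalEpsilon.
From Coquelicot Require Import Coquelicot.

Open Scope R_scope.

(** Subsets of the plane are predicates on Coquelicot's [C].  A function on a
    subset of [C] is a total function [C -> C] whose values outside that subset
    are irrelevant. *)

Definition holomorphic_on (U : C -> Prop) (f : C -> C) : Prop :=
  forall z : C, U z -> @ex_derive C_AbsRing C_NormedModule f z.

Definition injective_on (U : C -> Prop) (f : C -> C) : Prop :=
  forall z w : C, U z -> U w -> f z = f w -> z = w.

(** Only applied to open sets [U]. *)
Definition conformal_on (U : C -> Prop) (f : C -> C) : Prop :=
  holomorphic_on U f /\ injective_on U f.

Definition image (f : C -> C) (A : C -> Prop) : C -> Prop :=
  fun w => exists z : C, A z /\ f z = w.

Definition subset (A B : C -> Prop) : Prop := forall z : C, A z -> B z.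

Definition same_set (A B : C -> Prop) : Prop := forall z : C, A z <-> B z.

Definition open_disc (r : R) : C -> Prop := fun z => Cmod z < r.

Definition unit_circle : C -> Prop := fun z => Cmod z = 1.

Definition annulus (r1 r2 : R) : C -> Prop := fun z => r1 < Cmod z < r2.

Definition analytic_Jordan_curve (gamma : C -> Prop) : Prop :=
  exists (r1 r2 : R) (F : C -> C),
    0 < r1 < 1 /\ 1 < r2 /\
    conformal_on (annulus r1 r2) F /\
    same_set gamma (image F unit_circle).

Definition connected_set (A : C -> Prop) : Prop :=
  forall U V : C -> Prop, open U -> open V ->
    (forall z : C, A z -> U z \/ V z) ->
    (exists z : C, A z /\ U z) ->
    (exists z : C, A z /\ V z) ->
    exists z : C, A z /\ U z /\ V z.

Definition connected_component_of (A B : C -> Prop) : Prop :=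
  (exists z : C, B z) /\ subset B A /\ connected_set B /\
  (forall B' : C -> Prop,
     connected_set B' -> subset B' A -> subset B B' -> subset B' B).

Definition bounded_set (A : C -> Prop) : Prop :=
  exists M : R, forall z : C, A z -> Cmod z <= M.

(** By the Jordan curve theorem, exactly one [Omega] (up to [same_set]) has this
    property when [gamma] is a Jordan curve. *)
Definition is_interior (gamma Omega : C -> Prop) : Prop :=
  connected_component_of (fun z => ~ gamma z) Omega /\ bounded_set Omega.

(** [cis t] is e^{it}. *)
Definition cis (t : R) : C := (cos t, sin t).

(** [C] is viewed as a normed space over the reals: complex coefficients, real
    variable. *)
Definition real_analytic (g : R -> C) : Prop :=
  forall t0 : R, exists (a : nat -> C) (d : R), 0 < d /\
    forall t : R, Rabs (t - t0) < d ->
      @is_pseries R_AbsRing C_R_NormedModule a (t - t0) (g t).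

Definition is_arc_length (c : R -> C) (s : R -> R) : Prop :=
  forall t : R, exists v : C,
    @is_derive R_AbsRing C_R_NormedModule c t v /\ is_derive s t (Cmod v).

(** The two-sided inverse of [s] when [s] is a bijection of [R]. *)
Definition inverse_fun (s : R -> R) (tau : R) : R :=
  epsilon (inhabits 0) (fun t : R => s t = tau).

Definition extends_holomorphically (gamma : C -> Prop) (f : C -> C) : Prop :=
  exists (V : C -> Prop) (g : C -> C),
    open V /\ subset gamma V /\ holomorphic_on V g /\
    (forall z : C, gamma z -> g z = f z).

(* Main.v *)
Require Import Defs.
From Stdlib Require Import Reals Lra Lia Classical ClassicalEpsilon.
From Coquelicot Require Import Coquelicot.
Open Scope R_scope.

(** Real analyticity is a statement about holomorphic functions: a function on the
    line is real analytic exactly when, near each point, it is the restriction of a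
    holomorphic function ([real_analytic_iff]).  Holomorphic functions can be composed
    and, where they are injective, inverted, and the theorem follows by doing so.

    Put [P z = phi (e^{iz})] ([param]).  Near the real axis [P] is holomorphic, and it
    takes a value twice only at points that differ by a multiple of [2 pi], so it is
    locally conformal.  If [g] extends [f] to a neighbourhood of the curve, then
    [g o P] continues [t |-> f (phi (e^{it}))], which is therefore analytic
    ([extension_analytic_parameter]).  Conversely, a local continuation [H] of that
    function gives the local extension [H o P^{-1}] of [f].  Two such extensions agree:
    the continuations involved agree on the real axis up to a period, hence also close
    to it, by the identity theorem.  So they fit together to one extension
    ([analytic_parameter_extends]).

    For the arc length, [s' = |P'|] on the real axis.  There
    [|P'|^2 = P'(z) * conj (P' (conj z))], whose right-hand side is holomorphic and has
    no zero on the axis.  A holomorphic square root of it has a primitive, which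
    continues [s] ([arc_length_extension]), and the local inverse of this primitive
    continues [s^{-1}].  Composition with either one exchanges the two parameters.

    That the curve is exactly the image of the unit circle is topology.  A limit point
    of a component of the complement of [gamma] that is not in the component lies on
    [gamma] ([circle_image_in_curve]).  If the image missed a point of
    [gamma = F (circle)], then [F^{-1} o phi] would embed a circle in a circle without
    a point, that is in a line, which the intermediate value theorem forbids
    ([curve_in_circle_image]).

    Holomorphic means complex differentiable at each point, with no condition on the
    derivative, so the function theory starts from Goursat's bisection.  It is applied
    to the rectangle of parameters of the contraction [z + l c(t)] of a curve to [z],
    which leads at once to Cauchy's formula with [z] off the centre of the circle
    ([homotopy_limit], [cauchy_formula]), then to power series, the identity theorem
    and the removal of singularities.  An injective function is open by the mean value
    inequality for [1 / (f - w)], and its derivative has no zero, since the inverse is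
    differentiable even at the possible exceptional points, which are isolated and at
    which it is continuous ([conformal_local_inverse]). *)

(** * Continuity in the plane *)

Definition cdisc (c : C) (r : R) : C -> Prop := fun z => Cmod (z - c) < r.

Lemma Cmod_minus_sym (z w : C) : Cmod (z - w) = Cmod (w - z).
Proof. rewrite <- Cmod_opp. f_equal. ring. Qed.

Lemma Cmod_minus_triangle (x y z : C) : Cmod (x - z) <= Cmod (x - y) + Cmod (y - z).
Proof. replace (x - z)%C with ((x - y) + (y - z))%C by ring. apply Cmod_triangle. Qed.

Lemma Cmod_triangle_rev (x y : C) : Cmod x - Cmod y <= Cmod (x - y).
Proof.
  generalize (Cmod_triangle (x - y) y). replace (x - y + y)%C with x by ring. lra.
Qed.

Lemma Cmod_self (z : C) : Cmod (z - z) = 0.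
Proof. replace (z - z)%C with (RtoC 0) by ring. apply Cmod_0. Qed.

Lemma Cmod_pos (z : C) : z <> 0 -> 0 < Cmod z.
Proof. apply Cmod_gt_0. Qed.

Lemma Cmod_neq_0 (z : C) : 0 < Cmod z -> z <> 0.
Proof. apply Cmod_gt_0. Qed.

Lemma Cminus_eq_0 (z w : C) : (z - w = 0)%C -> z = w.
Proof. intros H. replace z with (z - w + w)%C by ring. rewrite H. ring. Qed.

Lemma cdisc_center (c : C) (r : R) : 0 < r -> cdisc c r c.
Proof. intros H. unfold cdisc. rewrite Cmod_self. exact H. Qed.

Lemma locally_C_iff (z : C) (P : C -> Prop) :
  @locally C_UniformSpace z P <->
  exists d, 0 < d /\ forall w, Cmod (w - z) < d -> P w.
Proof.
  split.
  - intros H.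
    destruct (locally_norm_le_locally (V := C_NormedModule) z P H) as [d Hd].
    exists d. split; [apply cond_pos|]. intros w Hw. apply Hd. exact Hw.
  - intros (d & Hd & H).
    apply (locally_le_locally_norm (V := C_NormedModule) z P).
    exists (mkposreal d Hd). intros w Hw. apply H. exact Hw.
Qed.

Lemma open_C_iff (U : C -> Prop) :
  @open C_UniformSpace U <->
  forall z, U z -> exists d, 0 < d /\ forall w, Cmod (w - z) < d -> U w.
Proof.
  unfold open. split; intros H z Hz.
  - now apply locally_C_iff, H.
  - now apply locally_C_iff, H.
Qed.

Lemma locally_R_iff (x : R) (P : R -> Prop) :
  @locally R_UniformSpace x P <->
  exists d, 0 < d /\ forall y, Rabs (y - x) < d -> P y.
Proof.
  split.
  - intros [d Hd]. exists d. split; [apply cond_pos|]. intros y Hy. now apply Hd.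
  - intros (d & Hd & H). exists (mkposreal d Hd). intros y Hy. now apply H.
Qed.

Lemma continuous_C_iff {U : UniformSpace} (f : U -> C) (x : U) :
  @continuous U C_UniformSpace f x <->
  forall eps, 0 < eps -> locally x (fun y => Cmod (f y - f x) < eps).
Proof.
  split.
  - intros H eps Heps. apply (H (fun w => Cmod (w - f x) < eps)).
    apply locally_C_iff. now exists eps.
  - intros H P HP. apply locally_C_iff in HP. destruct HP as (d & Hd & HP).
    unfold filtermap. generalize (H d Hd). apply filter_imp. intros y. apply HP.
Qed.

Lemma continuous_CC_iff (f : C -> C) (z : C) :
  @continuous C_UniformSpace C_UniformSpace f z <->
  forall eps, 0 < eps -> exists d, 0 < d /\
    forall w, Cmod (w - z) < d -> Cmod (f w - f z) < eps.
Proof.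
  rewrite continuous_C_iff. split; intros H eps He; apply locally_C_iff, H, He.
Qed.

Lemma continuous_RC_iff (f : R -> C) (t : R) :
  @continuous R_UniformSpace C_UniformSpace f t <->
  forall eps, 0 < eps -> exists d, 0 < d /\
    forall u, Rabs (u - t) < d -> Cmod (f u - f t) < eps.
Proof.
  rewrite continuous_C_iff. split; intros H eps He; apply locally_R_iff, H, He.
Qed.

Section ContinuousOps.
Context {U : UniformSpace}.
Implicit Types f g : U -> C_UniformSpace.

Lemma continuous_Cplus f g x :
  continuous f x -> continuous g x -> continuous (fun y => (f y + g y)%C : C_UniformSpace) x.
Proof.
  rewrite 3!continuous_C_iff. intros Hf Hg eps He.
  assert (H2 : 0 < eps / 2) by lra.
  generalize (filter_and _ _ (Hf _ H2) (Hg _ H2)). apply filter_imp. intros y [H1 H3].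
  replace (f y + g y - (f x + g x))%C with ((f y - f x) + (g y - g x))%C by ring.
  eapply Rle_lt_trans; [apply Cmod_triangle|]. lra.
Qed.

Lemma continuous_Cmult f g x :
  continuous f x -> continuous g x -> continuous (fun y => (f y * g y)%C : C_UniformSpace) x.
Proof.
  rewrite 3!continuous_C_iff. intros Hf Hg eps He.
  set (M := Cmod (f x) + Cmod (g x) + 1).
  assert (HM : 1 <= M) by (unfold M; generalize (Cmod_ge_0 (f x)) (Cmod_ge_0 (g x)); lra).
  set (e := Rmin 1 (eps / (3 * M))).
  assert (He' : 0 < eps / (3 * M)) by (apply Rdiv_lt_0_compat; lra).
  assert (H2 : 0 < e) by (apply Rmin_glb_lt; lra).
  generalize (filter_and _ _ (Hf _ H2) (Hg _ H2)). apply filter_imp. intros y [H1 H3].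
  replace (f y * g y - f x * g x)%C
    with ((f y - f x) * (g y - g x) + ((f y - f x) * g x + f x * (g y - g x)))%C by ring.
  eapply Rle_lt_trans; [apply Cmod_triangle|].
  eapply Rle_lt_trans; [apply Rplus_le_compat_l, Cmod_triangle|].
  rewrite 3!Cmod_mult.
  assert (Hem : e * (3 * M) <= eps).
  { replace eps with (eps / (3 * M) * (3 * M)) by (field; lra).
    apply Rmult_le_compat_r; [lra|apply Rmin_r]. }
  assert (He1 : e <= 1) by apply Rmin_l.
  set (A := Cmod (f y - f x)) in *. set (B := Cmod (g y - g x)) in *.
  assert (0 <= A) by apply Cmod_ge_0. assert (0 <= B) by apply Cmod_ge_0.
  assert (A * B <= e * 1) by (apply Rmult_le_compat; lra).
  assert (A * Cmod (g x) <= e * Cmod (g x)) by (apply Rmult_le_compat_r; [apply Cmod_ge_0|lra]).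
  assert (Cmod (f x) * B <= Cmod (f x) * e) by (apply Rmult_le_compat_l; [apply Cmod_ge_0|lra]).
  assert (e * M < e * (3 * M)) by (apply Rmult_lt_compat_l; lra).
  unfold M in *. lra.
Qed.

Lemma continuous_Cconst (c : C) x : continuous (fun _ : U => c : C_UniformSpace) x.
Proof. apply continuous_const. Qed.

Lemma continuous_Cminus f g x :
  continuous f x -> continuous g x -> continuous (fun y => (f y - g y)%C : C_UniformSpace) x.
Proof.
  intros Hf Hg.
  apply continuous_ext with (fun y => (f y + (- RtoC 1) * g y)%C : C_UniformSpace).
  { intros y. change (f y + (- RtoC 1) * g y = f y - g y)%C. ring. }
  apply continuous_Cplus; [exact Hf|]. apply continuous_Cmult; [|exact Hg].
  apply continuous_Cconst.
Qed.

Lemma continuous_Cinv f x :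
  f x <> RtoC 0 -> continuous f x -> continuous (fun y => (/ f y)%C : C_UniformSpace) x.
Proof.
  rewrite 2!continuous_C_iff. intros H0 Hf eps He.
  set (m := Cmod (f x)). assert (Hm : 0 < m) by now apply Cmod_pos.
  set (e := Rmin (m / 2) (eps * (m * m / 2))).
  assert (0 < eps * (m * m / 2)) by (apply Rmult_lt_0_compat; nra).
  assert (H2 : 0 < e) by (apply Rmin_glb_lt; lra).
  generalize (Hf _ H2). apply filter_imp. intros y Hy.
  assert (e <= m / 2) by apply Rmin_l.
  assert (He2 : e <= eps * (m * m / 2)) by apply Rmin_r.
  assert (Hfy : m / 2 < Cmod (f y)).
  { generalize (Cmod_triangle_rev (f x) (f y)). rewrite (Cmod_minus_sym (f x)). fold m. lra. }
  assert (f y <> RtoC 0) by (apply Cmod_neq_0; lra).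
  replace (/ f y - / f x)%C with ((f x - f y) / (f y * f x))%C by (field; auto).
  rewrite Cmod_div by now apply Cmult_neq_0.
  rewrite Cmod_mult, Cmod_minus_sym. fold m.
  apply Rmult_lt_reg_r with (Cmod (f y) * m); [nra|].
  replace (Cmod (f y - f x) / (Cmod (f y) * m) * (Cmod (f y) * m)) with (Cmod (f y - f x))
    by (field; lra).
  eapply Rlt_le_trans; [exact Hy|]. eapply Rle_trans; [exact He2|].
  apply Rmult_le_compat_l; [lra|]. nra.
Qed.

Lemma continuous_Ccomp (f : U -> C_UniformSpace) (g : C -> C) x :
  continuous f x -> @continuous C_UniformSpace C_UniformSpace g (f x) ->
  continuous (fun y => g (f y) : C_UniformSpace) x.
Proof. intros Hf Hg. now apply (continuous_comp f g). Qed.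

Lemma continuous_Cmod f x :
  continuous f x -> @continuous U R_UniformSpace (fun y => Cmod (f y)) x.
Proof.
  rewrite continuous_C_iff. intros Hf P HP. apply locally_R_iff in HP.
  destruct HP as (d & Hd & HP). generalize (Hf d Hd). unfold filtermap.
  apply filter_imp. intros y Hy. apply HP. apply Rabs_def1.
  - generalize (Cmod_triangle_rev (f y) (f x)). lra.
  - generalize (Cmod_triangle_rev (f x) (f y)). rewrite (Cmod_minus_sym (f x)). lra.
Qed.
End ContinuousOps.

Lemma continuous_RtoC (t : R) :
  @continuous R_UniformSpace C_UniformSpace RtoC t.
Proof.
  apply continuous_RC_iff. intros eps He. exists eps. split; [exact He|].
  intros u Hu. now rewrite <- RtoC_minus, Cmod_R.
Qed.

(** * Complex derivatives *)

(** Complex differentiability in terms of the modulus alone, which frees the calculus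
    below from the choice among the uniform structures of the plane. *)
Definition Cderiv (f : C -> C) (z l : C) : Prop :=
  forall eps, 0 < eps -> exists d, 0 < d /\ forall w, Cmod (w - z) < d ->
    Cmod (f w - f z - l * (w - z)) <= eps * Cmod (w - z).

Lemma Cderiv_is_derive (f : C -> C) (z l : C) :
  Cderiv f z l <-> @is_derive C_AbsRing C_NormedModule f z l.
Proof.
  split.
  - intros H. split; [apply (is_linear_scal_l (V := C_NormedModule))|].
    intros x Hx. apply (is_filter_lim_locally_unique (V := AbsRing_NormedModule C_AbsRing)) in Hx. subst x.
    intros eps. destruct (H eps (cond_pos eps)) as (d & Hd & Hw).
    exists (mkposreal d Hd). intros w Hb. specialize (Hw w Hb).
    rewrite Cmult_comm in Hw. exact Hw.
  - intros [_ H] eps He.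
    assert (Hl : is_filter_lim (locally (T := AbsRing_UniformSpace C_AbsRing) z) z)
      by (intros P HP; exact HP).
    destruct (H z Hl (mkposreal eps He)) as [d Hd].
    exists d. split; [apply cond_pos|]. intros w Hw. rewrite (Cmult_comm l).
    exact (Hd w Hw).
Qed.

Lemma ex_derive_Cderiv (f : C -> C) (z : C) :
  @ex_derive C_AbsRing C_NormedModule f z <-> exists l, Cderiv f z l.
Proof.
  split; intros [l Hl]; exists l; now apply Cderiv_is_derive.
Qed.

(** With a difference quotient that is continuous at the point, the rules for products,
    composites and inverses become identities between functions. *)
Lemma Cderiv_caratheodory (f : C -> C) (z l : C) :
  Cderiv f z l <->
  exists q : C -> C, @continuous C_UniformSpace C_UniformSpace q z /\ q z = l /\
    forall w, f w = (f z + q w * (w - z))%C.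
Proof.
  split.
  - intros H.
    exists (fun w => if Ceq_dec w z then l else ((f w - f z) / (w - z))%C).
    split; [|split].
    + apply continuous_CC_iff. intros eps He.
      assert (He2 : 0 < eps / 2) by lra.
      destruct (H _ He2) as (d & Hd & Hw). exists d. split; [exact Hd|].
      intros w Hwd. destruct (Ceq_dec z z) as [_|n]; [|now destruct n].
      destruct (Ceq_dec w z) as [E|E].
      * rewrite Cmod_self. exact He.
      * assert (Hwz : (w - z <> 0)%C) by (now apply Cminus_eq_contra).
        replace ((f w - f z) / (w - z) - l)%C with ((f w - f z - l * (w - z)) / (w - z))%C
          by (now field).
        rewrite Cmod_div by exact Hwz.
        assert (Hp := Cmod_pos _ Hwz).
        apply Rmult_lt_reg_r with (Cmod (w - z)); [exact Hp|].
        unfold Rdiv. rewrite Rmult_assoc, Rinv_l, Rmult_1_r by lra.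
        eapply Rle_lt_trans; [now apply Hw|]. nra.
    + destruct (Ceq_dec z z) as [_|n]; [reflexivity|now destruct n].
    + intros w. destruct (Ceq_dec w z) as [E|E].
      * subst. ring.
      * field. now apply Cminus_eq_contra.
  - intros (q & Hq & Hz & Hw) eps He. assert (Hq2 := proj1 (continuous_CC_iff q z) Hq).
    destruct (Hq2 eps He) as (d & Hd & Hc). exists d. split; [exact Hd|].
    intros w Hwd. rewrite (Hw w).
    replace (f z + q w * (w - z) - f z - l * (w - z))%C with ((q w - q z) * (w - z))%C
      by (rewrite Hz; ring).
    rewrite Cmod_mult. apply Rmult_le_compat_r; [apply Cmod_ge_0|].
    left. now apply Hc.
Qed.

Lemma Cderiv_continuous (f : C -> C) (z l : C) :
  Cderiv f z l -> @continuous C_UniformSpace C_UniformSpace f z.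
Proof.
  intros H. apply Cderiv_caratheodory in H. destruct H as (q & Hq & _ & Hw).
  apply continuous_ext with (fun w => (f z + q w * (w - z))%C : C_UniformSpace).
  { intros w. now rewrite <- Hw. }
  apply continuous_Cplus; [apply continuous_Cconst|].
  apply continuous_Cmult; [exact Hq|].
  apply continuous_Cminus; [apply continuous_id|apply continuous_Cconst].
Qed.

Lemma Cderiv_ext_loc (f g : C -> C) (z l : C) (d : R) :
  0 < d -> (forall w, Cmod (w - z) < d -> f w = g w) -> Cderiv f z l -> Cderiv g z l.
Proof.
  intros Hd He H eps Heps. destruct (H eps Heps) as (d' & Hd' & Hw).
  exists (Rmin d d'). split; [now apply Rmin_glb_lt|]. intros w Hwd.
  assert (Rmin d d' <= d) by apply Rmin_l. assert (Rmin d d' <= d') by apply Rmin_r.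
  rewrite <- (He w), <- (He z) by (rewrite ?Cmod_self; lra).
  apply Hw. lra.
Qed.

Lemma Cderiv_const (c z : C) : Cderiv (fun _ => c) z 0.
Proof.
  apply Cderiv_caratheodory. exists (fun _ => RtoC 0). split; [|split].
  - apply continuous_Cconst.
  - reflexivity.
  - intros w. ring.
Qed.

Lemma Cderiv_id (z : C) : Cderiv (fun w => w) z 1.
Proof.
  apply Cderiv_caratheodory. exists (fun _ => RtoC 1). split; [|split].
  - apply continuous_Cconst.
  - reflexivity.
  - intros w. ring.
Qed.

Lemma Cderiv_plus (f g : C -> C) (z l m : C) :
  Cderiv f z l -> Cderiv g z m -> Cderiv (fun w => f w + g w)%C z (l + m)%C.
Proof.
  rewrite 3!Cderiv_caratheodory. intros (q & Hq & Hz & Hw) (p & Hp & Hz' & Hw').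
  exists (fun w => q w + p w)%C. split; [|split].
  - now apply continuous_Cplus.
  - now rewrite Hz, Hz'.
  - intros w. rewrite (Hw w), (Hw' w). ring.
Qed.

Lemma Cderiv_mult (f g : C -> C) (z l m : C) :
  Cderiv f z l -> Cderiv g z m ->
  Cderiv (fun w => f w * g w)%C z (l * g z + f z * m)%C.
Proof.
  intros Hf Hg. assert (Hc := Cderiv_continuous _ _ _ Hg). revert Hf Hg.
  rewrite 3!Cderiv_caratheodory. intros (q & Hq & Hz & Hw) (p & Hp & Hz' & Hw').
  exists (fun w => q w * g w + f z * p w)%C. split; [|split].
  - apply continuous_Cplus; apply continuous_Cmult; trivial. apply continuous_Cconst.
  - now rewrite Hz, Hz'.
  - intros w. rewrite (Hw w), (Hw' w). ring.
Qed.

Lemma Cderiv_comp (f g : C -> C) (z l m : C) :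
  Cderiv f (g z) l -> Cderiv g z m -> Cderiv (fun w => f (g w)) z (l * m)%C.
Proof.
  intros Hf Hg. assert (Hc := Cderiv_continuous _ _ _ Hg). revert Hf Hg.
  rewrite 3!Cderiv_caratheodory. intros (q & Hq & Hz & Hw) (p & Hp & Hz' & Hw').
  exists (fun w => q (g w) * p w)%C. split; [|split].
  - apply continuous_Cmult; trivial. now apply continuous_Ccomp.
  - now rewrite Hz, Hz'.
  - intros w. rewrite (Hw (g w)), (Hw' w). ring.
Qed.

Lemma Cderiv_inv (f : C -> C) (z l : C) :
  f z <> 0 -> Cderiv f z l -> Cderiv (fun w => / f w)%C z (- l / (f z * f z))%C.
Proof.
  intros H0 Hf. assert (Hc := Cderiv_continuous _ _ _ Hf).
  assert (Hnz : exists d, 0 < d /\ forall w, Cmod (w - z) < d -> f w <> RtoC 0).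
  { destruct (proj1 (continuous_CC_iff f z) Hc (Cmod (f z)) (Cmod_pos _ H0)) as (d & Hd & Hw). exists d. split; [exact Hd|]. intros w Hwd E.
    specialize (Hw w Hwd). rewrite E in Hw.
    replace (0 - f z)%C with (- f z)%C in Hw by ring. rewrite Cmod_opp in Hw. lra. }
  destruct Hnz as (d & Hd & Hnz).
  apply Cderiv_caratheodory in Hf. destruct Hf as (q & Hq & Hz & Hw).
  (* the explicit quotient is only correct where [f] does not vanish *)
  apply Cderiv_ext_loc with (f := fun w => (/ f z + (- q w / (f w * f z)) * (w - z))%C) (d := d).
  - exact Hd.
  - intros w Hwd. specialize (Hnz w Hwd).
    assert (E : (q w * (w - z) = f w - f z)%C) by (rewrite (Hw w) at 1; ring).
    replace (/ f z + - q w / (f w * f z) * (w - z))%C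
      with (/ f z - (q w * (w - z)) / (f w * f z))%C by (now field).
    rewrite E. now field.
  - apply Cderiv_caratheodory. exists (fun w => (- q w / (f w * f z))%C). split; [|split].
    + apply continuous_Cmult.
      * apply continuous_ext with (fun w => (0 - q w)%C : C_UniformSpace).
        { intros w. change (0 - q w = - q w)%C. ring. }
        apply continuous_Cminus; [apply continuous_Cconst|exact Hq].
      * apply continuous_Cinv; [now apply Cmult_neq_0|].
        apply continuous_Cmult; [exact Hc|apply continuous_Cconst].
    + now rewrite Hz.
    + intros w. replace (z - z)%C with (RtoC 0) by ring. ring.
Qed.

Lemma Cderiv_unique (f : C -> C) (z l m : C) : Cderiv f z l -> Cderiv f z m -> l = m.
Proof.
  intros H1 H2. apply Cderiv_is_derive, is_C_derive_unique in H1.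
  apply Cderiv_is_derive, is_C_derive_unique in H2. congruence.
Qed.

(** * Curves *)

Definition Rderiv (c : R -> C) (t : R) (v : C) : Prop :=
  @is_derive R_AbsRing C_R_NormedModule c t v.

Lemma Rderiv_iff (c : R -> C) (t : R) (v : C) :
  Rderiv c t v <->
  forall eps, 0 < eps -> exists d, 0 < d /\ forall u, Rabs (u - t) < d ->
    Cmod (c u - c t - RtoC (u - t) * v) <= eps * Rabs (u - t).
Proof.
  split.
  - intros [_ H] eps He.
    assert (Hl : is_filter_lim (locally (T := R_UniformSpace) t) t)
      by (intros P HP; exact HP).
    destruct (H t Hl (mkposreal eps He)) as [d Hd].
    exists d. split; [apply cond_pos|]. intros u Hu. rewrite <- scal_R_Cmult, Cmod_norm.
    exact (Hd u Hu).
  - intros H. split; [apply (is_linear_scal_l (V := C_R_NormedModule))|].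
    intros x Hx. apply (is_filter_lim_locally_unique (V := R_NormedModule)) in Hx. subst x.
    intros eps. destruct (H eps (cond_pos eps)) as (d & Hd & Hw).
    exists (mkposreal d Hd). intros u Hb. specialize (Hw u Hb).
    rewrite <- scal_R_Cmult, Cmod_norm in Hw. exact Hw.
Qed.

Lemma Rderiv_continuous (c : R -> C) (t : R) (v : C) :
  Rderiv c t v -> @continuous R_UniformSpace C_UniformSpace c t.
Proof.
  intros H. apply (ex_derive_continuous (V := C_R_NormedModule)). now exists v.
Qed.

Lemma Rderiv_comp (f : C -> C) (c : R -> C) (t : R) (l v : C) :
  Cderiv f (c t) l -> Rderiv c t v -> Rderiv (fun u => f (c u)) t (l * v)%C.
Proof.
  intros Hf Hc. assert (Hcont := proj1 (continuous_RC_iff c t) (Rderiv_continuous _ _ _ Hc)).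
  apply Rderiv_iff. intros eps He.
  set (V := Cmod v + 1). assert (HV : 1 <= V) by (unfold V; generalize (Cmod_ge_0 v); lra).
  set (L := Cmod l + 1). assert (HL : 1 <= L) by (unfold L; generalize (Cmod_ge_0 l); lra).
  assert (He1 : 0 < eps / 2 / V) by (repeat apply Rdiv_lt_0_compat; lra).
  assert (He2 : 0 < Rmin 1 (eps / 2 / L)).
  { apply Rmin_glb_lt; [lra|]. repeat apply Rdiv_lt_0_compat; lra. }
  destruct (Hf _ He1) as (d1 & Hd1 & H1).
  destruct (proj1 (Rderiv_iff _ _ _) Hc _ He2) as (d2 & Hd2 & H2).
  destruct (Hcont _ Hd1) as (d3 & Hd3 & H3).
  exists (Rmin d2 d3). split; [now apply Rmin_glb_lt|]. intros u Hu.
  assert (Hu2 : Rabs (u - t) < d2) by (eapply Rlt_le_trans; [exact Hu|apply Rmin_l]).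
  assert (Hu3 : Rabs (u - t) < d3) by (eapply Rlt_le_trans; [exact Hu|apply Rmin_r]).
  specialize (H2 u Hu2). specialize (H1 (c u) (H3 u Hu3)).
  set (x := Rabs (u - t)) in *. assert (0 <= x) by apply Rabs_pos.
  assert (Hcu : Cmod (c u - c t) <= V * x).
  { replace (c u - c t)%C with ((c u - c t - RtoC (u - t) * v) + RtoC (u - t) * v)%C by ring.
    eapply Rle_trans; [apply Cmod_triangle|]. rewrite Cmod_mult, Cmod_R. fold x.
    assert (Rmin 1 (eps / 2 / L) <= 1) by apply Rmin_l. unfold V. nra. }
  replace (f (c u) - f (c t) - RtoC (u - t) * (l * v))%C
    with ((f (c u) - f (c t) - l * (c u - c t)) + l * (c u - c t - RtoC (u - t) * v))%C by ring.
  eapply Rle_trans; [apply Cmod_triangle|]. rewrite Cmod_mult.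
  assert (A1 : eps / 2 / V * Cmod (c u - c t) <= eps / 2 * x).
  { replace (eps / 2 * x) with (eps / 2 / V * (V * x)) by (field; lra).
    apply Rmult_le_compat_l; lra. }
  assert (A2 : Cmod l * Cmod (c u - c t - RtoC (u - t) * v) <= eps / 2 * x).
  { replace (eps / 2 * x) with (L * (eps / 2 / L * x)) by (field; lra).
    apply Rmult_le_compat; try apply Cmod_ge_0; [unfold L; lra|].
    eapply Rle_trans; [exact H2|]. apply Rmult_le_compat_r; [lra|apply Rmin_r]. }
  lra.
Qed.

Lemma Rderiv_fst (c : R -> C) (t : R) (v : C) :
  Rderiv c t v -> is_derive (fun u => fst (c u)) t (fst v).
Proof.
  intros H. apply is_derive_Reals. intros eps He.
  assert (He2 : 0 < eps / 2) by lra.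
  destruct (proj1 (Rderiv_iff _ _ _) H _ He2) as (d & Hd & Hw).
  exists (mkposreal d Hd). intros h Hh Hhd. simpl in Hhd.
  specialize (Hw (t + h)). replace (t + h - t) with h in Hw by ring. specialize (Hw Hhd).
  replace ((fst (c (t + h)) - fst (c t)) / h - fst v)
    with (fst (c (t + h)%R - c t - RtoC h * v)%C / h).
  2:{ unfold Cminus, Cplus, Copp, Cmult, RtoC. simpl. field. exact Hh. }
  rewrite Rabs_div by exact Hh.
  assert (Hp : 0 < Rabs h) by now apply Rabs_pos_lt.
  apply Rmult_lt_reg_r with (Rabs h); [exact Hp|].
  unfold Rdiv. rewrite Rmult_assoc, Rinv_l, Rmult_1_r by lra.
  eapply Rle_lt_trans; [apply re_le_Cmod|]. eapply Rle_lt_trans; [exact Hw|]. nra.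
Qed.

Lemma Rderiv_Cmult_l (k : C) (c : R -> C) (t : R) (v : C) :
  Rderiv c t v -> Rderiv (fun u => k * c u)%C t (k * v)%C.
Proof.
  intros H. apply (Rderiv_comp (fun w => k * w)%C c t k v); [|exact H].
  generalize (Cderiv_mult _ _ _ _ _ (Cderiv_const k (c t)) (Cderiv_id (c t))).
  now replace (0 * c t + k * 1)%C with k by ring.
Qed.

(** The imaginary part of a curve is the real part of its product with [-i]. *)
Lemma Rderiv_snd (c : R -> C) (t : R) (v : C) :
  Rderiv c t v -> is_derive (fun u => snd (c u)) t (snd v).
Proof.
  intros H. apply (Rderiv_Cmult_l (- Ci)%C) in H. apply Rderiv_fst in H.
  replace (fst (- Ci * v)%C) with (snd v) in H by (unfold Ci, Cmult, Copp; simpl; ring).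
  apply is_derive_ext with (2 := H). intros u. unfold Ci, Cmult, Copp; simpl; ring.
Qed.

Lemma Rderiv_pair (f g : R -> R) (t a b : R) :
  is_derive f t a -> is_derive g t b -> Rderiv (fun u => (f u, g u)) t (a, b).
Proof.
  intros Hf Hg. apply Rderiv_iff. intros eps He.
  assert (He2 : 0 < eps / 2) by lra.
  destruct Hf as [_ Hf]. destruct Hg as [_ Hg].
  assert (Hl : is_filter_lim (locally (T := R_UniformSpace) t) t) by (intros P HP; exact HP).
  destruct (Hf t Hl (mkposreal _ He2)) as [d1 H1].
  destruct (Hg t Hl (mkposreal _ He2)) as [d2 H2].
  exists (Rmin d1 d2). split; [apply Rmin_glb_lt; apply cond_pos|]. intros u Hu.
  assert (Hu2 : Rabs (u - t) < d1) by (eapply Rlt_le_trans; [exact Hu|apply Rmin_l]).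
  assert (Hu3 : Rabs (u - t) < d2) by (eapply Rlt_le_trans; [exact Hu|apply Rmin_r]).
  specialize (H1 u Hu2). specialize (H2 u Hu3). simpl in H1, H2.
  change (Rabs (f u - f t - (u - t) * a) <= eps / 2 * Rabs (u - t)) in H1.
  change (Rabs (g u - g t - (u - t) * b) <= eps / 2 * Rabs (u - t)) in H2.
  set (p := f u - f t - (u - t) * a) in *. set (q := g u - g t - (u - t) * b) in *.
  replace ((f u, g u) - (f t, g t) - RtoC (u - t) * (a, b))%C
    with (RtoC p + Ci * RtoC q)%C.
  2:{ unfold p, q, Cminus, Cplus, Copp, Cmult, RtoC, Ci. simpl. f_equal; ring. }
  eapply Rle_trans; [apply Cmod_triangle|]. rewrite Cmod_mult, 2!Cmod_R, Cmod_Ci. lra.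
Qed.

Lemma RtoC_derive (t : R) : Rderiv RtoC t 1.
Proof.
  apply (Rderiv_pair (fun u => u) (fun _ => 0)); apply is_derive_Reals;
    [apply derivable_pt_lim_id|apply derivable_pt_lim_const].
Qed.

Lemma Rderiv_unique (c : R -> C) (t : R) (v w : C) : Rderiv c t v -> Rderiv c t w -> v = w.
Proof.
  intros H1 H2.
  generalize (is_derive_unique _ _ _ (Rderiv_fst _ _ _ H1)) (is_derive_unique _ _ _ (Rderiv_fst _ _ _ H2))
    (is_derive_unique _ _ _ (Rderiv_snd _ _ _ H1)) (is_derive_unique _ _ _ (Rderiv_snd _ _ _ H2)).
  intros. apply injective_projections; congruence.
Qed.

Lemma Cmod_cis (t : R) : Cmod (cis t) = 1.
Proof.
  unfold Cmod, cis. simpl.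
  replace (cos t * (cos t * 1) + sin t * (sin t * 1)) with 1; [apply sqrt_1|].
  generalize (sin2_cos2 t). unfold Rsqr. lra.
Qed.

Lemma cis_derive (t : R) : Rderiv cis t (Ci * cis t)%C.
Proof.
  replace (Ci * cis t)%C with ((- sin t, cos t) : C)
    by (unfold Ci, cis, Cmult; simpl; f_equal; ring).
  apply Rderiv_pair; apply is_derive_Reals; [apply derivable_pt_lim_cos|apply derivable_pt_lim_sin].
Qed.

Lemma cis_continuous (t : R) : @continuous R_UniformSpace C_UniformSpace cis t.
Proof. exact (Rderiv_continuous _ _ _ (cis_derive t)). Qed.

Lemma cis_plus (s t : R) : cis (s + t) = (cis s * cis t)%C.
Proof. unfold cis, Cmult. simpl. rewrite cos_plus, sin_plus. f_equal; ring. Qed.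

Lemma cis_0 : cis 0 = RtoC 1.
Proof. unfold cis, RtoC. now rewrite cos_0, sin_0. Qed.

Lemma cis_2PI : cis (2 * PI) = RtoC 1.
Proof. unfold cis, RtoC. now rewrite cos_2PI, sin_2PI. Qed.

Lemma cis_period (t : R) (k : Z) : cis (t + 2 * IZR k * PI) = cis t.
Proof.
  assert (S : sin (IZR k * PI) = 0) by (apply sin_eq_0_1; now exists k).
  rewrite cis_plus. replace (cis (2 * IZR k * PI)) with (RtoC 1); [ring|].
  unfold cis, RtoC. replace (2 * IZR k * PI) with (2 * (IZR k * PI)) by ring.
  rewrite cos_2a_sin, sin_2a, S. f_equal; ring.
Qed.

Lemma cis_eq (s t : R) : cis s = cis t -> exists k : Z, s = t + 2 * IZR k * PI.
Proof.
  intros H. unfold cis in H. injection H as Hc Hs.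
  (* [1 - cos (s - t) = 2 sin^2 ((s - t) / 2)] vanishes. *)
  assert (E : cos (s - t) = 1).
  { rewrite cos_minus, Hc, Hs. generalize (sin2_cos2 t). unfold Rsqr. lra. }
  assert (S : sin ((s - t) / 2) = 0).
  { replace (s - t) with (2 * ((s - t) / 2)) in E by field. rewrite cos_2a_sin in E. nra. }
  destruct (sin_eq_0_0 _ S) as [k Hk]. exists k. lra.
Qed.

(** * Integrals of complex-valued functions *)

Definition CInt (f : R -> C) (a b : R) : C := @RInt C_R_CompleteNormedModule f a b.

Definition Ccontinuous_on (f : R -> C) (a b : R) : Prop :=
  forall t, a <= t <= b -> @continuous R_UniformSpace C_UniformSpace f t.

Lemma CInt_correct (f : R -> C) (a b : R) :
  a <= b -> Ccontinuous_on f a b -> @is_RInt C_R_NormedModule f a b (CInt f a b).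
Proof.
  intros Hab H. apply (RInt_correct (V := C_R_CompleteNormedModule)).
  apply (ex_RInt_continuous (V := C_R_CompleteNormedModule)).
  intros z Hz. rewrite Rmin_left, Rmax_right in Hz by exact Hab. now apply H.
Qed.

Lemma CInt_unique (f : R -> C) (a b : R) (l : C) :
  @is_RInt C_R_NormedModule f a b l -> CInt f a b = l.
Proof. apply (is_RInt_unique (V := C_R_CompleteNormedModule)). Qed.

(** All limits of integrals below are taken through this bound, the integral of [p]
    being known in closed form. *)
Lemma CInt_close (f p : R -> C) (a b m : R) (lp : C) :
  a <= b -> Ccontinuous_on f a b -> @is_RInt C_R_NormedModule p a b lp ->
  (forall t, a <= t <= b -> Cmod (f t - p t) <= m) ->
  Cmod (CInt f a b - lp) <= m * (b - a).
Proof.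
  rewrite Cmod_norm. intros Hab Hf Hp Hm.
  assert (H := is_RInt_minus (V := C_R_NormedModule) _ _ _ _ _ _ (CInt_correct f a b Hab Hf) Hp).
  replace (m * (b - a)) with (scal (b - a) m) by (rewrite Rmult_comm; reflexivity).
  refine (norm_RInt_le (V := C_R_NormedModule) _ (fun _ => m) a b _ _ Hab _ H _).
  - intros t Ht. specialize (Hm t Ht). rewrite Cmod_norm in Hm. exact Hm.
  - apply (is_RInt_const (V := R_NormedModule)).
Qed.

Lemma is_CInt_mult (k : C) (f : R -> C) (a b : R) (l : C) :
  @is_RInt C_R_NormedModule f a b l ->
  @is_RInt C_R_NormedModule (fun t => k * f t)%C a b (k * l)%C.
Proof.
  intros H. destruct k as [x y]. destruct l as [lu lv].
  assert (H1 := is_RInt_fct_extend_fst (U := R_NormedModule) (V := R_NormedModule) f a b _ H).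
  assert (H2 := is_RInt_fct_extend_snd (U := R_NormedModule) (V := R_NormedModule) f a b _ H).
  simpl in H1, H2.
  apply (is_RInt_fct_extend_pair (U := R_NormedModule) (V := R_NormedModule)); simpl.
  - apply (is_RInt_minus (V := R_NormedModule)); now apply (is_RInt_scal (V := R_NormedModule)).
  - apply (is_RInt_plus (V := R_NormedModule)); now apply (is_RInt_scal (V := R_NormedModule)).
Qed.

Lemma is_CInt_plus (f g : R -> C) (a b : R) (l m : C) :
  @is_RInt C_R_NormedModule f a b l -> @is_RInt C_R_NormedModule g a b m ->
  @is_RInt C_R_NormedModule (fun t => f t + g t)%C a b (l + m)%C.
Proof. apply (is_RInt_plus (V := C_R_NormedModule)). Qed.

Lemma is_CInt_derive (f df : R -> C) (a b : R) :
  a <= b -> (forall t, a <= t <= b -> Rderiv f t (df t)) -> Ccontinuous_on df a b ->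
  @is_RInt C_R_NormedModule df a b (f b - f a)%C.
Proof.
  intros Hab Hd Hc.
  apply (is_RInt_derive (V := C_R_CompleteNormedModule));
    rewrite Rmin_left, Rmax_right by exact Hab; assumption.
Qed.

Lemma CInt_Chasles (f : R -> C) (a b c : R) :
  a <= b -> b <= c -> Ccontinuous_on f a c -> (CInt f a b + CInt f b c = CInt f a c)%C.
Proof.
  intros Hab Hbc Hf. symmetry. apply CInt_unique.
  apply (is_RInt_Chasles (V := C_R_NormedModule)) with b.
  - apply CInt_correct; [exact Hab|]. intros t Ht. apply Hf. lra.
  - apply CInt_correct; [exact Hbc|]. intros t Ht. apply Hf. lra.
Qed.

(** * Goursat's bisection for the contraction of a curve *)

(** [ring] and [field] recognise equations at type [C] only, not at the carrier of a
    normed module, which is convertible to it. *)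
Ltac as_C_eq := match goal with |- @eq _ ?a ?b => change (@eq C a b) end.

Lemma nested_intervals (x : nat -> R) (L : R) :
  0 <= L ->
  (forall n, x n <= x (S n) <= x n + L * (/ 2) ^ S n) ->
  exists X, forall n, x n <= X <= x n + L * (/ 2) ^ n.
Proof.
  intros HL H.
  assert (Hp : forall n, 0 < (/ 2) ^ n) by (intros n; apply pow_lt; lra).
  set (y := fun n => x n + L * (/ 2) ^ n).
  assert (Hy : forall n, y (S n) <= y n).
  { intros n. unfold y. specialize (H n). simpl in *. specialize (Hp n). nra. }
  assert (Hxy : forall n, x n <= y 0%nat).
  { intros n. apply Rle_trans with (y n).
    - unfold y. specialize (Hp n). nra.
    - induction n; [lra|]. eapply Rle_trans; [apply Hy|exact IHn]. }
  destruct (ex_finite_lim_seq_incr x (y 0%nat)) as [X HX].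
  { intros n. apply H. }
  { exact Hxy. }
  assert (HY : is_lim_seq y X).
  { replace X with (X + L * 0) by ring. apply is_lim_seq_plus'; [exact HX|].
    apply is_lim_seq_mult'; [apply is_lim_seq_const|].
    apply is_lim_seq_geom. rewrite Rabs_right; lra. }
  exists X. intros n. split.
  - apply (is_lim_seq_incr_compare x X HX). intros k. apply H.
  - apply (is_lim_seq_decr_compare y X HY Hy).
Qed.

Definition interval_additive (F : R -> R -> C) (a b : R) : Prop :=
  forall x m y, a <= x -> x <= m -> m <= y -> y <= b -> F x y = (F x m + F m y)%C.

Lemma Cmod_quarter (a b c d s : C) (m : R) :
  s = ((a + b) + (c + d))%C -> m <= Cmod s ->
  m / 4 <= Cmod a \/ m / 4 <= Cmod b \/ m / 4 <= Cmod c \/ m / 4 <= Cmod d.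
Proof.
  intros -> H. generalize (Cmod_triangle (a + b) (c + d)) (Cmod_triangle a b) (Cmod_triangle c d).
  intros. destruct (Rle_dec (m / 4) (Cmod a)); [now left|].
  destruct (Rle_dec (m / 4) (Cmod b)); [now right; left|].
  destruct (Rle_dec (m / 4) (Cmod c)); [now right; right; left|].
  right; right; right. lra.
Qed.

(** Were the value on the whole rectangle non-zero, repeated quartering would give
    rectangles shrinking to a point on which it decreases no faster than the area,
    against the local bound there. *)
Lemma additive_rectangle_zero (Phi : R -> R -> R -> R -> C) (a b p q : R) :
  a <= b -> p <= q ->
  (forall u v, p <= u -> u <= v -> v <= q -> interval_additive (fun x y => Phi x y u v) a b) ->
  (forall x y, a <= x -> x <= y -> y <= b -> interval_additive (fun u v => Phi x y u v) p q) ->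
  (forall l t, a <= l <= b -> p <= t <= q -> forall eps, 0 < eps -> exists d, 0 < d /\
     forall x y u v, a <= x -> x <= l <= y -> y <= b -> p <= u -> u <= t <= v -> v <= q ->
       (y - x) + (v - u) < d ->
       Cmod (Phi x y u v) <= eps * ((y - x) + (v - u)) ^ 2) ->
  Phi a b p q = 0.
Proof.
  intros Hab Hpq Hadd1 Hadd2 Hloc.
  destruct (Ceq_dec (Phi a b p q) 0) as [E|E]; [exact E|exfalso].
  set (m := Cmod (Phi a b p q)). assert (Hm : 0 < m) by now apply Cmod_pos.
  set (h := fun n => (/ 2) ^ n).
  assert (Hh : forall n, 0 < h n) by (intros n; apply pow_lt; lra).
  assert (HhS : forall n, h (S n) = h n / 2) by (intros n; unfold h; simpl; field).
  set (W := b - a). set (H := q - p).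
  assert (HW : 0 <= W) by (unfold W; lra). assert (HH : 0 <= H) by (unfold H; lra).
  set (good := fun n (s : R * R) =>
    a <= fst s /\ fst s + W * h n <= b /\ p <= snd s /\ snd s + H * h n <= q /\
    m * h n ^ 2 <= Cmod (Phi (fst s) (fst s + W * h n) (snd s) (snd s + H * h n))).
  set (next := fun n (s s' : R * R) =>
    fst s <= fst s' <= fst s + W * h (S n) /\ snd s <= snd s' <= snd s + H * h (S n)).
  assert (Hstep : forall n s, good n s -> exists s', good (S n) s' /\ next n s s').
  { intros n [x u]. unfold good, next. simpl fst; simpl snd. intros (H1 & H2 & H3 & H4 & H5).
    assert (Hw : 0 <= W * h (S n)) by (apply Rmult_le_pos; [lra|left; apply Hh]).
    assert (Hk : 0 <= H * h (S n)) by (apply Rmult_le_pos; [lra|left; apply Hh]).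
    replace (W * h n) with (W * h (S n) + W * h (S n)) in * by (rewrite HhS; field).
    replace (H * h n) with (H * h (S n) + H * h (S n)) in * by (rewrite HhS; field).
    replace (m * h (S n) ^ 2) with (m * h n ^ 2 / 4) by (rewrite HhS; field).
    set (w := W * h (S n)) in *. set (k := H * h (S n)) in *.
    assert (S4 : Phi x (x + (w + w)) u (u + (k + k)) =
      Cplus (Cplus (Phi x (x + w) u (u + k)) (Phi (x + w) (x + w + w) u (u + k)))
       (Cplus (Phi x (x + w) (u + k) (u + k + k)) (Phi (x + w) (x + w + w) (u + k) (u + k + k)))).
    { replace (x + (w + w)) with (x + w + w) by ring.
      replace (u + (k + k)) with (u + k + k) by ring.
      rewrite (Hadd2 x (x + w + w) ltac:(lra) ltac:(lra) ltac:(lra) u (u + k) (u + k + k)) by lra.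
      rewrite (Hadd1 u (u + k) ltac:(lra) ltac:(lra) ltac:(lra) x (x + w) (x + w + w)) by lra.
      rewrite (Hadd1 (u + k) (u + k + k) ltac:(lra) ltac:(lra) ltac:(lra) x (x + w) (x + w + w)) by lra.
      reflexivity. }
    destruct (Cmod_quarter _ _ _ _ _ _ S4 H5) as [Q|[Q|[Q|Q]]].
    - exists (x, u); simpl; repeat split; try lra; exact Q.
    - exists (x + w, u); simpl; repeat split; try lra; exact Q.
    - exists (x, u + k); simpl; repeat split; try lra; exact Q.
    - exists (x + w, u + k); simpl; repeat split; try lra; exact Q. }
  assert (H0 : good 0%nat (a, p)).
  { unfold good, h; simpl. replace (a + W * 1) with b by (unfold W; ring).
    replace (p + H * 1) with q by (unfold H; ring).
    repeat split; try lra. fold m. lra. }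
  set (step := fun n (s : {s | good n s}) =>
    constructive_indefinite_description _ (Hstep n (proj1_sig s) (proj2_sig s))).
  set (sq := nat_rect (fun n => {s | good n s}) (exist _ (a, p) H0)
    (fun n s => exist _ (proj1_sig (step n s)) (proj1 (proj2_sig (step n s))))).
  set (s := fun n => proj1_sig (sq n)).
  assert (Hg : forall n, good n (s n)) by (intros n; apply (proj2_sig (sq n))).
  assert (Hn : forall n, next n (s n) (s (S n))).
  { intros n. exact (proj2 (proj2_sig (step n (sq n)))). }
  destruct (nested_intervals (fun n => fst (s n)) W HW) as [l Hl]; [intros n; apply Hn|].
  destruct (nested_intervals (fun n => snd (s n)) H HH) as [t Ht]; [intros n; apply Hn|].
  fold h in Hl, Ht. change (forall n, fst (s n) <= l <= fst (s n) + W * h n) in Hl.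
  change (forall n, snd (s n) <= t <= snd (s n) + H * h n) in Ht.
  assert (Hl0 : a <= l <= b).
  { destruct (Hg 0%nat) as (G1 & G2 & _). specialize (Hl 0%nat). lra. }
  assert (Ht0 : p <= t <= q).
  { destruct (Hg 0%nat) as (_ & _ & G1 & G2 & _). specialize (Ht 0%nat). lra. }
  set (D := W + H + 1). assert (HD : 1 <= D) by (unfold D; lra).
  assert (Heps : 0 < m / (2 * D ^ 2)) by (apply Rdiv_lt_0_compat; nra).
  destruct (Hloc l t Hl0 Ht0 _ Heps) as (d & Hd & Hloc').
  assert (Hsmall : exists n, D * h n < d).
  { destruct (pow_lt_1_zero (/ 2)) with (y := d / D) as [n Hn'].
    - rewrite Rabs_right; lra.
    - apply Rdiv_lt_0_compat; lra.
    - exists n. specialize (Hn' n (Nat.le_refl n)). fold (h n) in Hn'.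
      rewrite Rabs_right in Hn' by (specialize (Hh n); lra).
      replace d with (D * (d / D)) by (field; lra). apply Rmult_lt_compat_l; lra. }
  destruct Hsmall as [n Hsm]. destruct (Hg n) as (G1 & G2 & G3 & G4 & G5).
  specialize (Hh n).
  assert (HDh : W * h n + H * h n <= D * h n) by (unfold D; nra).
  assert (Hbound : Cmod (Phi (fst (s n)) (fst (s n) + W * h n) (snd (s n)) (snd (s n) + H * h n))
    <= m / (2 * D ^ 2) * (W * h n + H * h n) ^ 2).
  { replace (W * h n + H * h n) with
      ((fst (s n) + W * h n - fst (s n)) + (snd (s n) + H * h n - snd (s n))) by ring.
    apply Hloc'; trivial. lra. }
  assert (Hsq : (W * h n + H * h n) ^ 2 <= (D * h n) ^ 2).
  { apply pow_incr. split; [|exact HDh].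
    assert (0 <= W * h n) by (apply Rmult_le_pos; lra).
    assert (0 <= H * h n) by (apply Rmult_le_pos; lra). lra. }
  assert (m / (2 * D ^ 2) * (W * h n + H * h n) ^ 2 <= m / 2 * h n ^ 2).
  { replace (m / 2 * h n ^ 2) with (m / (2 * D ^ 2) * (D * h n) ^ 2) by (field; lra).
    apply Rmult_le_compat_l; lra. }
  assert (0 < h n ^ 2) by (apply pow_lt; exact Hh). nra.
Qed.

(** The conditions needed to contract [z + c t] to [z] through [z + l c t].  The bounds
    hold for all times, so that they need not be rederived on subintervals. *)
Definition contracting_curve (c c' : R -> C) (M : R) : Prop :=
  (forall t, Rderiv c t (c' t)) /\
  (forall t, @continuous R_UniformSpace C_UniformSpace c' t) /\
  (forall t, c t <> 0) /\
  (forall t, Cmod (c t) <= M) /\ (forall t, Cmod (c' t) <= M) /\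
  (forall t, Cmod (c' t / c t) <= M).

Lemma Rderiv_lipschitz (c c' : R -> C) (M : R) :
  (forall t, Rderiv c t (c' t)) ->
  (forall t, @continuous R_UniformSpace C_UniformSpace c' t) ->
  (forall t, Cmod (c' t) <= M) ->
  forall t u, Cmod (c t - c u) <= M * Rabs (t - u).
Proof.
  intros Hd Hc HM.
  assert (Hle : forall t u, u <= t -> Cmod (c t - c u) <= M * (t - u)).
  { intros t u Htu.
    assert (HI := is_CInt_derive c c' u t Htu (fun x _ => Hd x) (fun x _ => Hc x)).
    assert (H0 := is_RInt_const (V := C_R_NormedModule) u t (RtoC 0)).
    rewrite <- (CInt_unique _ _ _ _ HI).
    replace (CInt c' u t) with (CInt c' u t - RtoC (t - u) * RtoC 0)%C by ring.
    rewrite scal_R_Cmult in H0.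
    apply (CInt_close c' (fun _ => RtoC 0)); [exact Htu| intros x _; apply Hc |exact H0|].
    intros x _. replace (c' x - 0)%C with (c' x) by ring. apply HM. }
  intros t u. destruct (Rle_dec u t) as [H|H].
  - rewrite Rabs_right by lra. now apply Hle.
  - rewrite Cmod_minus_sym, Rabs_left by lra. replace (- (t - u)) with (u - t) by ring.
    apply Hle. lra.
Qed.

(** In the coordinates [l], [t] of [zeta l t = z + l c t], the form [f w dw / (w - z)]
    is [radial dl + angular dt]; [boundary] is its integral around a rectangle of
    parameters.  Only [0 < l] is considered, so the pole [z] is avoided. *)
Section Homotopy.
Context (f : C -> C) (z : C) (c c' : R -> C) (M : R).

Let zeta (l t : R) : C := (z + RtoC l * c t)%C.
Let radial (l t : R) : C := (f (zeta l t) * / RtoC l)%C.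
Let angular (l t : R) : C := (f (zeta l t) * (c' t / c t))%C.
Let boundary (x y u v : R) : C :=
  ((CInt (angular y) u v - CInt (angular x) u v) -
   (CInt (fun l => radial l v) x y - CInt (fun l => radial l u) x y))%C.

Hypothesis Hc : contracting_curve c c' M.

Lemma zeta_continuous_t (l t : R) : @continuous R_UniformSpace C_UniformSpace (zeta l) t.
Proof.
  destruct Hc as (Hd & _).
  apply continuous_Cplus; [apply continuous_Cconst|].
  apply continuous_Cmult; [apply continuous_Cconst|]. exact (Rderiv_continuous _ _ _ (Hd t)).
Qed.

Lemma zeta_continuous_l (l t : R) :
  @continuous R_UniformSpace C_UniformSpace (fun l => zeta l t) l.
Proof.
  apply continuous_Cplus; [apply continuous_Cconst|].
  apply continuous_Cmult; [apply continuous_RtoC|apply continuous_Cconst].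
Qed.

Lemma kernel_continuous (t : R) :
  @continuous R_UniformSpace C_UniformSpace (fun t => c' t / c t)%C t.
Proof.
  destruct Hc as (Hd & Hc' & H0 & _).
  apply continuous_Cmult; [apply Hc'|]. apply continuous_Cinv; [apply H0|].
  exact (Rderiv_continuous _ _ _ (Hd t)).
Qed.

Lemma RtoC_neq_0 (l : R) : l <> 0 -> RtoC l <> 0.
Proof. intros H E. apply H. now injection E. Qed.

Lemma invl_continuous (l : R) : 0 < l ->
  @continuous R_UniformSpace C_UniformSpace (fun l => / RtoC l)%C l.
Proof.
  intros H. apply continuous_Cinv; [|apply continuous_RtoC]. apply RtoC_neq_0. lra.
Qed.

Lemma angular_continuous (l t : R) :
  @continuous C_UniformSpace C_UniformSpace f (zeta l t) ->
  @continuous R_UniformSpace C_UniformSpace (angular l) t.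
Proof.
  intros H. apply continuous_Cmult; [|apply kernel_continuous].
  apply continuous_Ccomp; [apply zeta_continuous_t|exact H].
Qed.

Lemma radial_continuous (l t : R) : 0 < l ->
  @continuous C_UniformSpace C_UniformSpace f (zeta l t) ->
  @continuous R_UniformSpace C_UniformSpace (fun l => radial l t) l.
Proof.
  intros Hl H. apply continuous_Cmult; [|now apply invl_continuous].
  apply (continuous_Ccomp (fun l => zeta l t) f l); [apply zeta_continuous_l|exact H].
Qed.

Lemma zeta_lipschitz (l l' t t' : R) :
  0 <= l' <= 1 -> Cmod (zeta l t - zeta l' t') <= M * (Rabs (l - l') + Rabs (t - t')).
Proof.
  intros Hl. destruct Hc as (Hd & Hc' & _ & HM & HM' & _). unfold zeta.
  replace (z + RtoC l * c t - (z + RtoC l' * c t'))%C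
    with (RtoC (l - l') * c t + RtoC l' * (c t - c t'))%C by (rewrite RtoC_minus; ring).
  eapply Rle_trans; [apply Cmod_triangle|]. rewrite 2!Cmod_mult, 2!Cmod_R.
  rewrite (Rabs_right l') by lra.
  generalize (Rderiv_lipschitz c c' M Hd Hc' HM' t t') (HM t) (Cmod_ge_0 (c t - c t'))
    (Rabs_pos (l - l')) (Cmod_ge_0 (c t)).
  intros. assert (l' * Cmod (c t - c t') <= 1 * Cmod (c t - c t')) by (apply Rmult_le_compat_r; lra).
  assert (Rabs (l - l') * Cmod (c t) <= Rabs (l - l') * M) by (apply Rmult_le_compat_l; lra).
  lra.
Qed.

(** For affine [f] the form is exact and the boundary integral vanishes, so only the
    error of the affine approximation at a point of the rectangle contributes.  The error
    and the perimeter are each linear in the diameter, whence the square. *)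
Lemma boundary_small (a x y u v l t : R) (k : C) (eps d : R) :
  0 < a -> a <= x -> x <= l <= y -> y <= 1 -> u <= t <= v -> 0 < eps ->
  (forall w, Cmod (w - zeta l t) < d ->
     Cmod (f w - f (zeta l t) - k * (w - zeta l t)) <= eps * Cmod (w - zeta l t)) ->
  (forall l t, x <= l <= y -> @continuous C_UniformSpace C_UniformSpace f (zeta l t)) ->
  M * ((y - x) + (v - u)) < d ->
  Cmod (boundary x y u v) <= eps * M * (2 * (M + / a)) * ((y - x) + (v - u)) ^ 2.
Proof.
  intros Ha Hx Hl Hy Ht He Hk Hf Hd.
  set (z0 := zeta l t) in *. set (D := (y - x) + (v - u)) in *.
  assert (HM : 0 <= M).
  { destruct Hc as (_ & _ & _ & H & _). eapply Rle_trans; [|apply (H 0)]. apply Cmod_ge_0. }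
  assert (HaI : 0 < / a) by now apply Rinv_0_lt_compat.
  set (g := fun w => (f z0 + k * (w - z0))%C).
  assert (Hclose : forall l' t', x <= l' <= y -> u <= t' <= v ->
    Cmod (f (zeta l' t') - g (zeta l' t')) <= eps * (M * D)).
  { intros l' t' Hl' Ht'.
    assert (Hz : Cmod (zeta l' t' - z0) <= M * D).
    { eapply Rle_trans; [apply zeta_lipschitz; lra|]. apply Rmult_le_compat_l; [exact HM|].
      unfold D. apply Rplus_le_compat; apply Rabs_le; lra. }
    unfold g. replace (f (zeta l' t') - (f z0 + k * (zeta l' t' - z0)))%C
      with (f (zeta l' t') - f z0 - k * (zeta l' t' - z0))%C by ring.
    eapply Rle_trans; [apply Hk; lra|]. apply Rmult_le_compat_l; lra. }
  set (al := (f z0 + k * (z - z0))%C).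
  set (W := CInt (fun t => c' t / c t)%C u v).
  set (L := CInt (fun l => / RtoC l)%C x y).
  assert (HW : is_RInt (V := C_R_NormedModule) (fun t => c' t / c t)%C u v W).
  { apply CInt_correct; [lra|]. intros s _. apply kernel_continuous. }
  assert (HL : is_RInt (V := C_R_NormedModule) (fun l => / RtoC l)%C x y L).
  { apply CInt_correct; [lra|]. intros s Hs. apply invl_continuous. lra. }
  assert (Hang : forall l', x <= l' <= y ->
    Cmod (CInt (angular l') u v - (al * W + k * RtoC l' * (c v - c u))) <= eps * (M * D) * M * (v - u)).
  { intros l' Hl'.
    apply CInt_close with (p := fun s => (g (zeta l' s) * (c' s / c s))%C).
    - lra.
    - intros s _. apply angular_continuous. now apply Hf.
    - destruct Hc as (Hcd & Hc' & H0 & _).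
      apply (is_RInt_ext (V := C_R_NormedModule))
        with (fun s => (al * (c' s / c s) + k * RtoC l' * c' s)%C).
      { intros s _. unfold g, al, zeta. as_C_eq. field. apply H0. }
      apply is_CInt_plus; apply is_CInt_mult; [exact HW|].
      apply is_CInt_derive; [lra| intros; apply Hcd | intros s _; apply Hc'].
    - intros s Hs. unfold angular.
      replace (f (zeta l' s) * (c' s / c s) - g (zeta l' s) * (c' s / c s))%C
        with ((f (zeta l' s) - g (zeta l' s)) * (c' s / c s))%C by ring.
      rewrite Cmod_mult. apply Rmult_le_compat; try apply Cmod_ge_0; [now apply Hclose|].
      apply Hc. }
  assert (Hrad : forall t', u <= t' <= v ->
    Cmod (CInt (fun l => radial l t') x y - (al * L + k * c t' * RtoC (y - x)))
      <= eps * (M * D) * / a * (y - x)).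
  { intros t' Ht'.
    apply CInt_close with (p := fun s => (g (zeta s t') * / RtoC s)%C).
    - lra.
    - intros s Hs. apply radial_continuous; [lra|]. now apply Hf.
    - apply (is_RInt_ext (V := C_R_NormedModule))
        with (fun s => (al * (/ RtoC s) + k * c t' * RtoC 1)%C).
      { intros s. rewrite Rmin_left, Rmax_right by lra. intros Hs.
        unfold g, al, zeta. as_C_eq. field. apply RtoC_neq_0. lra. }
      apply is_CInt_plus; apply is_CInt_mult; [exact HL|].
      replace (RtoC (y - x)) with (@scal R_AbsRing C_R_ModuleSpace (y - x)%R (RtoC 1)) by (rewrite scal_R_Cmult; as_C_eq; ring).
      apply (is_RInt_const (V := C_R_NormedModule)).
    - intros s Hs. unfold radial.
      replace (f (zeta s t') * / RtoC s - g (zeta s t') * / RtoC s)%C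
        with ((f (zeta s t') - g (zeta s t')) * / RtoC s)%C by ring.
      rewrite Cmod_mult. apply Rmult_le_compat; try apply Cmod_ge_0; [now apply Hclose|].
      rewrite Cmod_inv by (apply RtoC_neq_0; lra). rewrite Cmod_R, Rabs_right by lra.
      apply Rinv_le_contravar; lra. }
  generalize (Hang y ltac:(lra)) (Hang x ltac:(lra)) (Hrad v ltac:(lra)) (Hrad u ltac:(lra)).
  unfold boundary.
  set (A1 := CInt (angular y) u v). set (A2 := CInt (angular x) u v).
  set (R1 := CInt (fun l => radial l v) x y). set (R2 := CInt (fun l => radial l u) x y).
  intros E1 E2 E3 E4.
  replace (A1 - A2 - (R1 - R2))%C with
    (((A1 - (al * W + k * RtoC y * (c v - c u))) - (A2 - (al * W + k * RtoC x * (c v - c u)))) -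
     ((R1 - (al * L + k * c v * RtoC (y - x))) - (R2 - (al * L + k * c u * RtoC (y - x)))))%C
    by (rewrite RtoC_minus; ring).
  assert (Hsub : forall p q : C, Cmod (p - q) <= Cmod p + Cmod q).
  { intros p q. eapply Rle_trans; [apply Cmod_triangle|]. rewrite Cmod_opp. lra. }
  eapply Rle_trans; [apply Hsub|].
  eapply Rle_trans; [apply Rplus_le_compat; apply Hsub|].
  assert (0 <= eps * M * D) by (unfold D; repeat apply Rmult_le_pos; lra).
  assert (eps * (M * D) * M * (v - u) <= eps * M * D * M * D).
  { replace (eps * (M * D) * M * (v - u)) with (eps * M * D * M * (v - u)) by ring.
    apply Rmult_le_compat_l; [nra|unfold D; lra]. }
  assert (eps * (M * D) * / a * (y - x) <= eps * M * D * / a * D).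
  { replace (eps * (M * D) * / a * (y - x)) with (eps * M * D * / a * (y - x)) by ring.
    apply Rmult_le_compat_l; [apply Rmult_le_pos; lra|unfold D; lra]. }
  replace (eps * M * (2 * (M + / a)) * D ^ 2)
    with (2 * (eps * M * D * M * D) + 2 * (eps * M * D * / a * D)) by ring.
  lra.
Qed.

Hypothesis Hf : forall l t, 0 < l <= 1 -> exists k, Cderiv f (zeta l t) k.

(** The two sides of the parameter rectangle on which [t] is constant cancel because the
    curve is closed. *)
Lemma homotopy_invariance (a p q : R) :
  0 < a <= 1 -> p <= q -> c p = c q ->
  CInt (angular a) p q = CInt (angular 1) p q.
Proof.
  intros Ha Hpq Hcl.
  assert (Hcont : forall l t, 0 < l <= 1 -> @continuous C_UniformSpace C_UniformSpace f (zeta l t)).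
  { intros l t Hl. destruct (Hf l t Hl) as [k Hk]. exact (Cderiv_continuous _ _ _ Hk). }
  assert (HB : boundary a 1 p q = 0).
  { apply additive_rectangle_zero; try lra.
    - intros u v Hu Huv Hv x m y Hx Hxm Hmy Hy. unfold boundary.
      rewrite <- (CInt_Chasles (fun l => radial l v) x m y), <- (CInt_Chasles (fun l => radial l u) x m y);
        try lra; [ring| |]; intros l Hl; apply radial_continuous; try lra; apply Hcont; lra.
    - intros x y Hx Hxy Hy u m v Hu Hum Hmv Hv. unfold boundary.
      rewrite <- (CInt_Chasles (angular y) u m v), <- (CInt_Chasles (angular x) u m v);
        try lra; [ring| |]; intros l Hl; apply angular_continuous; apply Hcont; lra.
    - intros l t Hl Ht eps He.
      destruct (Hf l t ltac:(lra)) as [k Hk].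
      assert (HM : 0 <= M).
      { destruct Hc as (_ & _ & _ & H & _). eapply Rle_trans; [|apply (H 0)]. apply Cmod_ge_0. }
      assert (HaI : 0 < / a) by (apply Rinv_0_lt_compat; lra).
      set (K := (M + 1) * (2 * (M + / a))). assert (HK : 0 < K) by (unfold K; nra).
      destruct (Hk (eps / K) ltac:(now apply Rdiv_lt_0_compat)) as (d & Hd & Hw).
      exists (d / (M + 1)). split; [apply Rdiv_lt_0_compat; lra|].
      intros x y u v Hx Hxl Hy Hu Hut Hv HD.
      set (D := y - x + (v - u)) in *.
      assert (HD2 : (M + 1) * D < d).
      { replace d with ((M + 1) * (d / (M + 1))) by (field; lra). apply Rmult_lt_compat_l; lra. }
      assert (0 <= D) by (unfold D; lra).
      eapply Rle_trans.
      + apply (boundary_small a x y u v l t k (eps / K) d); try lra.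
        * now apply Rdiv_lt_0_compat.
        * exact Hw.
        * intros l' t' Hl'. apply Hcont. lra.
        * fold D. lra.
      + fold D.
        replace (eps * D ^ 2) with (eps / K * K * D ^ 2) by (field; lra).
        apply Rmult_le_compat_r; [nra|].
        unfold K at 2. rewrite Rmult_assoc. apply Rmult_le_compat_l; [left; now apply Rdiv_lt_0_compat|].
        apply Rmult_le_compat_r; nra. }
  unfold boundary in HB.
  assert (E : CInt (fun l => radial l q) a 1 = CInt (fun l => radial l p) a 1).
  { apply (RInt_ext (V := C_R_CompleteNormedModule)). intros l _. unfold radial, zeta. now rewrite Hcl. }
  rewrite E in HB. symmetry. apply Cminus_eq_0. rewrite <- HB. ring.
Qed.

(** As the contracted curve shrinks to [z], continuity of [f] at [z] replaces [f] by
    [f z] under the integral. *)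
Lemma homotopy_limit (p q : R) :
  p <= q -> c p = c q -> @continuous C_UniformSpace C_UniformSpace f z ->
  CInt (angular 1) p q = (f z * CInt (fun t => c' t / c t)%C p q)%C.
Proof.
  intros Hpq Hcl Hz. apply Cminus_eq_0, Cmod_eq_0. apply Rle_antisym; [|apply Cmod_ge_0].
  apply le_epsilon. intros eps He. rewrite Rplus_0_l.
  assert (HM : 0 <= M).
  { destruct Hc as (_ & _ & _ & H & _). eapply Rle_trans; [|apply (H 0)]. apply Cmod_ge_0. }
  set (K := M * (q - p) + 1). assert (HK : 0 < K) by (unfold K; nra).
  destruct (proj1 (continuous_CC_iff f z) Hz (eps / K) ltac:(now apply Rdiv_lt_0_compat)) as (d & Hd & Hw).
  set (a := Rmin 1 (d / (2 * (M + 1)))).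
  assert (Ha0 : 0 < d / (2 * (M + 1))) by (apply Rdiv_lt_0_compat; lra).
  assert (Ha : 0 < a <= 1) by (unfold a; split; [apply Rmin_glb_lt; lra|apply Rmin_l]).
  rewrite <- (homotopy_invariance a p q Ha Hpq Hcl).
  assert (HI := is_CInt_mult (f z) _ _ _ _
    (CInt_correct (fun t => c' t / c t)%C p q Hpq (fun t _ => kernel_continuous t))).
  eapply Rle_trans.
  - apply CInt_close with (m := eps / K * M) (3 := HI); [exact Hpq| |].
    + intros t _. apply angular_continuous. destruct (Hf a t Ha) as [k Hk].
      exact (Cderiv_continuous _ _ _ Hk).
    + intros t _. unfold angular.
      replace (f (zeta a t) * (c' t / c t) - f z * (c' t / c t))%C
        with ((f (zeta a t) - f z) * (c' t / c t))%C by ring.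
      rewrite Cmod_mult. apply Rmult_le_compat; try apply Cmod_ge_0; [|apply Hc].
      left. apply Hw. unfold zeta. replace (z + RtoC a * c t - z)%C with (RtoC a * c t)%C by ring.
      rewrite Cmod_mult, Cmod_R, Rabs_right by lra.
      assert (Cmod (c t) <= M) by apply Hc. assert (0 <= Cmod (c t)) by apply Cmod_ge_0.
      assert (a * (M + 1) <= d / 2).
      { replace (d / 2) with (d / (2 * (M + 1)) * (M + 1)) by (field; lra).
        apply Rmult_le_compat_r; [lra|apply Rmin_r]. }
      nra.
  - replace eps with (eps / K * K) at 2 by (field; lra). rewrite Rmult_assoc.
    apply Rmult_le_compat_l; [left; now apply Rdiv_lt_0_compat|unfold K; lra].
Qed.
End Homotopy.

(** * Complex power series *)

Definition Cseries (u : nat -> C) (l : C) : Prop := @is_series C_AbsRing C_NormedModule u l.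

Lemma Cseries_unique (u : nat -> C) (l m : C) : Cseries u l -> Cseries u m -> l = m.
Proof. apply (filterlim_locally_unique (V := C_NormedModule)). Qed.

Lemma Cseries_ext (u v : nat -> C) (l : C) : (forall n, u n = v n) -> Cseries u l -> Cseries v l.
Proof. apply (is_series_ext (V := C_NormedModule)). Qed.

Lemma Cseries_plus (u v : nat -> C) (l m : C) :
  Cseries u l -> Cseries v m -> Cseries (fun n => u n + v n)%C (l + m)%C.
Proof. apply (is_series_plus (V := C_NormedModule)). Qed.

Lemma Cseries_scal (k : C) (u : nat -> C) (l : C) :
  Cseries u l -> Cseries (fun n => k * u n)%C (k * l)%C.
Proof. apply (is_series_scal (V := C_NormedModule)). Qed.

Lemma Cseries_shift (u : nat -> C) (l : C) :
  Cseries u l <-> Cseries (fun n => u (S n)) (l - u 0%nat)%C.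
Proof.
  split; intros H.
  - apply (is_series_incr_1 (V := C_NormedModule)).
    refine (eq_ind _ (Cseries u) H _ _).
    change (l = (l - u 0%nat + u 0%nat)%C). ring.
  - apply (is_series_decr_1 (V := C_NormedModule)). exact H.
Qed.

Lemma Cseries_lim (u : nat -> C) (l : C) :
  Cseries u l <-> filterlim (sum_n u) eventually (@locally C_UniformSpace l).
Proof. reflexivity. Qed.

Lemma Cseries_bounded (u : nat -> C) (l : C) :
  Cseries u l -> exists M, forall n, Cmod (u n) <= M.
Proof.
  intros H.
  destruct (filterlim_bounded (V := C_NormedModule) (sum_n u)) as [M HM]; [now exists l|].
  exists (2 * M). intros [|n].
  - specialize (HM 0%nat). rewrite sum_O in HM. change (Cmod (u 0%nat) <= M) in HM.
    generalize (Cmod_ge_0 (u 0%nat)). lra.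
  - assert (H1 := HM (S n)). assert (H2 := HM n). rewrite sum_Sn in H1.
    change (Cmod (sum_n u n + u (S n))%C <= M) in H1. change (Cmod (sum_n u n) <= M) in H2.
    replace (u (S n)) with ((sum_n u n + u (S n)) - sum_n u n)%C by ring.
    eapply Rle_trans; [apply Cmod_triangle|]. rewrite Cmod_opp. lra.
Qed.

Lemma Cseries_norm_le (u : nat -> C) (b : nat -> R) (l : C) (L : R) :
  Cseries u l -> (forall n, Cmod (u n) <= b n) -> is_series b L -> Cmod l <= L.
Proof.
  intros Hu Hb HL.
  assert (H1 : is_lim_seq (fun n => Cmod (sum_n u n)) (Cmod l)).
  { apply (filterlim_comp _ _ _ (sum_n u) Cmod eventually (@locally C_UniformSpace l)); [exact Hu|].
    apply (continuous_Cmod (fun w : C_UniformSpace => w) l). apply continuous_id. }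
  assert (H2 : is_lim_seq (sum_n b) L) by exact HL.
  apply (is_lim_seq_le _ _ (Finite (Cmod l)) (Finite L)) with (2 := H1) (3 := H2).
  intros n. induction n as [|n IH].
  - rewrite 2!sum_O. apply Hb.
  - rewrite 2!sum_Sn. eapply Rle_trans; [apply Cmod_triangle|]. now apply Rplus_le_compat.
Qed.

(** Real power series with coefficients [|a n|] control the complex ones, so
    the radius of convergence is theirs. *)
Definition radius (a : nat -> C) : Rbar := CV_radius (fun n => Cmod (a n)).

Lemma radius_abs_series (a : nat -> C) (d x : R) :
  Rbar_le d (radius a) -> 0 <= x < d -> ex_series (fun n => Cmod (a n) * x ^ n).
Proof.
  intros H Hx. apply (ex_series_ext (V := R_NormedModule)) with (fun n => Rabs (Cmod (a n) * x ^ n)).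
  - intros n. apply Rabs_right, Rle_ge, Rmult_le_pos; [apply Cmod_ge_0|apply pow_le; lra].
  - apply CV_disk_inside. apply Rbar_lt_le_trans with (Finite d); [|exact H].
    simpl. rewrite Rabs_right; lra.
Qed.

Lemma radius_of_bound (a : nat -> C) (x M : R) :
  0 <= x -> (forall n, Cmod (a n) * x ^ n <= M) -> Rbar_le x (radius a).
Proof.
  intros Hx HM. apply (CV_radius_bounded (fun n => Cmod (a n))). exists M. intros n.
  rewrite Rabs_right; [apply HM|].
  apply Rle_ge, Rmult_le_pos; [apply Cmod_ge_0|now apply pow_le].
Qed.

Lemma radius_of_convergence (a : nat -> C) (d : R) :
  0 < d -> (forall x, 0 <= x < d -> exists l, Cseries (fun n => a n * RtoC x ^ n)%C l) ->
  Rbar_le d (radius a).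
Proof.
  intros Hd H.
  assert (Hx : forall x, 0 <= x < d -> Rbar_le x (radius a)).
  { intros x Hx. destruct (H x Hx) as [l Hl]. destruct (Cseries_bounded _ _ Hl) as [M HM].
    apply (radius_of_bound a x M); [lra|]. intros n. specialize (HM n).
    rewrite Cmod_mult, Cmod_pow, Cmod_R, Rabs_right in HM by lra. exact HM. }
  destruct (radius a) as [r| |]; simpl in *; trivial.
  - apply le_epsilon. intros eps He.
    destruct (Rle_dec 0 (d - eps)) as [h|h].
    + specialize (Hx (d - eps) ltac:(lra)). lra.
    + specialize (Hx 0 ltac:(lra)). lra.
  - apply (Hx 0). lra.
Qed.

(** Meaningful wherever the series converges. *)
Definition CPS (a : nat -> C) (q : C) : C :=
  epsilon (inhabits (RtoC 0)) (Cseries (fun n => a n * q ^ n)%C).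

Lemma CPS_unique (a : nat -> C) (q l : C) : Cseries (fun n => a n * q ^ n)%C l -> CPS a q = l.
Proof.
  intros H. apply Cseries_unique with (2 := H). unfold CPS. apply epsilon_spec. now exists l.
Qed.

Lemma CPS_correct (a : nat -> C) (d : R) (q : C) :
  Rbar_le d (radius a) -> Cmod q < d -> Cseries (fun n => a n * q ^ n)%C (CPS a q).
Proof.
  intros H Hq. unfold CPS. apply epsilon_spec.
  apply (ex_series_le (V := C_CompleteNormedModule)) with (fun n => Cmod (a n) * Cmod q ^ n).
  - intros n. rewrite <- Cmod_pow, <- Cmod_mult. apply Rle_refl.
  - apply (radius_abs_series a d); [exact H|]. split; [apply Cmod_ge_0|exact Hq].
Qed.

Definition Cder (a : nat -> C) (n : nat) : C := (RtoC (INR (S n)) * a (S n))%C.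

Lemma radius_Cder (a : nat -> C) : radius (Cder a) = radius a.
Proof.
  unfold radius. rewrite <- (CV_radius_derive (fun n => Cmod (a n))).
  apply CV_radius_ext. intros n. unfold Cder, PS_derive.
  rewrite Cmod_mult, Cmod_R, Rabs_right; [reflexivity|]. apply Rle_ge, pos_INR.
Qed.

Lemma radius_shift (a : nat -> C) : radius (fun n => a (S n)) = radius a.
Proof. unfold radius. exact (CV_radius_decr_1 (fun n => Cmod (a n))). Qed.

Lemma CPS_shift (a : nat -> C) (d : R) (q : C) :
  Rbar_le d (radius a) -> Cmod q < d -> CPS a q = (a 0%nat + q * CPS (fun n => a (S n)) q)%C.
Proof.
  intros H Hq. apply CPS_unique. apply Cseries_shift.
  replace (a 0%nat + q * CPS (fun n => a (S n)) q - a 0%nat * q ^ 0)%C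
    with (q * CPS (fun n => a (S n)) q)%C by (simpl; ring).
  apply Cseries_ext with (fun n => q * (a (S n) * q ^ n))%C.
  { intros n. simpl. ring. }
  apply Cseries_scal. apply CPS_correct with d; [|exact Hq]. now rewrite radius_shift.
Qed.

(** The derivative of [q^n], by cases so that [n = 0] needs no predecessor. *)
Definition dpow (q : C) (n : nat) : C :=
  match n with O => RtoC 0 | S m => (RtoC (INR (S m)) * q ^ m)%C end.
Definition dpowR (x : R) (n : nat) : R :=
  match n with O => 0 | S m => INR (S m) * x ^ m end.

Lemma CPS_dpow (a : nat -> C) (d : R) (q : C) :
  Rbar_le d (radius a) -> Cmod q < d -> Cseries (fun n => a n * dpow q n)%C (CPS (Cder a) q).
Proof.
  intros H Hq. apply Cseries_shift.
  replace (CPS (Cder a) q - a 0%nat * dpow q 0)%C with (CPS (Cder a) q) by (simpl; ring).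
  apply Cseries_ext with (fun n => Cder a n * q ^ n)%C.
  { intros n. unfold Cder, dpow. ring. }
  apply CPS_correct with d; [|exact Hq]. now rewrite radius_Cder.
Qed.

Lemma dpow_remainder_S (q h : C) (n : nat) :
  ((q + h) ^ S n - q ^ S n - dpow q (S n) * h =
   (q + h) * ((q + h) ^ n - q ^ n - dpow q n * h) + dpow q n * (h * h))%C.
Proof.
  destruct n as [|n]; [simpl; ring|].
  unfold dpow. rewrite (S_INR (S n)), RtoC_plus, 2!(Cpow_S _ (S n)), (Cpow_S q n). ring.
Qed.

Lemma dpowR_remainder_S (x y : R) (n : nat) :
  (x + y) ^ S n - x ^ S n - dpowR x (S n) * y =
  (x + y) * ((x + y) ^ n - x ^ n - dpowR x n * y) + dpowR x n * (y * y).
Proof.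
  destruct n as [|n]; [simpl; ring|].
  unfold dpowR. rewrite (S_INR (S n)). simpl. ring.
Qed.

(** The remainder is a polynomial in [q] and [h] with nonnegative coefficients; the
    recursion exhibits this. *)
Lemma dpow_remainder_bound (q h : C) (n : nat) :
  Cmod ((q + h) ^ n - q ^ n - dpow q n * h) <=
  (Cmod q + Cmod h) ^ n - Cmod q ^ n - dpowR (Cmod q) n * Cmod h.
Proof.
  induction n as [|n IH].
  - simpl. replace (1 - 1 - 0 * h)%C with (RtoC 0) by ring. rewrite Cmod_0. lra.
  - rewrite dpow_remainder_S, dpowR_remainder_S.
    eapply Rle_trans; [apply Cmod_triangle|]. rewrite 3!Cmod_mult.
    apply Rplus_le_compat.
    + apply Rmult_le_compat; try apply Cmod_ge_0; [apply Cmod_triangle|exact IH].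
    + apply Rmult_le_compat_r; [apply Rmult_le_pos; apply Cmod_ge_0|].
      destruct n as [|n]; simpl dpow; simpl dpowR; [rewrite Cmod_0; lra|].
      rewrite Cmod_mult, Cmod_R, Cmod_pow, Rabs_right; [apply Rle_refl|].
      apply Rle_ge, (pos_INR (S n)).
Qed.

(** The remainder of order one is dominated termwise by that of the real power series
    with coefficients [|a n|] at [|q|], which is differentiable. *)
Lemma CPS_derive (a : nat -> C) (d : R) (q : C) :
  Rbar_le d (radius a) -> Cmod q < d -> Cderiv (CPS a) q (CPS (Cder a) q).
Proof.
  intros H Hq. set (x := Cmod q). assert (Hx : 0 <= x) by apply Cmod_ge_0.
  set (b := fun n => Cmod (a n)).
  assert (HD : is_derive (PSeries b) x (PSeries (PS_derive b) x)).
  { apply is_derive_PSeries. apply Rbar_lt_le_trans with (Finite d); [|exact H].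
    simpl. rewrite Rabs_right; unfold x in *; lra. }
  assert (Hb : forall y, 0 <= y < d -> is_series (fun n => b n * y ^ n) (PSeries b y)).
  { intros y Hy. apply (Series_correct (fun n => b n * y ^ n)). now apply (radius_abs_series a d). }
  assert (Hb' : is_series (fun n => b n * dpowR x n) (PSeries (PS_derive b) x)).
  { apply (is_series_decr_1 (V := R_NormedModule)).
    refine (eq_ind (PSeries (PS_derive b) x)
      (fun l : R_NormedModule => is_series (fun n => b (S n) * dpowR x (S n)) l) _ _ _).
    2:{ simpl. change (PSeries (PS_derive b) x = PSeries (PS_derive b) x + - (b 0%nat * 0)). ring. }
    apply (is_series_ext (V := R_NormedModule)) with (fun n => PS_derive b n * x ^ n).
    { intros n. unfold PS_derive, dpowR.
      change (INR (S n) * b (S n) * x ^ n = b (S n) * (INR (S n) * x ^ n)). ring. }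
    apply (Series_correct (fun n => PS_derive b n * x ^ n)).
    apply (ex_series_ext (V := R_NormedModule)) with (fun n => Cmod (Cder a n) * x ^ n).
    { intros n. unfold Cder, PS_derive. rewrite Cmod_mult, Cmod_R, Rabs_right; [reflexivity|].
      apply Rle_ge, pos_INR. }
    apply (radius_abs_series (Cder a) d); [now rewrite radius_Cder|unfold x in *; lra]. }
  intros eps He. destruct HD as [_ HD].
  assert (Hl : is_filter_lim (locally (T := R_UniformSpace) x) x) by (intros P HP; exact HP).
  destruct (HD x Hl (mkposreal eps He)) as [d1 H1].
  exists (Rmin d1 (d - x)). split; [apply Rmin_glb_lt; [apply cond_pos|unfold x; lra]|].
  intros w Hw. set (h := (w - q)%C) in *. set (y := Cmod h) in *.
  assert (Hy : 0 <= y) by apply Cmod_ge_0.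
  assert (y < d1) by (eapply Rlt_le_trans; [exact Hw|apply Rmin_l]).
  assert (Hyd : y < d - x) by (eapply Rlt_le_trans; [exact Hw|apply Rmin_r]).
  replace w with (q + h)%C by (unfold h; ring).
  assert (Hqh : Cmod (q + h) < d).
  { eapply Rle_lt_trans; [apply Cmod_triangle|]. fold x y. lra. }
  assert (S1 := CPS_correct a d _ H Hqh). assert (S2 := CPS_correct a d _ H Hq).
  assert (S3 := CPS_dpow a d q H Hq).
  assert (S : Cseries (fun n => a n * ((q + h) ^ n - q ^ n - dpow q n * h))%C
    (CPS a (q + h) - CPS a q - CPS (Cder a) q * h)%C).
  { replace (CPS a (q + h) - CPS a q - CPS (Cder a) q * h)%C with
      (CPS a (q + h) + ((- RtoC 1) * CPS a q + (- h) * CPS (Cder a) q))%C by ring.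
    apply Cseries_ext with (fun n => a n * (q + h) ^ n +
      ((- RtoC 1) * (a n * q ^ n) + (- h) * (a n * dpow q n)))%C; [intros n; ring|].
    apply Cseries_plus; [exact S1|]. apply Cseries_plus; now apply Cseries_scal. }
  assert (SR : is_series (fun n => b n * ((x + y) ^ n - x ^ n - dpowR x n * y))
    (PSeries b (x + y) - PSeries b x - y * PSeries (PS_derive b) x)).
  { assert (T1 := Hb (x + y) ltac:(lra)). assert (T2 := Hb x ltac:(lra)).
    assert (T3 := is_series_scal (V := R_NormedModule) y _ _ Hb').
    assert (T := is_series_minus _ _ _ _ (is_series_minus _ _ _ _ T1 T2) T3).
    apply (is_series_ext (V := R_NormedModule)) with (2 := T). intros n.
    change (b n * (x + y) ^ n - b n * x ^ n - y * (b n * dpowR x n) =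
      b n * ((x + y) ^ n - x ^ n - dpowR x n * y)). ring. }
  eapply Rle_trans.
  - apply Cseries_norm_le with (1 := S) (3 := SR). intros n. rewrite Cmod_mult.
    apply Rmult_le_compat_l; [apply Cmod_ge_0|]. apply dpow_remainder_bound.
  - assert (Hball : ball x d1 (x + y)).
    { change (Rabs (x + y - x) < d1). replace (x + y - x) with y by ring. rewrite Rabs_right; lra. }
    specialize (H1 (x + y) Hball).
    change (Rabs (PSeries b (x + y) - PSeries b x - (x + y - x) * PSeries (PS_derive b) x)
      <= eps * Rabs (x + y - x)) in H1.
    replace (x + y - x) with y in H1 by ring. rewrite (Rabs_right y) in H1 by lra.
    eapply Rle_trans; [apply Rle_abs|exact H1].
Qed.

Lemma CPS_primitive (u : nat -> C) (c : C) :
  exists b, b 0%nat = c /\ radius b = radius u /\ forall n, Cder b n = u n.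
Proof.
  set (b := fun n => match n with O => c | S m => (u m * / RtoC (INR (S m)))%C end).
  assert (Hb : forall n, Cder b n = u n).
  { intros n. unfold Cder, b. field. apply RtoC_neq_0, not_0_INR. lia. }
  exists b. split; [reflexivity|]. split; [|exact Hb].
  rewrite <- radius_Cder. apply CV_radius_ext. intros n. now rewrite Hb.
Qed.

Lemma CPS_0 (a : nat -> C) (d : R) : 0 < d -> Rbar_le d (radius a) -> CPS a 0 = a 0%nat.
Proof.
  intros Hd H. rewrite (CPS_shift a d 0 H) by (rewrite Cmod_0; exact Hd). ring.
Qed.

(** * Cauchy's formula *)

Lemma sum_n_cv_C (u : nat -> C) (l : C) :
  (forall eps, 0 < eps -> exists N, forall n, (N <= n)%nat -> Cmod (sum_n u n - l) < eps) ->
  Cseries u l.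
Proof.
  intros H. apply Cseries_lim. intros P HP. apply locally_C_iff in HP.
  destruct HP as (d & Hd & HP). destruct (H d Hd) as [N HN].
  exists N. intros n Hn. apply HP. now apply HN.
Qed.

Lemma continuous_bounded (g : R -> R) (a b : R) :
  a <= b -> (forall t, @continuous R_UniformSpace R_UniformSpace g t) ->
  exists t0, a <= t0 <= b /\ forall t, a <= t <= b -> g t <= g t0.
Proof.
  intros Hab Hg. destruct (continuity_ab_maj g a b Hab) as (t0 & H1 & H2).
  - intros t _. apply continuity_pt_filterlim. apply Hg.
  - exists t0. split; [exact H2|exact H1].
Qed.

Lemma Cmod_sub_ge (r : R) (e q : C) : Cmod e = r -> r - Cmod q <= Cmod (e - q).
Proof. intros <-. apply Cmod_triangle_rev. Qed.

Fixpoint geom (x : C) (n : nat) : C :=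
  match n with O => RtoC 1 | S m => (geom x m + x ^ S m)%C end.

Lemma geom_eq (x : C) (n : nat) : (geom x n * (1 - x) = 1 - x ^ S n)%C.
Proof.
  induction n as [|n IH]; [simpl; ring|].
  change (geom x (S n)) with (geom x n + x ^ S n)%C.
  rewrite Cmult_plus_distr_r, IH. rewrite (Cpow_S _ (S n)). ring.
Qed.

Definition circle (r : R) (t : R) : C := (RtoC r * cis t)%C.

Lemma Cmod_circle (r t : R) : 0 < r -> Cmod (circle r t) = r.
Proof. intros H. unfold circle. rewrite Cmod_mult, Cmod_cis, Cmod_R, Rabs_right; lra. Qed.

Lemma circle_neq_0 (r t : R) : 0 < r -> circle r t <> 0.
Proof. intros H. apply Cmod_neq_0. now rewrite Cmod_circle. Qed.

Lemma circle_derive (r t : R) : Rderiv (circle r) t (Ci * circle r t)%C.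
Proof.
  replace (Ci * circle r t)%C with (RtoC r * (Ci * cis t))%C by (unfold circle; ring).
  apply Rderiv_Cmult_l, cis_derive.
Qed.

Lemma circle_continuous (r t : R) : @continuous R_UniformSpace C_UniformSpace (circle r) t.
Proof. exact (Rderiv_continuous _ _ _ (circle_derive r t)). Qed.

Lemma circle_period (r : R) : circle r 0 = circle r (2 * PI).
Proof. unfold circle. now rewrite cis_0, cis_2PI. Qed.

Lemma circle_sub_neq_0 (r t : R) (q : C) : Cmod q < r -> (circle r t - q)%C <> 0.
Proof.
  intros Hq. apply Cmod_neq_0.
  assert (0 < r) by (generalize (Cmod_ge_0 q); lra).
  generalize (Cmod_sub_ge r (circle r t) q (Cmod_circle r t H)). lra.
Qed.

Lemma circle_contracting (r : R) (q : C) : Cmod q < r ->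
  contracting_curve (fun t => circle r t - q)%C (fun t => Ci * circle r t)%C (2 * r + r / (r - Cmod q)).
Proof.
  intros Hq. assert (H0 := Cmod_ge_0 q). assert (Hr : 0 < r) by lra.
  assert (0 < r / (r - Cmod q)) by (apply Rdiv_lt_0_compat; lra).
  assert (HC : forall t, Cmod (Ci * circle r t) = r).
  { intros t. rewrite Cmod_mult, Cmod_Ci, Cmod_circle by exact Hr. ring. }
  refine (conj _ (conj _ (conj _ (conj _ (conj _ _))))); intros t.
  - replace (Ci * circle r t)%C with (1 * (Ci * circle r t))%C by ring.
    apply (Rderiv_comp (fun w => w - q)%C (circle r)); [|apply circle_derive].
    replace (RtoC 1) with (1 + 0)%C by ring.
    apply Cderiv_plus; [apply Cderiv_id|apply Cderiv_const].
  - apply continuous_Cmult; [apply continuous_Cconst|apply circle_continuous].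
  - now apply circle_sub_neq_0.
  - eapply Rle_trans; [apply Cmod_triangle|]. rewrite Cmod_opp, Cmod_circle by exact Hr. lra.
  - rewrite HC. lra.
  - rewrite Cmod_div by now apply circle_sub_neq_0. rewrite HC.
    apply Rle_trans with (r / (r - Cmod q)); [|lra].
    apply Rmult_le_compat_l; [lra|]. apply Rinv_le_contravar; [lra|].
    now apply Cmod_sub_ge, Cmod_circle.
Qed.

Definition cauchy_coef (r : R) (g : R -> C) (k : nat) : C :=
  CInt (fun t => g t * (Ci * / circle r t ^ k))%C 0 (2 * PI).

Definition cauchy_integral (r : R) (g : R -> C) (q : C) : C :=
  CInt (fun t => g t * ((Ci * circle r t) / (circle r t - q)))%C 0 (2 * PI).

Lemma PI2_pos : 0 <= 2 * PI.
Proof. generalize PI_RGT_0. lra. Qed.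

Section CauchyExpansion.
Context (r : R) (g : R -> C).
Hypothesis Hr : 0 < r.
Hypothesis Hg : forall t, @continuous R_UniformSpace C_UniformSpace g t.

Lemma Cpow_continuous (k : nat) (z : C) :
  @continuous C_UniformSpace C_UniformSpace (fun w => w ^ k)%C z.
Proof.
  induction k as [|k IH]; [apply continuous_Cconst|].
  apply (continuous_Cmult (fun w : C_UniformSpace => w) (fun w => (w ^ k)%C : C_UniformSpace));
    [apply continuous_id|exact IH].
Qed.

Lemma cauchy_coef_continuous (k : nat) (t : R) :
  @continuous R_UniformSpace C_UniformSpace (fun t => g t * (Ci * / circle r t ^ k))%C t.
Proof.
  apply continuous_Cmult; [apply Hg|]. apply continuous_Cmult; [apply continuous_Cconst|].
  apply continuous_Cinv; [now apply Cpow_nz, circle_neq_0|].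
  apply (continuous_Ccomp (circle r) (fun w => w ^ k)%C); [apply circle_continuous|apply Cpow_continuous].
Qed.

Lemma cauchy_integral_continuous (q : C) (t : R) : Cmod q < r ->
  @continuous R_UniformSpace C_UniformSpace
    (fun t => g t * ((Ci * circle r t) / (circle r t - q)))%C t.
Proof.
  intros Hq. apply continuous_Cmult; [apply Hg|]. apply continuous_Cmult.
  - apply continuous_Cmult; [apply continuous_Cconst|apply circle_continuous].
  - apply continuous_Cinv; [now apply circle_sub_neq_0|].
    apply continuous_Cminus; [apply circle_continuous|apply continuous_Cconst].
Qed.

Lemma cauchy_partial_sum (q : C) (n : nat) :
  @is_RInt C_R_NormedModule (fun t => g t * (Ci * geom (q / circle r t) n))%C 0 (2 * PI)
    (sum_n (fun k => cauchy_coef r g k * q ^ k)%C n).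
Proof.
  assert (Hk : forall k, @is_RInt C_R_NormedModule
    (fun t => q ^ k * (g t * (Ci * / circle r t ^ k)))%C 0 (2 * PI) (q ^ k * cauchy_coef r g k)%C).
  { intros k. apply is_CInt_mult, CInt_correct; [exact PI2_pos|].
    intros t _. apply cauchy_coef_continuous. }
  assert (Hpow : forall k t, ((q / circle r t) ^ k = q ^ k * / circle r t ^ k)%C).
  { intros k t. unfold Cdiv. rewrite Cpow_mult_l. f_equal. apply Cpow_inv.
    now apply circle_neq_0. }
  induction n as [|n IH].
  - rewrite sum_O. rewrite (Cmult_comm _ (q ^ 0)).
    apply (is_RInt_ext (V := C_R_NormedModule)) with (2 := Hk 0%nat).
    intros t _. as_C_eq. simpl. field.
  - rewrite sum_Sn.
    apply (is_RInt_ext (V := C_R_NormedModule))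
      with (fun t => (g t * (Ci * geom (q / circle r t) n) +
         q ^ S n * (g t * (Ci * / circle r t ^ S n)))%C).
    + intros t _. as_C_eq. change (geom (q / circle r t) (S n))
        with (geom (q / circle r t) n + (q / circle r t) ^ S n)%C. rewrite Hpow. ring.
    + rewrite (Cmult_comm _ (q ^ S n)). apply is_CInt_plus; [exact IH|apply Hk].
Qed.

Lemma cauchy_bound : exists B, 0 <= B /\ forall t, 0 <= t <= 2 * PI -> Cmod (g t) <= B.
Proof.
  destruct (continuous_bounded (fun t => Cmod (g t)) 0 (2 * PI) PI2_pos) as (t0 & _ & H).
  - intros t. apply continuous_Cmod, Hg.
  - exists (Cmod (g t0)). split; [apply Cmod_ge_0|exact H].
Qed.

(** The geometric series of the Cauchy kernel may be integrated termwise because its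
    remainder is uniformly small on the circle. *)
Lemma cauchy_integral_series (q : C) : Cmod q < r ->
  Cseries (fun k => cauchy_coef r g k * q ^ k)%C (cauchy_integral r g q).
Proof.
  intros Hq. destruct cauchy_bound as (B & HB & HgB).
  set (x := Cmod q / r). assert (H0 := Cmod_ge_0 q).
  assert (Hx : 0 <= x < 1).
  { unfold x. split; [apply Rmult_le_pos; [lra|left; now apply Rinv_0_lt_compat]|].
    apply Rmult_lt_reg_r with r; [exact Hr|]. unfold Rdiv. rewrite Rmult_assoc, Rinv_l; lra. }
  set (K := B * (r / (r - Cmod q))).
  assert (HK : 0 <= K).
  { apply Rmult_le_pos; [exact HB|]. apply Rlt_le, Rdiv_lt_0_compat; lra. }
  assert (Hest : forall n,
    Cmod (sum_n (fun k => cauchy_coef r g k * q ^ k)%C n - cauchy_integral r g q) <= K * x ^ S n * (2 * PI)).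
  { intros n. rewrite Cmod_minus_sym.
    replace (K * x ^ S n * (2 * PI)) with (K * x ^ S n * (2 * PI - 0)) by ring.
    apply CInt_close with (3 := cauchy_partial_sum q n); [exact PI2_pos| |].
    - intros t _. now apply cauchy_integral_continuous.
    - intros t Ht. assert (He := circle_neq_0 r t Hr). assert (Heq := circle_sub_neq_0 r t q Hq).
      set (e := circle r t) in *.
      assert (E : (Ci * e / (e - q) - Ci * geom (q / e) n = Ci * (q / e) ^ S n * (e / (e - q)))%C).
      { assert (G := geom_eq (q / e) n).
        assert (N : (1 - q / e)%C <> 0).
        { replace (1 - q / e)%C with ((e - q) / e)%C by (now field).
          unfold Cdiv. apply Cmult_neq_0; [exact Heq|]. apply Cmod_neq_0.
          rewrite Cmod_inv by exact He. apply Rinv_0_lt_compat. now apply Cmod_pos. }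
        replace (geom (q / e) n) with ((1 - (q / e) ^ S n) / (1 - q / e))%C.
        2:{ rewrite <- G. now field. }
        replace (1 - q / e)%C with ((e - q) / e)%C by (now field).
        field. now split. }
      replace (g t * (Ci * e / (e - q)) - g t * (Ci * geom (q / e) n))%C
        with (g t * (Ci * e / (e - q) - Ci * geom (q / e) n))%C by ring.
      rewrite E, 3!Cmod_mult, Cmod_Ci, Cmod_pow, 2!Cmod_div by assumption.
      unfold e at 1 2. rewrite Cmod_circle by exact Hr. fold x. unfold K.
      replace (B * (r / (r - Cmod q)) * x ^ S n) with (B * (1 * x ^ S n * (r / (r - Cmod q)))) by ring.
      assert (0 <= x ^ S n) by (apply pow_le; lra).
      assert (Hd : r - Cmod q <= Cmod (e - q)) by (now apply Cmod_sub_ge, Cmod_circle).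
      assert (0 < r / Cmod (e - q)) by (apply Rdiv_lt_0_compat; lra).
      apply Rmult_le_compat; [apply Cmod_ge_0| |now apply HgB|].
      + apply Rmult_le_pos; [apply Rmult_le_pos|]; lra.
      + apply Rmult_le_compat_l; [lra|]. apply Rmult_le_compat_l; [lra|].
        apply Rinv_le_contravar; lra. }
  apply sum_n_cv_C. intros eps He.
  set (K' := K * (2 * PI) + 1).
  assert (HK' : 0 < K') by (unfold K'; generalize (Rmult_le_pos _ _ HK PI2_pos); lra).
  destruct (pow_lt_1_zero x ltac:(rewrite Rabs_right; lra) (eps / K')) as [N HN].
  { now apply Rdiv_lt_0_compat. }
  exists N. intros n Hn. eapply Rle_lt_trans; [apply Hest|].
  specialize (HN (S n) ltac:(lia)).
  assert (0 <= x ^ S n) by (apply pow_le; lra). rewrite Rabs_right in HN by lra.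
  replace eps with (K' * (eps / K')) by (field; lra).
  replace (K * x ^ S n * (2 * PI)) with (K * (2 * PI) * x ^ S n) by ring.
  eapply Rle_lt_trans; [|apply Rmult_lt_compat_l; [exact HK'|exact HN]].
  apply Rmult_le_compat_r; [lra|unfold K'; lra].
Qed.

End CauchyExpansion.

Lemma Cderiv_pow (n : nat) (z : C) : Cderiv (fun w => w ^ n)%C z (dpow z n).
Proof.
  induction n as [|n IH]; [exact (Cderiv_const 1 z)|].
  assert (H := Cderiv_mult _ _ _ _ _ (Cderiv_id z) IH).
  replace (dpow z (S n)) with (1 * z ^ n + z * dpow z n)%C; [exact H|].
  destruct n as [|n]; [simpl; ring|].
  unfold dpow. rewrite (S_INR (S n)), RtoC_plus. simpl. ring.
Qed.

(** The winding number of the circle about [q] is one, at every point [q] inside: in the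
    expansion of the kernel all powers but the constant term have a periodic
    antiderivative. *)
Lemma cauchy_integral_1 (r : R) (q : C) : Cmod q < r ->
  cauchy_integral r (fun _ => RtoC 1) q = (Ci * RtoC (2 * PI))%C.
Proof.
  intros Hq. assert (Hr : 0 < r) by (generalize (Cmod_ge_0 q); lra).
  assert (H := cauchy_integral_series r (fun _ => RtoC 1) Hr (fun t => continuous_Cconst _ t) q Hq).
  assert (H0 : cauchy_coef r (fun _ => RtoC 1) 0 = (Ci * RtoC (2 * PI))%C).
  { unfold cauchy_coef. apply CInt_unique.
    assert (HI := is_RInt_const (V := C_R_NormedModule) 0 (2 * PI) Ci).
    rewrite scal_R_Cmult in HI. replace (2 * PI - 0) with (2 * PI) in HI by ring.
    rewrite Cmult_comm.
    apply (is_RInt_ext (V := C_R_NormedModule)) with (2 := HI).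
    intros t _. as_C_eq. simpl. field. }
  assert (HS : forall k, cauchy_coef r (fun _ => RtoC 1) (S k) = 0).
  { intros k. unfold cauchy_coef. apply CInt_unique.
    set (K := (- / RtoC (INR (S k)))%C).
    assert (HK : RtoC (INR (S k)) <> 0) by (apply RtoC_neq_0, not_0_INR; lia).
    assert (HI := is_CInt_derive (fun t => K * (/ circle r t) ^ S k)%C
      (fun t => 1 * (Ci * / circle r t ^ S k))%C 0 (2 * PI) PI2_pos).
    cbv beta in HI. rewrite <- circle_period in HI.
    replace (K * (/ circle r 0) ^ S k - K * (/ circle r 0) ^ S k)%C with (RtoC 0) in HI by ring.
    apply HI.
    - intros t _. assert (Hn := circle_neq_0 r t Hr).
      assert (Hi := Rderiv_comp (fun w => / w)%C (circle r) t _ _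
        (Cderiv_inv (fun w => w) (circle r t) _ Hn (Cderiv_id _)) (circle_derive r t)).
      assert (Hp := Rderiv_comp (fun w => w ^ S k)%C _ t _ _ (Cderiv_pow (S k) _) Hi).
      apply (Rderiv_Cmult_l K) in Hp. cbv beta in Hp.
      match type of Hp with Rderiv _ _ ?v => replace (1 * (Ci * / circle r t ^ S k))%C with v end;
        [exact Hp|].
      unfold K, dpow. rewrite <- Cpow_inv by exact Hn. simpl Cpow.
      set (P := ((/ circle r t) ^ k)%C). field. now split.
    - intros t _. apply (cauchy_coef_continuous r (fun _ => RtoC 1) Hr). intros u. apply continuous_Cconst. }
  apply Cseries_unique with (1 := H). rewrite <- H0. apply sum_n_cv_C. intros eps He.
  exists 0%nat. intros n _.
  replace (sum_n (fun k => cauchy_coef r (fun _ => RtoC 1) k * q ^ k)%C n)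
    with (cauchy_coef r (fun _ => RtoC 1) 0); [now rewrite Cmod_self|].
  induction n as [|n IH].
  - rewrite sum_O. simpl. ring.
  - rewrite sum_Sn, <- IH, HS.
    change (cauchy_coef r (fun _ => RtoC 1) 0 =
      (cauchy_coef r (fun _ => RtoC 1) 0 + 0 * q ^ S n)%C). ring.
Qed.

Lemma holomorphic_continuous (U : C -> Prop) (f : C -> C) (z : C) :
  holomorphic_on U f -> U z -> @continuous C_UniformSpace C_UniformSpace f z.
Proof.
  intros Hf Hz. destruct (proj1 (ex_derive_Cderiv f z) (Hf z Hz)) as [l Hl].
  exact (Cderiv_continuous _ _ _ Hl).
Qed.

(** The circle contracts to [a + q] within the disc, along segments. *)
Lemma cauchy_formula (f : C -> C) (a : C) (rho r : R) (q : C) :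
  holomorphic_on (cdisc a rho) f -> r < rho -> Cmod q < r ->
  cauchy_integral r (fun t => f (a + circle r t)%C) q = (f (a + q)%C * (Ci * RtoC (2 * PI)))%C.
Proof.
  intros Hf HR Hq. assert (H0 := Cmod_ge_0 q).
  rewrite <- (cauchy_integral_1 r q Hq).
  assert (Hin : forall l t, 0 < l <= 1 -> cdisc a rho (a + q + RtoC l * (circle r t - q))%C).
  { intros l t Hl. unfold cdisc.
    replace (a + q + RtoC l * (circle r t - q) - a)%C
      with (RtoC (1 - l) * q + RtoC l * circle r t)%C by (rewrite RtoC_minus; ring).
    eapply Rle_lt_trans; [apply Cmod_triangle|].
    rewrite 2!Cmod_mult, 2!Cmod_R, Cmod_circle, 2!Rabs_right by lra. nra. }
  assert (H := homotopy_limit f (a + q) _ _ _ (circle_contracting r q Hq)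
    (fun l t Hl => proj1 (ex_derive_Cderiv f _) (Hf _ (Hin l t Hl))) 0 (2 * PI) PI2_pos).
  assert (E1 : forall t, (1 * (Ci * circle r t / (circle r t - q)) = Ci * circle r t / (circle r t - q))%C)
    by (intros t; ring).
  unfold cauchy_integral.
  transitivity (CInt (fun t : R => f (a + q + 1 * (circle r t - q)) *
       (Ci * circle r t / (circle r t - q)))%C 0 (2 * PI)).
  - apply (RInt_ext (V := C_R_CompleteNormedModule)). intros t _. as_C_eq.
    do 2 f_equal. ring.
  - rewrite H.
    + f_equal. apply (RInt_ext (V := C_R_CompleteNormedModule)). intros t _. as_C_eq. now rewrite E1.
    + now rewrite circle_period.
    + apply (holomorphic_continuous (cdisc a rho)); [exact Hf|]. unfold cdisc.
      replace (a + q - a)%C with q by ring. lra.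
Qed.

Lemma circle_values_continuous (f : C -> C) (a : C) (rho r : R) (t : R) :
  holomorphic_on (cdisc a rho) f -> 0 < r < rho ->
  @continuous R_UniformSpace C_UniformSpace (fun t => f (a + circle r t)%C) t.
Proof.
  intros Hf Hr. apply (continuous_Ccomp (fun t => a + circle r t)%C f).
  - apply continuous_Cplus; [apply continuous_Cconst|apply circle_continuous].
  - apply (holomorphic_continuous (cdisc a rho)); [exact Hf|]. unfold cdisc.
    replace (a + circle r t - a)%C with (circle r t) by ring. rewrite Cmod_circle; lra.
Qed.

Lemma TwoPiI_neq_0 : (Ci * RtoC (2 * PI))%C <> 0.
Proof.
  apply Cmult_neq_0; [apply Ci_nz|]. apply RtoC_neq_0. generalize PI_RGT_0. lra.
Qed.

Theorem holomorphic_power_series (f : C -> C) (a : C) (rho r : R) :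
  holomorphic_on (cdisc a rho) f -> 0 < r < rho ->
  exists u, Rbar_le r (radius u) /\ forall z, cdisc a r z -> f z = CPS u (z - a)%C.
Proof.
  intros Hf Hr. set (g := fun t => f (a + circle r t)%C).
  assert (Hg : forall t, @continuous R_UniformSpace C_UniformSpace g t)
    by (intros t; now apply circle_values_continuous with rho).
  assert (HN := TwoPiI_neq_0). set (N := (Ci * RtoC (2 * PI))%C) in *.
  exists (fun k => cauchy_coef r g k * / N)%C.
  assert (Hser : forall z, cdisc a r z ->
    Cseries (fun k => (cauchy_coef r g k * / N) * (z - a) ^ k)%C (f z)).
  { intros z Hz. assert (H := cauchy_integral_series r g (proj1 Hr) Hg (z - a)%C Hz).
    unfold g in H at 2. rewrite (cauchy_formula f a rho r (z - a)%C Hf (proj2 Hr) Hz) in H.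
    apply (Cseries_scal (/ N)%C) in H. fold N in H.
    replace (/ N * (f (a + (z - a)) * N))%C with (f z) in H.
    2:{ replace (a + (z - a))%C with z by ring. now field. }
    apply Cseries_ext with (2 := H). intros k. ring. }
  split.
  - apply radius_of_convergence; [lra|]. intros x Hx. exists (f (a + RtoC x)%C).
    assert (Hd : cdisc a r (a + RtoC x)%C).
    { unfold cdisc. replace (a + RtoC x - a)%C with (RtoC x) by ring.
      rewrite Cmod_R, Rabs_right; lra. }
    apply Cseries_ext with (2 := Hser _ Hd). intros n.
    now replace (a + RtoC x - a)%C with (RtoC x) by ring.
  - intros z Hz. symmetry. now apply CPS_unique, Hser.
Qed.

Lemma holomorphic_mean_value (f : C -> C) (a : C) (rho r B : R) :
  holomorphic_on (cdisc a rho) f -> 0 < r < rho ->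
  (forall t, 0 <= t <= 2 * PI -> Cmod (f (a + circle r t)%C) <= B) -> Cmod (f a) <= B.
Proof.
  intros Hf Hr HB.
  assert (H := cauchy_formula f a rho r 0 Hf (proj2 Hr) ltac:(rewrite Cmod_0; lra)).
  replace (a + 0)%C with a in H by ring.
  assert (H0 := is_RInt_const (V := C_R_NormedModule) 0 (2 * PI) (RtoC 0)).
  rewrite scal_R_Cmult, Cmult_0_r in H0.
  assert (E : Cmod (cauchy_integral r (fun t => f (a + circle r t)%C) 0 - 0) <= B * (2 * PI - 0)).
  { apply CInt_close with (3 := H0); [exact PI2_pos| |].
    - intros t _. apply cauchy_integral_continuous; [|rewrite Cmod_0; lra].
      intros u. now apply circle_values_continuous with rho.
    - intros t Ht. assert (Hn := circle_neq_0 r t (proj1 Hr)).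
      replace (f (a + circle r t) * (Ci * circle r t / (circle r t - 0)) - 0)%C
        with (f (a + circle r t) * Ci)%C by (field; now replace (circle r t - 0)%C with (circle r t) by ring).
      rewrite Cmod_mult, Cmod_Ci, Rmult_1_r. now apply HB. }
  rewrite H in E. replace (f a * (Ci * RtoC (2 * PI)) - 0)%C with (f a * (Ci * RtoC (2 * PI)))%C in E by ring.
  rewrite 2!Cmod_mult, Cmod_Ci, Cmod_R, Rabs_right in E by (apply Rle_ge, PI2_pos).
  generalize PI_RGT_0. nra.
Qed.

(** * Zeros and removable singularities *)

Lemma holomorphic_of_Cderiv (U : C -> Prop) (f : C -> C) :
  (forall z, U z -> exists l, Cderiv f z l) -> holomorphic_on U f.
Proof. intros H z Hz. now apply ex_derive_Cderiv, H. Qed.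

Lemma holomorphic_Cderiv (U : C -> Prop) (f : C -> C) (z : C) :
  holomorphic_on U f -> U z -> exists l, Cderiv f z l.
Proof. intros H Hz. now apply ex_derive_Cderiv, H. Qed.

Lemma holomorphic_subset (U V : C -> Prop) (f : C -> C) :
  subset U V -> holomorphic_on V f -> holomorphic_on U f.
Proof. intros HUV H z Hz. now apply H, HUV. Qed.

Lemma cdisc_open (a : C) (r : R) (z : C) :
  cdisc a r z -> exists d, 0 < d /\ forall w, cdisc z d w -> cdisc a r w.
Proof.
  intros Hz. unfold cdisc in *. exists (r - Cmod (z - a)). split; [lra|]. intros w Hw.
  generalize (Cmod_minus_triangle w z a). lra.
Qed.

Lemma cdisc_subset (a : C) (r r' : R) : r <= r' -> subset (cdisc a r) (cdisc a r').
Proof. intros H z Hz. unfold cdisc in *. lra. Qed.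

Lemma Cderiv_sub_const (f : C -> C) (c z l : C) :
  Cderiv f z l -> Cderiv (fun w => f w - c)%C z l.
Proof.
  intros H. generalize (Cderiv_plus f (fun _ => - c)%C z l 0 H (Cderiv_const (- c) z)).
  now rewrite Cplus_0_r.
Qed.

Lemma Cderiv_translate (f : C -> C) (a z l : C) :
  Cderiv f (z - a)%C l -> Cderiv (fun w => f (w - a)%C) z l.
Proof.
  intros H. replace l with (l * 1)%C by ring.
  apply (Cderiv_comp f (fun w => w - a)%C); [exact H|].
  exact (Cderiv_sub_const (fun w => w) a z 1 (Cderiv_id z)).
Qed.

Lemma CPS_translate_derive (u : nat -> C) (a z : C) (r : R) :
  Rbar_le r (radius u) -> cdisc a r z ->
  Cderiv (fun w => CPS u (w - a)%C) z (CPS (Cder u) (z - a)%C).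
Proof. intros Hu Hz. apply Cderiv_translate. now apply CPS_derive with r. Qed.

Lemma CPS_translate_holomorphic (u : nat -> C) (a : C) (r : R) :
  Rbar_le r (radius u) -> holomorphic_on (cdisc a r) (fun w => CPS u (w - a)%C).
Proof.
  intros Hu. apply holomorphic_of_Cderiv. intros z Hz.
  exists (CPS (Cder u) (z - a)%C). now apply CPS_translate_derive with r.
Qed.

Lemma Cderiv_congr_disc (f g : C -> C) (a z l : C) (r : R) :
  (forall w, cdisc a r w -> f w = g w) -> cdisc a r z -> Cderiv f z l -> Cderiv g z l.
Proof.
  intros Hfg Hz H. destruct (cdisc_open a r z Hz) as (d & Hd & Hs).
  apply Cderiv_ext_loc with (1 := Hd) (3 := H). intros w Hw. apply Hfg, Hs, Hw.
Qed.

Lemma derivative_holomorphic (f : C -> C) (a : C) (rho r : R) :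
  holomorphic_on (cdisc a rho) f -> 0 < r < rho ->
  exists f1, holomorphic_on (cdisc a r) f1 /\ forall z, cdisc a r z -> Cderiv f z (f1 z).
Proof.
  intros Hf Hr. destruct (holomorphic_power_series f a rho r Hf Hr) as (u & Hu & Hfu).
  exists (fun z => CPS (Cder u) (z - a)%C). split.
  - apply CPS_translate_holomorphic. now rewrite radius_Cder.
  - intros z Hz. apply Cderiv_congr_disc with (fun w => CPS u (w - a)%C) a r; trivial.
    + intros w Hw. symmetry. now apply Hfu.
    + now apply CPS_translate_derive with r.
Qed.

Lemma holomorphic_primitive (f : C -> C) (a c : C) (rho r : R) :
  holomorphic_on (cdisc a rho) f -> 0 < r < rho ->
  exists F, F a = c /\ forall z, cdisc a r z -> Cderiv F z (f z).
Proof.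
  intros Hf Hr. destruct (holomorphic_power_series f a rho r Hf Hr) as (u & Hu & Hfu).
  destruct (CPS_primitive u c) as (b & Hb0 & Hbr & Hb).
  exists (fun z => CPS b (z - a)%C). split.
  - replace (a - a)%C with (RtoC 0) by ring. rewrite (CPS_0 b r); [exact Hb0|lra|now rewrite Hbr].
  - intros z Hz. rewrite (Hfu z Hz).
    replace (CPS u (z - a)%C) with (CPS (Cder b) (z - a)%C).
    + apply CPS_translate_derive with r; [now rewrite Hbr|exact Hz].
    + apply CPS_unique. apply Cseries_ext with (fun n => u n * (z - a) ^ n)%C.
      * intros n. now rewrite Hb.
      * now apply CPS_correct with r.
Qed.

(** Divide by [q] until the constant coefficient is not zero; then continuity at [0]
    suffices. *)
Lemma CPS_isolated_zero (n : nat) : forall (a : nat -> C) (d : R),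
  0 < d -> Rbar_le d (radius a) -> a n <> 0 ->
  exists e, 0 < e /\ forall q, 0 < Cmod q < e -> CPS a q <> 0.
Proof.
  assert (Hbase : forall (a : nat -> C) (d : R), 0 < d -> Rbar_le d (radius a) -> a 0%nat <> 0 ->
    exists e, 0 < e /\ forall q, 0 < Cmod q < e -> CPS a q <> 0).
  { intros a d Hd Ha H0.
    assert (Hc : @continuous C_UniformSpace C_UniformSpace (CPS a) (RtoC 0)).
    { apply Cderiv_continuous with (CPS (Cder a) 0). apply CPS_derive with d; [exact Ha|].
      now rewrite Cmod_0. }
    destruct (proj1 (continuous_CC_iff _ _) Hc (Cmod (a 0%nat)) (Cmod_pos _ H0)) as (e & He & Hq).
    exists e. split; [exact He|]. intros q Hqe E. specialize (Hq q).
    replace (q - 0)%C with q in Hq by ring. specialize (Hq (proj2 Hqe)).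
    rewrite E, (CPS_0 a d Hd Ha) in Hq. rewrite Cmod_minus_sym in Hq.
    replace (a 0%nat - 0)%C with (a 0%nat) in Hq by ring. lra. }
  induction n as [|n IH]; intros a d Hd Ha Hn; [now apply (Hbase a d)|].
  destruct (Ceq_dec (a 0%nat) 0) as [E|E]; [|now apply (Hbase a d)].
  destruct (IH (fun k => a (S k)) d Hd) as (e & He & Hq); [now rewrite radius_shift|exact Hn|].
  exists (Rmin d e). split; [now apply Rmin_glb_lt|]. intros q Hqe.
  assert (Cmod q < d) by (eapply Rlt_le_trans; [apply Hqe|apply Rmin_l]).
  assert (Cmod q < e) by (eapply Rlt_le_trans; [apply Hqe|apply Rmin_r]).
  rewrite (CPS_shift a d q Ha) by assumption. rewrite E, Cplus_0_l.
  apply Cmult_neq_0; [apply Cmod_neq_0; lra|apply Hq; lra].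
Qed.

(** The coefficients may depend on the radius of the expansion, so the point [z] is
    fixed before the radius; one nonzero coefficient isolates the centre as a zero. *)
Lemma holomorphic_zero_dichotomy (f : C -> C) (a : C) (rho : R) :
  holomorphic_on (cdisc a rho) f ->
  (forall z, cdisc a rho z -> f z = 0) \/
  (exists e, 0 < e /\ forall z, 0 < Cmod (z - a) < e -> f z <> 0).
Proof.
  intros Hf. destruct (classic (exists e, 0 < e /\ forall z, 0 < Cmod (z - a) < e -> f z <> 0))
    as [H|H]; [now right|left].
  intros z Hz. unfold cdisc in Hz. assert (H0 := Cmod_ge_0 (z - a)).
  set (r := (Cmod (z - a) + rho) / 2).
  destruct (holomorphic_power_series f a rho r Hf) as (u & Hu & Hfu); [unfold r; lra|].
  assert (Hall : forall n, u n = 0).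
  { intros n. destruct (Ceq_dec (u n) 0) as [E|E]; [exact E|exfalso; apply H].
    destruct (CPS_isolated_zero n u r ltac:(unfold r; lra) Hu E) as (e & He & Hq).
    exists (Rmin r e). split; [apply Rmin_glb_lt; [unfold r; lra|exact He]|]. intros w Hw.
    assert (Cmod (w - a) < r) by (eapply Rlt_le_trans; [apply Hw|apply Rmin_l]).
    assert (Cmod (w - a) < e) by (eapply Rlt_le_trans; [apply Hw|apply Rmin_r]).
    rewrite Hfu by assumption. apply Hq. lra. }
  assert (Hzr : cdisc a r z) by (unfold cdisc, r; lra).
  rewrite (Hfu z Hzr). apply CPS_unique.
  assert (HS := Cseries_scal 0 _ _ (CPS_correct u r _ Hu Hzr)).
  rewrite Cmult_0_l in HS. apply Cseries_ext with (2 := HS).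
  intros n. rewrite Hall. ring.
Qed.

Lemma holomorphic_minus (U : C -> Prop) (f g : C -> C) :
  holomorphic_on U f -> holomorphic_on U g -> holomorphic_on U (fun z => f z - g z)%C.
Proof.
  intros Hf Hg. apply holomorphic_of_Cderiv. intros z Hz.
  destruct (holomorphic_Cderiv U f z Hf Hz) as [l Hl].
  destruct (holomorphic_Cderiv U g z Hg Hz) as [m Hm].
  exists (l + (0 * g z + (- RtoC 1) * m))%C.
  apply Cderiv_ext_loc with (f := fun w => (f w + (- RtoC 1) * g w)%C) (d := 1); [lra| |].
  - intros w _. ring.
  - apply Cderiv_plus; [exact Hl|].
    apply (Cderiv_mult (fun _ => - RtoC 1)%C g); [apply Cderiv_const|exact Hm].
Qed.

(** The difference vanishes at real points arbitrarily close to the centre. *)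
Lemma identity_on_reals (f g : C -> C) (x rho d : R) :
  holomorphic_on (cdisc (RtoC x) rho) f -> holomorphic_on (cdisc (RtoC x) rho) g ->
  0 < d -> (forall t, Rabs (t - x) < d -> f (RtoC t) = g (RtoC t)) ->
  forall z, cdisc (RtoC x) rho z -> f z = g z.
Proof.
  intros Hf Hg Hd Hfg z Hz. apply Cminus_eq_0.
  destruct (holomorphic_zero_dichotomy _ _ _ (holomorphic_minus _ _ _ Hf Hg)) as [H|(e & He & H)].
  - now apply H.
  - exfalso. set (m := Rmin d e / 2).
    assert (Hm : 0 < Rmin d e) by now apply Rmin_glb_lt.
    assert (Rmin d e <= d) by apply Rmin_l. assert (Rmin d e <= e) by apply Rmin_r.
    apply (H (RtoC (x + m))).
    + rewrite <- RtoC_minus, Cmod_R. replace (x + m - x) with m by ring.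
      rewrite Rabs_right; unfold m; lra.
    + rewrite Hfg; [ring|]. replace (x + m - x) with m by ring. rewrite Rabs_right; unfold m; lra.
Qed.

(** [(w - a) * f w] is complex differentiable at [a] too as soon as [f] is continuous
    there; division of its power series by [w - a] gives one for [f]. *)
Lemma removable_singularity (f : C -> C) (a : C) (rho : R) :
  0 < rho -> @continuous C_UniformSpace C_UniformSpace f a ->
  (forall z, 0 < Cmod (z - a) < rho -> exists l, Cderiv f z l) ->
  exists l, Cderiv f a l.
Proof.
  intros HR Hc Hf. set (h := fun w => ((w - a) * f w)%C).
  assert (Hha : Cderiv h a (f a)).
  { apply Cderiv_caratheodory. exists f. split; [exact Hc|]. split; [reflexivity|].
    intros w. unfold h. ring. }
  assert (Hh : holomorphic_on (cdisc a rho) h).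
  { apply holomorphic_of_Cderiv. intros z Hz.
    destruct (Ceq_dec z a) as [->|E]; [now exists (f a)|].
    destruct (Hf z) as [l Hl].
    { split; [|exact Hz]. now apply Cmod_pos, Cminus_eq_contra. }
    exists (1 * f z + (z - a) * l)%C. apply (Cderiv_mult (fun w => w - a)%C f); [|exact Hl].
    exact (Cderiv_sub_const (fun w => w) a z 1 (Cderiv_id z)). }
  destruct (holomorphic_power_series h a rho (rho / 2) Hh) as (u & Hu & Hhu); [lra|].
  set (v := fun n => u (S n)).
  assert (Hv : Rbar_le (rho / 2) (radius v)) by (unfold v; now rewrite radius_shift).
  assert (Ha : cdisc a (rho / 2) a) by (apply cdisc_center; lra).
  assert (Hu0 : u 0%nat = 0).
  { assert (E := Hhu a Ha). replace (a - a)%C with (RtoC 0) in E by ring.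
    rewrite (CPS_0 u (rho / 2)) in E by (trivial; lra). rewrite <- E. unfold h. ring. }
  assert (Hhv : forall w, cdisc a (rho / 2) w -> h w = ((w - a) * CPS v (w - a))%C).
  { intros w Hw. rewrite (Hhu w Hw), (CPS_shift u (rho / 2) _ Hu Hw), Hu0. unfold v. ring. }
  assert (Hd := CPS_translate_derive v a a (rho / 2) Hv Ha).
  assert (Hfa : f a = CPS v (a - a)%C).
  { apply (Cderiv_unique h a); [exact Hha|].
    apply Cderiv_congr_disc with (fun w => (w - a) * CPS v (w - a))%C a (rho / 2); trivial.
    - intros w Hw. symmetry. now apply Hhv.
    - apply Cderiv_caratheodory. exists (fun w => CPS v (w - a)%C).
      split; [exact (Cderiv_continuous _ _ _ Hd)|]. split; [reflexivity|]. intros w. ring. }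
  exists (CPS (Cder v) (a - a)%C).
  apply Cderiv_congr_disc with (fun w => CPS v (w - a)%C) a (rho / 2); trivial.
  intros w Hw. destruct (Ceq_dec w a) as [->|E]; [now symmetry|].
  assert (Hw' := Hhv w Hw). unfold h in Hw'.
  assert (N : (w - a)%C <> 0) by now apply Cminus_eq_contra.
  replace (f w) with ((w - a) * f w / (w - a))%C by (now field). rewrite Hw'. now field.
Qed.

(** * Local inverses *)

(** If some [w] near [f a] were not a value of [f], then [1 / (f - w)] would be
    holomorphic and larger at the centre than on a circle around it, on which
    injectivity keeps [f] away from [f a]. *)
Lemma injective_open (f : C -> C) (a : C) (rho : R) :
  0 < rho -> conformal_on (cdisc a rho) f ->
  exists e, 0 < e /\ forall w, cdisc (f a) e w -> exists z, cdisc a rho z /\ f z = w.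
Proof.
  intros HR [Hf Hinj]. set (r := rho / 2).
  destruct (continuous_bounded (fun t => - Cmod (f (a + circle r t)%C - f a)) 0 (2 * PI) PI2_pos)
    as (t0 & _ & Ht0).
  { intros t. apply (continuous_opp (V := R_NormedModule)). apply continuous_Cmod.
    apply continuous_Cminus; [|apply continuous_Cconst].
    apply circle_values_continuous with rho; [exact Hf|unfold r; lra]. }
  assert (Hin : forall t, cdisc a rho (a + circle r t)%C).
  { intros t. unfold cdisc. replace (a + circle r t - a)%C with (circle r t) by ring.
    rewrite Cmod_circle; unfold r; lra. }
  set (m := Cmod (f (a + circle r t0)%C - f a)).
  assert (Hm : 0 < m).
  { apply Cmod_pos, Cminus_eq_contra. intros E.
    apply Hinj in E; [|apply Hin|now apply cdisc_center].
    apply (circle_neq_0 r t0); [unfold r; lra|].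
    replace (circle r t0) with ((a + circle r t0) - a)%C by ring. rewrite E. ring. }
  exists (m / 2). split; [lra|]. intros w Hw.
  destruct (classic (exists z, cdisc a rho z /\ f z = w)) as [H|H]; [exact H|exfalso].
  assert (Hne : forall z, cdisc a rho z -> (f z - w)%C <> 0).
  { intros z Hz E. apply H. exists z. split; [exact Hz|now apply Cminus_eq_0]. }
  assert (Hg : holomorphic_on (cdisc a rho) (fun z => / (f z - w))%C).
  { apply holomorphic_of_Cderiv. intros z Hz.
    destruct (holomorphic_Cderiv _ f z Hf Hz) as [l Hl].
    exists (- l / ((f z - w) * (f z - w)))%C.
    apply (Cderiv_inv (fun z => f z - w)%C); [now apply Hne|].
    now apply Cderiv_sub_const. }
  assert (Hle : Cmod (/ (f a - w)) <= / (m / 2)).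
  { apply (holomorphic_mean_value (fun z => / (f z - w))%C a rho r); [exact Hg|unfold r; lra|].
    intros t Ht. rewrite Cmod_inv by (apply Hne, Hin). apply Rinv_le_contravar; [lra|].
    specialize (Ht0 t Ht). fold m in Ht0.
    generalize (Cmod_minus_triangle (f (a + circle r t)%C) w (f a)). unfold cdisc in Hw. lra. }
  assert (Haw := Hne a (cdisc_center a rho HR)).
  rewrite Cmod_inv in Hle by exact Haw.
  assert (Cmod (f a - w) < m / 2) by (rewrite Cmod_minus_sym; exact Hw).
  assert (/ (m / 2) < / Cmod (f a - w)).
  { apply Rinv_lt_contravar; [|assumption]. apply Rmult_lt_0_compat; [now apply Cmod_pos|lra]. }
  lra.
Qed.

Definition inverse_on (U : C -> Prop) (f : C -> C) (w : C) : C :=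
  epsilon (inhabits (RtoC 0)) (fun z => U z /\ f z = w).

Lemma inverse_on_eq (U : C -> Prop) (f : C -> C) (z : C) :
  injective_on U f -> U z -> inverse_on U f (f z) = z.
Proof.
  intros Hinj Hz. unfold inverse_on.
  destruct (epsilon_spec (inhabits (RtoC 0)) (fun z' => U z' /\ f z' = f z)) as [H1 H2].
  - now exists z.
  - now apply Hinj.
Qed.

Lemma conformal_sub_disc (f : C -> C) (a z : C) (rho d : R) :
  conformal_on (cdisc a rho) f -> (forall w, cdisc z d w -> cdisc a rho w) ->
  conformal_on (cdisc z d) f.
Proof.
  intros [Hf Hinj] Hs. split.
  - now apply holomorphic_subset with (cdisc a rho).
  - intros x y Hx Hy. apply Hinj; now apply Hs.
Qed.

Lemma inverse_continuous (f : C -> C) (a z : C) (rho : R) :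
  conformal_on (cdisc a rho) f -> cdisc a rho z ->
  forall d, 0 < d -> exists e, 0 < e /\ forall w, cdisc (f z) e w ->
    cdisc z d (inverse_on (cdisc a rho) f w) /\
    cdisc a rho (inverse_on (cdisc a rho) f w) /\ f (inverse_on (cdisc a rho) f w) = w.
Proof.
  intros Hf Hz d Hd. destruct (cdisc_open a rho z Hz) as (d' & Hd' & Hs).
  assert (Hm : 0 < Rmin d d') by now apply Rmin_glb_lt.
  assert (Hs' : forall w, cdisc z (Rmin d d') w -> cdisc a rho w).
  { intros w Hw. apply Hs. unfold cdisc in *. eapply Rlt_le_trans; [exact Hw|apply Rmin_r]. }
  destruct (injective_open f z (Rmin d d') Hm (conformal_sub_disc _ _ _ _ _ Hf Hs')) as (e & He & H).
  exists e. split; [exact He|]. intros w Hw. destruct (H w Hw) as (x & Hx & <-).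
  rewrite (inverse_on_eq _ _ x (proj2 Hf) (Hs' x Hx)).
  split; [|split; [now apply Hs'|reflexivity]].
  unfold cdisc in *. eapply Rlt_le_trans; [exact Hx|apply Rmin_l].
Qed.

Lemma inverse_continuous_at (f : C -> C) (a z : C) (rho : R) :
  conformal_on (cdisc a rho) f -> cdisc a rho z ->
  @continuous C_UniformSpace C_UniformSpace (inverse_on (cdisc a rho) f) (f z).
Proof.
  intros Hf Hz. apply continuous_CC_iff. intros eps He.
  destruct (inverse_continuous f a z rho Hf Hz eps He) as (e & Hepos & H).
  exists e. split; [exact Hepos|]. intros w Hw.
  rewrite (inverse_on_eq _ _ z (proj2 Hf) Hz). now apply H.
Qed.

Lemma inverse_derive (f : C -> C) (a z l : C) (rho : R) :
  conformal_on (cdisc a rho) f -> cdisc a rho z -> Cderiv f z l -> l <> 0 ->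
  Cderiv (inverse_on (cdisc a rho) f) (f z) (/ l)%C.
Proof.
  intros Hf Hz Hl H0. set (Q := inverse_on (cdisc a rho) f).
  assert (HQc := inverse_continuous_at f a z rho Hf Hz). fold Q in HQc.
  assert (HQz : Q (f z) = z) by (apply inverse_on_eq; [apply Hf|exact Hz]).
  apply Cderiv_caratheodory in Hl. destruct Hl as (p & Hp & Hpz & Hpw).
  destruct (inverse_continuous f a z rho Hf Hz 1 Rlt_0_1) as (e & He & HQ). fold Q in HQ.
  assert (Hp0 : p z <> 0) by now rewrite Hpz.
  apply Cderiv_ext_loc with (f := fun w => (z + / p (Q w) * (w - f z))%C) (d := e); [exact He| |].
  - intros w Hw. destruct (HQ w Hw) as (_ & _ & HfQ).
    assert (E := Hpw (Q w)). rewrite HfQ in E.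
    destruct (Ceq_dec (p (Q w)) 0) as [P0|P0].
    (* the slope can only vanish where [w = f z], and there it equals [l] *)
    + exfalso. rewrite P0 in E. assert (w = f z) by (rewrite E; ring). subst w.
      rewrite HQz in P0. contradiction.
    + rewrite E at 2. field. exact P0.
  - apply Cderiv_caratheodory. exists (fun w => / p (Q w))%C. split; [|split].
    + apply continuous_Cinv; [now rewrite HQz|].
      apply (continuous_Ccomp Q p); [exact HQc|now rewrite HQz].
    + now rewrite HQz, Hpz.
    + intros w. ring.
Qed.

Lemma segment_derive (f : C -> C) (w h l : C) (t : R) :
  Cderiv f (w + RtoC t * h)%C l -> Rderiv (fun t => f (w + RtoC t * h)%C) t (l * h)%C.
Proof.
  intros H. apply (Rderiv_comp f (fun t => w + RtoC t * h)%C); [exact H|].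
  apply Rderiv_iff. intros eps He. exists 1. split; [lra|]. intros u _.
  replace (w + RtoC u * h - (w + RtoC t * h) - RtoC (u - t) * h)%C with (RtoC 0)
    by (rewrite RtoC_minus; ring).
  rewrite Cmod_0. apply Rmult_le_pos; [lra|apply Rabs_pos].
Qed.

Lemma cdisc_convex (a z w : C) (r t : R) :
  cdisc a r z -> cdisc a r w -> 0 <= t <= 1 -> cdisc a r (w + RtoC t * (z - w))%C.
Proof.
  unfold cdisc. intros Hz Hw Ht.
  replace (w + RtoC t * (z - w) - a)%C with (RtoC (1 - t) * (w - a) + RtoC t * (z - a))%C
    by (rewrite RtoC_minus; ring).
  eapply Rle_lt_trans; [apply Cmod_triangle|]. rewrite 2!Cmod_mult, 2!Cmod_R, 2!Rabs_right by lra.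
  destruct (Rle_dec t (1 / 2)); nra.
Qed.

(** [f z - f w] is the integral of the derivative along the segment from [w] to [z]. *)
Lemma increment_close (f f1 : C -> C) (a l z w : C) (r m : R) :
  (forall x, cdisc a r x -> Cderiv f x (f1 x)) -> holomorphic_on (cdisc a r) f1 ->
  (forall x, cdisc a r x -> Cmod (f1 x - l) <= m) -> cdisc a r z -> cdisc a r w ->
  Cmod (f z - f w - l * (z - w)) <= m * Cmod (z - w).
Proof.
  intros Hd Hf1 Hm Hz Hw.
  assert (Hseg : forall t, 0 <= t <= 1 -> cdisc a r (w + RtoC t * (z - w))%C)
    by (intros t Ht; now apply cdisc_convex).
  assert (Hcont : Ccontinuous_on (fun t => f1 (w + RtoC t * (z - w)) * (z - w))%C 0 1).
  { intros t Ht. apply continuous_Cmult; [|apply continuous_Cconst].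
    apply (continuous_Ccomp (fun t => w + RtoC t * (z - w))%C f1).
    - apply continuous_Cplus; [apply continuous_Cconst|].
      apply continuous_Cmult; [apply continuous_RtoC|apply continuous_Cconst].
    - apply (holomorphic_continuous (cdisc a r)); [exact Hf1|now apply Hseg]. }
  assert (HI := is_CInt_derive (fun t => f (w + RtoC t * (z - w))%C)
    (fun t => f1 (w + RtoC t * (z - w)) * (z - w))%C 0 1 Rle_0_1
    (fun t Ht => segment_derive f w (z - w)%C _ t (Hd _ (Hseg t Ht))) Hcont).
  apply CInt_unique in HI.
  replace (w + RtoC 1 * (z - w))%C with z in HI by ring.
  replace (w + RtoC 0 * (z - w))%C with w in HI by ring.
  rewrite <- HI.
  assert (H0 := is_RInt_const (V := C_R_NormedModule) 0 1 (l * (z - w))%C).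
  rewrite scal_R_Cmult in H0. replace (1 - 0) with 1 in H0 by ring. rewrite Cmult_1_l in H0.
  replace (m * Cmod (z - w)) with (m * Cmod (z - w) * (1 - 0)) by ring.
  apply CInt_close with (3 := H0); [lra|exact Hcont|].
  intros t Ht.
  replace (f1 (w + RtoC t * (z - w)) * (z - w) - l * (z - w))%C
    with ((f1 (w + RtoC t * (z - w)) - l) * (z - w))%C by ring.
  rewrite Cmod_mult. apply Rmult_le_compat_r; [apply Cmod_ge_0|]. now apply Hm, Hseg.
Qed.

(** If the derivative vanished at [a], then, its zeros being isolated, the continuous
    inverse would be holomorphic off [f a], hence at [f a] as well, and the chain rule
    at [a] would read [1 = 0]. *)
Lemma conformal_derivative_neq_0 (f : C -> C) (a l : C) (rho : R) :
  0 < rho -> conformal_on (cdisc a rho) f -> Cderiv f a l -> l <> 0.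
Proof.
  intros HR Hf Hl E. subst l.
  destruct (derivative_holomorphic f a rho (rho / 2) (proj1 Hf)) as (f1 & Hf1 & Hd); [lra|].
  set (Q := inverse_on (cdisc a rho) f).
  destruct (holomorphic_zero_dichotomy f1 a (rho / 2) Hf1) as [H|(e & He & H)].
  (* [f] would be constant near [a] *)
  - set (z := (a + RtoC (rho / 4))%C).
    assert (Hz : Cmod (z - a) = rho / 4).
    { unfold z. replace (a + RtoC (rho / 4) - a)%C with (RtoC (rho / 4)) by ring.
      rewrite Cmod_R, Rabs_right; lra. }
    assert (HE : Cmod (f z - f a - 0 * (z - a)) <= 0 * Cmod (z - a)).
    { apply (increment_close f f1 a 0 z a (rho / 2) 0 Hd Hf1).
      - intros x Hx. rewrite (H x Hx), Cmod_self. lra.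
      - unfold cdisc. lra.
      - apply cdisc_center. lra. }
    assert (Heq : f z = f a).
    { apply Cminus_eq_0, Cmod_eq_0. apply Rle_antisym; [|apply Cmod_ge_0].
      replace (f z - f a)%C with (f z - f a - 0 * (z - a))%C by ring. lra. }
    apply (proj2 Hf) in Heq; [|unfold cdisc; lra|now apply cdisc_center].
    rewrite Heq, Cmod_self in Hz. lra.
  (* the inverse is holomorphic off [f a] and continuous at it, so holomorphic at it *)
  - assert (Ha := cdisc_center a rho HR).
    assert (Hm : 0 < Rmin e (rho / 2)) by (apply Rmin_glb_lt; lra).
    destruct (inverse_continuous f a a rho Hf Ha _ Hm) as (e' & He' & HQ). fold Q in HQ.
    destruct (removable_singularity Q (f a) e' He') as [m HmQ].
    + now apply inverse_continuous_at.
    + intros w [Hw0 Hw]. destruct (HQ w Hw) as (H1 & H2 & H3). unfold cdisc in H1.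
      assert (Cmod (Q w - a) < e) by (eapply Rlt_le_trans; [exact H1|apply Rmin_l]).
      assert (HR2 : cdisc a (rho / 2) (Q w)) by (eapply Rlt_le_trans; [exact H1|apply Rmin_r]).
      exists (/ f1 (Q w))%C. rewrite <- H3 at 1. apply inverse_derive; trivial; [now apply Hd|].
      apply H. split; [|assumption]. apply Cmod_pos, Cminus_eq_contra. intros E.
      rewrite <- H3, E, Cmod_self in Hw0. lra.
    + assert (HQf := Cderiv_comp Q f a m 0 HmQ Hl).
      assert (Hid : Cderiv (fun w => Q (f w)) a 1).
      { apply Cderiv_congr_disc with (fun w => w) a rho; trivial; [|apply Cderiv_id].
        intros w Hw. symmetry. now apply inverse_on_eq; [apply Hf|]. }
      apply C1_nz. rewrite (Cderiv_unique _ _ _ _ Hid HQf). ring.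
Qed.

Lemma conformal_local_inverse (f : C -> C) (a : C) (rho : R) :
  0 < rho -> conformal_on (cdisc a rho) f ->
  exists (e : R) (Q : C -> C), 0 < e /\ holomorphic_on (cdisc (f a) e) Q /\
    forall w, cdisc (f a) e w -> cdisc a rho (Q w) /\ f (Q w) = w.
Proof.
  intros HR Hf. set (Q := inverse_on (cdisc a rho) f).
  destruct (inverse_continuous f a a rho Hf (cdisc_center a rho HR) 1 Rlt_0_1) as (e & He & HQ).
  fold Q in HQ. exists e, Q. split; [exact He|]. split; [|intros w Hw; now apply HQ].
  apply holomorphic_of_Cderiv. intros w Hw. destruct (HQ w Hw) as (_ & Hz & HfQ).
  destruct (holomorphic_Cderiv _ f _ (proj1 Hf) Hz) as [l Hl].
  exists (/ l)%C. rewrite <- HfQ at 1. apply inverse_derive; trivial.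
  destruct (cdisc_open a rho _ Hz) as (d & Hd & Hs).
  apply (conformal_derivative_neq_0 f (Q w) l d Hd); [|exact Hl].
  now apply conformal_sub_disc with a rho.
Qed.

(** Near [a] the increments of [f] are close to those of the injective map [z |-> l z]. *)
Lemma locally_conformal (f : C -> C) (a l : C) (rho : R) :
  0 < rho -> holomorphic_on (cdisc a rho) f -> Cderiv f a l -> l <> 0 ->
  exists r, 0 < r <= rho /\ conformal_on (cdisc a r) f.
Proof.
  intros HR Hf Hl H0.
  destruct (derivative_holomorphic f a rho (rho / 2) Hf) as (f1 & Hf1 & Hd); [lra|].
  assert (Ha : cdisc a (rho / 2) a) by (apply cdisc_center; lra).
  assert (Hla : f1 a = l) by (exact (Cderiv_unique _ _ _ _ (Hd a Ha) Hl)).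
  assert (Hp := Cmod_pos _ H0).
  destruct (proj1 (continuous_CC_iff f1 a) (holomorphic_continuous _ _ _ Hf1 Ha) (Cmod l / 2))
    as (d & Hdp & Hc); [lra|].
  set (r := Rmin d (rho / 2)).
  assert (Hr : 0 < r) by (apply Rmin_glb_lt; lra).
  assert (r <= d) by apply Rmin_l. assert (Hr2 : r <= rho / 2) by apply Rmin_r.
  assert (Hs := cdisc_subset a r (rho / 2) Hr2).
  exists r. split; [lra|]. split.
  - apply holomorphic_subset with (cdisc a rho); [apply cdisc_subset; lra|exact Hf].
  - intros z w Hz Hw E.
    assert (HE : Cmod (f z - f w - l * (z - w)) <= Cmod l / 2 * Cmod (z - w)).
    { apply (increment_close f f1 a l z w r); trivial.
      - intros x Hx. now apply Hd, Hs.
      - now apply holomorphic_subset with (cdisc a (rho / 2)).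
      - intros x Hx. rewrite <- Hla at 1. left. apply Hc. unfold cdisc in Hx. lra. }
    rewrite E in HE. replace (f w - f w - l * (z - w))%C with (- (l * (z - w)))%C in HE by ring.
    rewrite Cmod_opp, Cmod_mult in HE.
    apply Cminus_eq_0, Cmod_eq_0. generalize (Cmod_ge_0 (z - w)). nra.
Qed.

(** * Real analytic functions as restrictions of holomorphic functions *)

Lemma cdisc_RtoC (x r t : R) : cdisc (RtoC x) r (RtoC t) <-> Rabs (t - x) < r.
Proof. unfold cdisc. now rewrite <- RtoC_minus, Cmod_R. Qed.

Lemma pseries_R_iff (a : nat -> C) (x : R) (l : C) :
  @is_pseries R_AbsRing C_R_NormedModule a x l <-> Cseries (fun n => a n * RtoC x ^ n)%C l.
Proof.
  assert (E : forall n, scal (pow_n (K := R_Ring) x n) (a n : C_R_NormedModule) = (a n * RtoC x ^ n)%C).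
  { intros n. rewrite scal_R_Cmult, pow_n_pow, RtoC_pow. as_C_eq. ring. }
  split; intros H.
  - apply Cseries_ext with (1 := E). exact H.
  - apply (is_series_ext (V := C_R_NormedModule)) with (1 := fun n => eq_sym (E n)). exact H.
Qed.

Definition extends_near (h : R -> C) (t0 d : R) (H : C -> C) : Prop :=
  holomorphic_on (cdisc (RtoC t0) d) H /\ forall t, Rabs (t - t0) < d -> H (RtoC t) = h t.

(** A series that converges on a real interval converges on the disc over it;
    conversely, a holomorphic function has a power series at [t0]. *)
Lemma real_analytic_iff (h : R -> C) :
  real_analytic h <-> forall t0, exists d H, 0 < d /\ extends_near h t0 d H.
Proof.
  split.
  - intros Hh t0. destruct (Hh t0) as (a & d & Hd & Ha).
    assert (Hr : Rbar_le d (radius a)).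
    { apply radius_of_convergence; [exact Hd|]. intros x Hx. exists (h (t0 + x)).
      apply pseries_R_iff. specialize (Ha (t0 + x)). replace (t0 + x - t0) with x in Ha by ring.
      apply Ha. rewrite Rabs_right; lra. }
    exists d, (fun z => CPS a (z - RtoC t0)%C). split; [exact Hd|]. split.
    + now apply CPS_translate_holomorphic.
    + intros t Ht. apply CPS_unique. rewrite <- RtoC_minus. now apply pseries_R_iff, Ha.
  - intros Hh t0. destruct (Hh t0) as (d & H & Hd & HH & Hext).
    destruct (holomorphic_power_series H (RtoC t0) d (d / 2) HH) as (u & Hu & HHu); [lra|].
    exists u, (d / 2). split; [lra|]. intros t Ht. apply pseries_R_iff.
    assert (Hin : cdisc (RtoC t0) (d / 2) (RtoC t)) by now apply cdisc_RtoC.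
    rewrite <- Hext by lra. rewrite (HHu _ Hin), RtoC_minus.
    now apply CPS_correct with (d / 2).
Qed.

Lemma holomorphic_maps_into (g : C -> C) (a : C) (r : R) (V : C -> Prop) :
  0 < r -> holomorphic_on (cdisc a r) g -> @open C_UniformSpace V -> V (g a) ->
  exists d, 0 < d <= r /\ forall z, cdisc a d z -> V (g z).
Proof.
  intros Hr Hg HV Hga. destruct (proj1 (open_C_iff V) HV _ Hga) as (e & He & HVe).
  destruct (proj1 (continuous_CC_iff g a) (holomorphic_continuous _ _ _ Hg (cdisc_center a r Hr)) e He)
    as (d & Hd & H).
  exists (Rmin d r). split; [split; [now apply Rmin_glb_lt|apply Rmin_r]|].
  intros z Hz. apply HVe, H. eapply Rlt_le_trans; [exact Hz|apply Rmin_l].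
Qed.

Lemma cdisc_is_open (a : C) (r : R) : @open C_UniformSpace (cdisc a r).
Proof. apply open_C_iff. intros z Hz. now apply cdisc_open. Qed.

Lemma holomorphic_comp (f g : C -> C) (U V : C -> Prop) :
  holomorphic_on U g -> holomorphic_on V f -> (forall z, U z -> V (g z)) ->
  holomorphic_on U (fun z => f (g z)).
Proof.
  intros Hg Hf HUV. apply holomorphic_of_Cderiv. intros z Hz.
  destruct (holomorphic_Cderiv _ _ _ Hg Hz) as [m Hm].
  destruct (holomorphic_Cderiv _ _ _ Hf (HUV z Hz)) as [l Hl].
  exists (l * m)%C. now apply Cderiv_comp.
Qed.

Lemma fst_le_Cmod (z : C) : Rabs (fst z) <= Cmod z.
Proof. eapply Rle_trans; [apply Rmax_l|apply Rmax_Cmod]. Qed.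

Lemma snd_le_Cmod (z : C) : Rabs (snd z) <= Cmod z.
Proof. eapply Rle_trans; [apply Rmax_r|apply Rmax_Cmod]. Qed.

(** * The parametrization continued to complex times *)

(** [e^{iz}] *)
Definition cisC (z : C) : C := (RtoC (exp (- snd z)) * cis (fst z))%C.

Lemma cisC_RtoC (t : R) : cisC (RtoC t) = cis t.
Proof. unfold cisC. simpl. rewrite Ropp_0, exp_0. ring. Qed.

Lemma Cmod_cisC (z : C) : Cmod (cisC z) = exp (- snd z).
Proof.
  unfold cisC. rewrite Cmod_mult, Cmod_cis, Cmod_R, Rabs_right; [ring|].
  left. apply exp_pos.
Qed.

Lemma cisC_neq_0 (z : C) : cisC z <> 0.
Proof. apply Cmod_neq_0. rewrite Cmod_cisC. apply exp_pos. Qed.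

Lemma cisC_plus (z w : C) : cisC (z + w) = (cisC z * cisC w)%C.
Proof.
  unfold cisC. simpl. rewrite Ropp_plus_distr, exp_plus, cis_plus, RtoC_mult. ring.
Qed.

Lemma cisC_eq (z w : C) : cisC z = cisC w -> exists k : Z, z = (w + RtoC (2 * IZR k * PI))%C.
Proof.
  intros H. assert (Hm : exp (- snd z) = exp (- snd w)) by (rewrite <- 2!Cmod_cisC; now f_equal).
  apply exp_inv in Hm. unfold cisC in H. rewrite Hm in H.
  assert (N : RtoC (exp (- snd w)) <> 0) by (apply RtoC_neq_0; generalize (exp_pos (- snd w)); lra).
  assert (Hc : cis (fst z) = cis (fst w)).
  { replace (cis (fst z)) with (RtoC (exp (- snd w)) * cis (fst z) / RtoC (exp (- snd w)))%C by (now field).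
    rewrite H. now field. }
  destruct (cis_eq _ _ Hc) as [k Hk]. exists k. apply injective_projections; simpl; lra.
Qed.

Lemma exp_remainder (eps : R) : 0 < eps ->
  exists d, 0 < d /\ forall y, Rabs y < d -> Rabs (exp (- y) - 1 + y) <= eps * Rabs y.
Proof.
  intros He. destruct (derivable_pt_lim_exp_0 eps He) as [d Hd].
  exists d. split; [apply cond_pos|]. intros y Hy.
  destruct (Req_dec y 0) as [->|Hn].
  - rewrite Ropp_0, exp_0. replace (1 - 1 + 0) with 0 by ring. rewrite Rabs_R0. lra.
  - specialize (Hd (- y)). rewrite Rplus_0_l, exp_0, Rabs_Ropp in Hd.
    specialize (Hd ltac:(lra) Hy). left.
    replace (exp (- y) - 1 + y) with (((exp (- y) - 1) / - y - 1) * - y) by (field; lra).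
    rewrite Rabs_mult, Rabs_Ropp. apply Rmult_lt_compat_r; [now apply Rabs_pos_lt|exact Hd].
Qed.

(** By the addition formula only the derivative at [0] matters; there
    [e^{i(x+iy)} - 1 - i(x+iy)] splits into the remainders of [e^{-y}] and [cis x] and a
    product of two small factors. *)
Lemma cisC_derive (z : C) : Cderiv cisC z (Ci * cisC z)%C.
Proof.
  intros eps He. assert (Hm := Cmod_pos _ (cisC_neq_0 z)). set (m := Cmod (cisC z)) in *.
  set (e := Rmin 1 (eps / m / 3)).
  assert (He0 : 0 < eps / m / 3) by (repeat apply Rdiv_lt_0_compat; lra).
  assert (He1 : 0 < e) by (apply Rmin_glb_lt; lra).
  assert (He3 : m * (3 * e) <= eps).
  { replace eps with (m * (3 * (eps / m / 3))) at 1 by (field; lra).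
    apply Rmult_le_compat_l; [lra|]. apply Rmult_le_compat_l; [lra|apply Rmin_r]. }
  destruct (exp_remainder e He1) as (d1 & Hd1 & H1).
  destruct (proj1 (Rderiv_iff cis 0 _) (cis_derive 0) e He1) as (d2 & Hd2 & H2).
  destruct (proj1 (continuous_RC_iff cis 0) (cis_continuous 0) e He1) as (d3 & Hd3 & H3).
  exists (Rmin d1 (Rmin d2 d3)). split; [repeat apply Rmin_glb_lt; assumption|].
  intros w Hw. set (h := (w - z)%C) in *. replace w with (z + h)%C by (unfold h; ring).
  rewrite cisC_plus.
  replace (cisC z * cisC h - cisC z - Ci * cisC z * h)%C
    with (cisC z * (cisC h - 1 - Ci * h))%C by ring.
  rewrite Cmod_mult. fold m.
  set (x := fst h). set (y := snd h). set (M := Cmod h) in *.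
  assert (Hx : Rabs x <= M) by apply fst_le_Cmod.
  assert (Hy : Rabs y <= M) by apply snd_le_Cmod.
  assert (M < d1 /\ M < d2 /\ M < d3) as (Hw1 & Hw2 & Hw3).
  { generalize (Rmin_l d1 (Rmin d2 d3)) (Rmin_r d1 (Rmin d2 d3)) (Rmin_l d2 d3) (Rmin_r d2 d3). lra. }
  specialize (H1 y ltac:(lra)). specialize (H2 x). specialize (H3 x).
  rewrite cis_0, Rminus_0_r in H2, H3. specialize (H2 ltac:(lra)). specialize (H3 ltac:(lra)).
  replace (cisC h - 1 - Ci * h)%C with
    (RtoC (exp (- y) - 1 + y) * cis x +
      ((cis x - 1 - RtoC x * (Ci * 1)) + (- RtoC y) * (cis x - 1)))%C.
  2:{ replace (cisC h) with (RtoC (exp (- y)) * cis x)%C by reflexivity.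
      replace h with (RtoC x + Ci * RtoC y)%C.
      2:{ unfold x, y. apply injective_projections; simpl; ring. }
      rewrite RtoC_plus, RtoC_minus. 
      replace (Ci * (RtoC x + Ci * RtoC y))%C with (RtoC x * Ci + (Ci * Ci) * RtoC y)%C by ring.
      replace (Ci * Ci)%C with (- RtoC 1)%C; [ring|].
      unfold RtoC, Ci, Cmult, Copp. simpl. f_equal; ring. }
  apply Rle_trans with (m * (3 * e * M)).
  - apply Rmult_le_compat_l; [lra|].
    eapply Rle_trans; [apply Cmod_triangle|].
    eapply Rle_trans; [apply Rplus_le_compat_l, Cmod_triangle|].
    rewrite 2!Cmod_mult, Cmod_cis, Cmod_opp, 2!Cmod_R.
    assert (e * Rabs y <= e * M) by (apply Rmult_le_compat_l; lra).
    assert (e * Rabs x <= e * M) by (apply Rmult_le_compat_l; lra).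
    assert (Rabs y * Cmod (cis x - 1) <= M * e).
    { apply Rmult_le_compat; [apply Rabs_pos|apply Cmod_ge_0|lra|lra]. }
    lra.
  - rewrite <- Rmult_assoc. apply Rmult_le_compat_r; [apply Cmod_ge_0|]. lra.
Qed.

(** The curve [t |-> phi (e^{it})] at complex times. *)
Definition param (phi : C -> C) (z : C) : C := phi (cisC z).

(** For [0 < r] this is the half plane of imaginary part above [- ln r]. *)
Definition half_plane (r : R) : C -> Prop := fun z => Cmod (cisC z) < r.

Lemma half_plane_open (r : R) : @open C_UniformSpace (half_plane r).
Proof.
  apply open_C_iff. intros z Hz. unfold half_plane in Hz.
  destruct (proj1 (continuous_CC_iff cisC z) (Cderiv_continuous _ _ _ (cisC_derive z)) (r - Cmod (cisC z)))
    as (d & Hd & H); [lra|].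
  exists d. split; [exact Hd|]. intros w Hw. unfold half_plane.
  generalize (H w Hw) (Cmod_triangle_rev (cisC w) (cisC z)). lra.
Qed.

Lemma half_plane_RtoC (r t : R) : 1 < r -> half_plane r (RtoC t).
Proof. intros Hr. unfold half_plane. rewrite cisC_RtoC, Cmod_cis. exact Hr. Qed.

Lemma param_holomorphic (phi : C -> C) (r : R) :
  holomorphic_on (open_disc r) phi -> holomorphic_on (half_plane r) (param phi).
Proof.
  intros Hphi. apply (holomorphic_comp phi cisC (half_plane r) (open_disc r)).
  - apply holomorphic_of_Cderiv. intros z _. exists (Ci * cisC z)%C. apply cisC_derive.
  - exact Hphi.
  - intros z Hz. exact Hz.
Qed.

Lemma param_eq (phi : C -> C) (r : R) (z w : C) :
  conformal_on (open_disc r) phi -> half_plane r z -> half_plane r w -> param phi z = param phi w ->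
  exists k : Z, z = (w + RtoC (2 * IZR k * PI))%C.
Proof. intros [_ Hinj] Hz Hw E. apply cisC_eq. now apply Hinj. Qed.

Lemma param_locally_conformal (phi : C -> C) (r : R) (U : C -> Prop) (z0 : C) :
  conformal_on (open_disc r) phi -> @open C_UniformSpace U -> U z0 -> half_plane r z0 ->
  exists d, 0 < d /\ conformal_on (cdisc z0 d) (param phi) /\
    forall z, cdisc z0 d z -> U z /\ half_plane r z.
Proof.
  intros Hphi HU HUz Hz0.
  destruct (proj1 (open_C_iff _) HU z0 HUz) as (d1 & Hd1 & H1).
  destruct (proj1 (open_C_iff _) (half_plane_open r) z0 Hz0) as (d2 & Hd2 & H2).
  set (d := Rmin 1 (Rmin d1 d2)).
  assert (Hd : 0 < d) by (repeat apply Rmin_glb_lt; lra).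
  assert (d <= 1) by apply Rmin_l.
  assert (d <= d1) by (unfold d; eapply Rle_trans; [apply Rmin_r|apply Rmin_l]).
  assert (d <= d2) by (unfold d; eapply Rle_trans; [apply Rmin_r|apply Rmin_r]).
  assert (Hs : forall z, cdisc z0 d z -> U z /\ half_plane r z).
  { intros z Hz. unfold cdisc in Hz. split; [apply H1|apply H2]; lra. }
  exists d. split; [exact Hd|]. split; [|exact Hs]. split.
  - apply holomorphic_subset with (half_plane r); [intros z Hz; now apply Hs|].
    now apply param_holomorphic, Hphi.
  - intros z w Hz Hw E.
    destruct (param_eq phi r z w Hphi) as [k Hk]; trivial; try now apply Hs.
    (* the period 2 pi exceeds the diameter of the disc *)
    assert (Hdist : Cmod (z - w) < 2).
    { generalize (Cmod_minus_triangle z z0 w). rewrite (Cmod_minus_sym z0).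
      unfold cdisc in Hz, Hw. lra. }
    rewrite Hk in Hdist.
    replace (w + RtoC (2 * IZR k * PI) - w)%C with (RtoC (2 * IZR k * PI)) in Hdist by ring.
    rewrite Cmod_R in Hdist. generalize PI2_1 PI_RGT_0. intros Hpi1 Hpi0.
    destruct (Z.eq_dec k 0) as [->|Hk0].
    + rewrite Hk. replace (2 * 0 * PI) with 0 by ring. ring.
    + exfalso. assert (Hk1 : 1 <= Rabs (IZR k)).
      { rewrite Rabs_Zabs. apply IZR_le. lia. }
      rewrite Rabs_mult, Rabs_mult, (Rabs_right 2), (Rabs_right PI) in Hdist by lra. nra.
Qed.

(** * The curve is the image of the unit circle *)

(** A connected set stays connected when one of its limit points is added, so a component
    of the complement of [gamma] absorbs each of its limit points outside [gamma]. *)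
Lemma boundary_in_curve (gamma Omega : C -> Prop) (p : C) :
  connected_component_of (fun z => ~ gamma z) Omega ->
  (forall W, @open C_UniformSpace W -> W p -> exists z, Omega z /\ W z) ->
  ~ Omega p -> gamma p.
Proof.
  intros (Hne & Hsub & Hconn & Hmax) Hlim Hp. apply NNPP. intros Hg. apply Hp.
  apply (Hmax (fun z => Omega z \/ z = p)); [| |intros z Hz; now left|now right].
  - intros U V HU HV Hcov HexU HexV.
    assert (HcovO : forall z, Omega z -> U z \/ V z) by (intros z Hz; apply Hcov; now left).
    assert (Hin : forall W, @open C_UniformSpace W -> (exists z, (Omega z \/ z = p) /\ W z) ->
      exists z, Omega z /\ W z).
    { intros W HW (z & [Hz| ->] & HWz); [now exists z|]. now apply Hlim. }
    destruct (Hconn U V HU HV HcovO (Hin U HU HexU) (Hin V HV HexV)) as (z & Hz & HUV).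
    exists z. split; [now left|exact HUV].
  - intros z [Hz| ->]; [now apply Hsub|exact Hg].
Qed.

(** [phi (e^{it})] is a limit of the values [phi ((1 - m) e^{it})] in [Omega] and, by
    injectivity on the larger disc, not itself in [Omega]. *)
Lemma circle_image_in_curve (gamma Omega : C -> Prop) (phi : C -> C) (r : R) :
  is_interior gamma Omega -> 1 < r -> conformal_on (open_disc r) phi ->
  same_set (image phi (open_disc 1)) Omega ->
  forall t, gamma (phi (cis t)).
Proof.
  intros [Hcomp _] Hr [Hhol Hinj] HO t.
  assert (Ht : open_disc r (cis t)) by (unfold open_disc; rewrite Cmod_cis; exact Hr).
  apply boundary_in_curve with Omega; [exact Hcomp| |].
  - intros W HW HWp.
    destruct (proj1 (open_C_iff _) HW _ HWp) as (e & He & HWe).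
    destruct (proj1 (continuous_CC_iff phi (cis t)) (holomorphic_continuous _ _ _ Hhol Ht) e He)
      as (d & Hd & Hc).
    set (m := Rmin d 1 / 2). assert (0 < Rmin d 1) by (apply Rmin_glb_lt; lra).
    assert (Rmin d 1 <= d) by apply Rmin_l. assert (Rmin d 1 <= 1) by apply Rmin_r.
    exists (phi (RtoC (1 - m) * cis t)%C). split.
    + apply HO. exists (RtoC (1 - m) * cis t)%C. split; [|reflexivity].
      unfold open_disc. rewrite Cmod_mult, Cmod_R, Cmod_cis, Rabs_right; unfold m; lra.
    + apply HWe, Hc. rewrite RtoC_minus.
      replace ((1 - RtoC m) * cis t - cis t)%C with (- (RtoC m * cis t))%C by ring.
      rewrite Cmod_opp, Cmod_mult, Cmod_R, Cmod_cis, Rabs_right; unfold m; lra.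
  - intros HOp. apply HO in HOp. destruct HOp as (z & Hz & E). unfold open_disc in Hz.
    apply Hinj in E; [|unfold open_disc; lra|exact Ht].
    subst z. rewrite Cmod_cis in Hz. lra.
Qed.

(** The Cayley transform, which maps the unit circle without 1 to the real line. *)
Definition cayley (v : C) : C := (Ci * (1 + v) / (1 - v))%C.

Lemma cayley_real (v : C) : Cmod v = 1 -> v <> 1 -> snd (cayley v) = 0.
Proof.
  intros Hv Hn. assert (N : (1 - v)%C <> 0) by (apply Cminus_eq_contra; congruence).
  assert (E : (cayley v * (1 - v) = Ci * (1 + v))%C) by (unfold cayley; now field).
  destruct v as [x y]. set (c := cayley (x, y)) in *. destruct c as [p q] eqn:Ec.
  assert (Hxy : x * x + y * y = 1).
  { assert (H2 : Cmod (x, y) * Cmod (x, y) = 1) by (rewrite Hv; ring).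
    unfold Cmod in H2. simpl in H2. rewrite sqrt_sqrt in H2 by nra. lra. }
  unfold Cmult, Cplus, Cminus, Copp, Ci, RtoC in E. simpl in E. injection E as E1 E2. simpl.
  assert (K : q * ((1 - x) * (1 - x) + y * y) = 0).
  { replace (q * ((1 - x) * (1 - x) + y * y))
      with ((1 - x) * (q * (1 - x) - p * y) + y * (p * (1 - x) + q * y)) by ring.
    replace (q * (1 - x) - p * y) with (1 + x) by lra.
    replace (p * (1 - x) + q * y) with (- y) by lra. lra. }
  apply Rmult_integral in K. destruct K as [K|K]; [exact K|exfalso].
  assert (y = 0) by nra. assert (x = 1) by nra. subst. now apply Hn.
Qed.

Lemma cayley_injective (v w : C) : v <> 1 -> w <> 1 -> cayley v = cayley w -> v = w.
Proof.
  intros Hv Hw E. assert (Nv : (1 - v)%C <> 0) by (apply Cminus_eq_contra; congruence).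
  assert (Nw : (1 - w)%C <> 0) by (apply Cminus_eq_contra; congruence).
  assert (E2 : (Ci * (1 + v) * (1 - w) = Ci * (1 + w) * (1 - v))%C).
  { replace (Ci * (1 + v))%C with (cayley v * (1 - v))%C by (unfold cayley; now field).
    rewrite E. unfold cayley. now field. }
  apply Cminus_eq_0.
  replace (v - w)%C with ((Ci * (1 + v) * (1 - w) - Ci * (1 + w) * (1 - v)) / (2 * Ci))%C.
  - rewrite E2. unfold Cdiv. ring.
  - field. apply Ci_nz.
Qed.

(** Both half circles joining [1] and [-1] are mapped onto sets that contain the
    interval between the two values there. *)
Lemma circle_not_embedded_in_R (b : R -> R) :
  (forall t, @continuous R_UniformSpace R_UniformSpace b t) ->
  (forall t, b (t + 2 * PI) = b t) ->
  exists t u, cis t <> cis u /\ b t = b u.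
Proof.
  intros Hb Hper.
  assert (Hcont : Ranalysis1.continuity b).
  { intros t. apply continuity_pt_filterlim. apply Hb. }
  assert (Hpi := PI_RGT_0).
  assert (Hdist : forall t u, 0 < u - t < 2 * PI -> cis t <> cis u).
  { intros t u Htu E. destruct (cis_eq u t (eq_sym E)) as [k Hk].
    destruct (Z.lt_ge_cases k 1) as [h|h].
    - assert (IZR k <= 0) by (apply IZR_le; lia). nra.
    - assert (1 <= IZR k) by (apply IZR_le; lia). nra. }
  assert (H2pi : b (2 * PI) = b 0) by (rewrite <- (Hper 0); f_equal; ring).
  destruct (Req_dec (b 0) (b PI)) as [E|E].
  { exists 0, PI. split; [apply Hdist; lra|exact E]. }
  set (m := (b 0 + b PI) / 2).
  assert (Hm1 : Rmin (b 0) (b PI) <= m <= Rmax (b 0) (b PI)).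
  { unfold m, Rmin, Rmax. destruct (Rle_dec (b 0) (b PI)); lra. }
  assert (Hm2 : Rmin (b PI) (b (2 * PI)) <= m <= Rmax (b PI) (b (2 * PI))).
  { rewrite H2pi, Rmin_comm, Rmax_comm. exact Hm1. }
  destruct (IVT_gen b 0 PI m Hcont Hm1) as (t & Ht & Hbt).
  destruct (IVT_gen b PI (2 * PI) m Hcont Hm2) as (u & Hu & Hbu).
  rewrite Rmin_left, Rmax_right in Ht, Hu by lra.
  exists t, u. split; [|congruence]. apply Hdist.
  assert (t <> 0) by (intros ->; unfold m in Hbt; lra).
  assert (t <> PI) by (intros ->; unfold m in Hbt; lra).
  assert (u <> 2 * PI) by (intros ->; rewrite H2pi in Hbu; unfold m in Hbu; lra).
  lra.
Qed.

Lemma Re_continuous (c : R -> C) (t : R) :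
  @continuous R_UniformSpace C_UniformSpace c t ->
  @continuous R_UniformSpace R_UniformSpace (fun t => fst (c t)) t.
Proof.
  intros Hc. rewrite continuous_RC_iff in Hc. intros P HP. apply locally_R_iff in HP.
  destruct HP as (d & Hd & HP). destruct (Hc d Hd) as (e & He & H).
  apply locally_R_iff. exists e. split; [exact He|]. intros u Hu. apply HP.
  eapply Rle_lt_trans; [|apply (H u Hu)]. exact (fst_le_Cmod (c u - c t)%C).
Qed.

Lemma annulus_open (r1 r2 : R) (z : C) :
  annulus r1 r2 z -> exists d, 0 < d /\ forall w, cdisc z d w -> annulus r1 r2 w.
Proof.
  unfold annulus, cdisc. intros Hz. exists (Rmin (Cmod z - r1) (r2 - Cmod z)).
  split; [apply Rmin_glb_lt; lra|]. intros w Hw.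
  generalize (Rmin_l (Cmod z - r1) (r2 - Cmod z)) (Rmin_r (Cmod z - r1) (r2 - Cmod z))
    (Cmod_triangle_rev w z) (Cmod_triangle_rev z w).
  rewrite (Cmod_minus_sym z w). lra.
Qed.

(** [F^{-1} o phi] embeds the unit circle in the unit circle; were its image to miss a
    point [z0], the Cayley transform of its quotient by [z0] would embed the circle in
    the line. *)
Lemma curve_in_circle_image (gamma : C -> Prop) (phi : C -> C) (r : R) :
  analytic_Jordan_curve gamma -> 1 < r -> conformal_on (open_disc r) phi ->
  (forall t, gamma (phi (cis t))) ->
  forall w, gamma w -> exists t, phi (cis t) = w.
Proof.
  intros (r1 & r2 & F & Hr1 & Hr2 & [HF HFinj] & HgF) Hr [Hphi Hinj] Hin w Hw.
  set (A := annulus r1 r2). set (G := inverse_on A F).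
  assert (HT : forall z, Cmod z = 1 -> A z) by (intros z Hz; unfold A, annulus; lra).
  assert (HGF : forall z, Cmod z = 1 -> G (F z) = z).
  { intros z Hz. apply inverse_on_eq; [exact HFinj|now apply HT]. }
  assert (HGcont : forall z, Cmod z = 1 -> @continuous C_UniformSpace C_UniformSpace G (F z)).
  { intros z Hz. apply continuous_CC_iff. intros eps He.
    destruct (annulus_open r1 r2 z (HT z Hz)) as (d & Hd & Hs).
    set (d' := Rmin d eps). assert (Hd' : 0 < d') by now apply Rmin_glb_lt.
    assert (Hs' : forall x, cdisc z d' x -> A x).
    { intros x Hx. apply Hs. eapply Rlt_le_trans; [exact Hx|apply Rmin_l]. }
    destruct (injective_open F z d' Hd') as (e & He' & H).
    { split; [intros x Hx; now apply HF, Hs'|]. intros x y Hx Hy. apply HFinj; now apply Hs'. }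
    exists e. split; [exact He'|]. intros y Hy. destruct (H y Hy) as (x & Hx & <-).
    rewrite (HGF z Hz). unfold G. rewrite inverse_on_eq; [|exact HFinj|now apply Hs'].
    eapply Rlt_le_trans; [exact Hx|apply Rmin_r]. }
  apply HgF in Hw. destruct Hw as (z0 & Hz0 & Hw). unfold unit_circle in Hz0.
  assert (Hnz : z0 <> 0) by (apply Cmod_neq_0; lra).
  apply NNPP. intros Hno.
  set (zeta := fun t => G (phi (cis t))).
  assert (Hzeta : forall t, Cmod (zeta t) = 1 /\ F (zeta t) = phi (cis t)).
  { intros t. destruct (proj1 (HgF _) (Hin t)) as (z & Hz & E). unfold unit_circle in Hz.
    unfold zeta. rewrite <- E, HGF by exact Hz. now split. }
  set (v := fun t => (zeta t * / z0)%C).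
  assert (Hv : forall t, Cmod (v t) = 1 /\ v t <> 1).
  { intros t. destruct (Hzeta t) as [H1 H2]. split.
    - unfold v. rewrite Cmod_mult, Cmod_inv, H1, Hz0 by exact Hnz. field.
    - intros E. apply Hno. exists t. rewrite <- H2, <- Hw. f_equal.
      replace (zeta t) with (v t * z0)%C by (unfold v; now field). rewrite E. ring. }
  assert (Hvc : forall t, @continuous R_UniformSpace C_UniformSpace v t).
  { intros t. apply continuous_Cmult; [|apply continuous_Cconst].
    apply (continuous_Ccomp (fun t => phi (cis t)) G).
    - apply (continuous_Ccomp cis phi); [apply cis_continuous|].
      apply (holomorphic_continuous (open_disc r)); [exact Hphi|].
      unfold open_disc. rewrite Cmod_cis. exact Hr.
    - destruct (Hzeta t) as [H1 <-]. now apply HGcont. }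
  destruct (circle_not_embedded_in_R (fun t => fst (cayley (v t)))) as (t & u & Htu & E).
  - intros t. apply Re_continuous. apply continuous_Cmult.
    + apply continuous_Cmult; [apply continuous_Cconst|].
      apply continuous_Cplus; [apply continuous_Cconst|apply Hvc].
    + apply continuous_Cinv.
      * apply Cminus_eq_contra. intros E. destruct (Hv t) as [_ H]. now apply H.
      * apply continuous_Cminus; [apply continuous_Cconst|apply Hvc].
  - intros t. unfold v, zeta. rewrite cis_plus, cis_2PI, Cmult_1_r. reflexivity.
  - apply Htu. destruct (Hv t) as [Ht1 Ht2]. destruct (Hv u) as [Hu1 Hu2].
    assert (Ec : cayley (v t) = cayley (v u)).
    { apply injective_projections; [exact E|]. now rewrite 2!cayley_real. }
    apply cayley_injective in Ec; trivial.
    assert (Ez : zeta t = zeta u).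
    { replace (zeta t) with (v t * z0)%C by (unfold v; now field). rewrite Ec. unfold v. now field. }
    destruct (Hzeta t) as [_ HFt]. destruct (Hzeta u) as [_ HFu].
    apply Hinj; [unfold open_disc; rewrite Cmod_cis; exact Hr..|]. now rewrite <- HFt, <- HFu, Ez.
Qed.

(** * Extension to a neighbourhood of the curve *)

Section Gluing.
Context (phi : C -> C) (r : R) (h : R -> C).
Hypothesis Hr : 1 < r.
Hypothesis Hphi : conformal_on (open_disc r) phi.
Hypothesis Hper : forall (t : R) (k : Z), h (t + 2 * IZR k * PI) = h t.
Hypothesis Hh : real_analytic h.

(** [v] is the value at [w] that some local continuation [H] of [h] gives through [param].
    Only the disc of half the radius is used: the disc around the real part of a
    point in it that just reaches the point still lies in the domain of [H]. *)
Definition continued_value (w v : C) : Prop :=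
  exists t d H z, 0 < d /\ extends_near h t d H /\ cdisc (RtoC t) (d / 2) z /\ half_plane r z /\
    param phi z = w /\ H z = v.

(** Compare the two on a disc around the real part of [z], on whose diameter both are
    [h], up to a period. *)
Lemma local_continuations_agree (t d : R) (H : C -> C) (t' d' : R) (H' : C -> C) (z : C) (k : Z) :
  extends_near h t d H -> extends_near h t' d' H' ->
  cdisc (RtoC t) (d / 2) z -> cdisc (RtoC t') (d' / 2) (z + RtoC (2 * IZR k * PI))%C ->
  H z = H' (z + RtoC (2 * IZR k * PI))%C.
Proof.
  intros [HH HHh] [HH' HHh'] Hz Hz'. set (p := 2 * IZR k * PI) in *. set (x := fst z).
  assert (Hclose : forall (a b : R) (w : C), cdisc (RtoC a) b w ->
    Rabs (fst w - a) < b /\ Rabs (snd w) < b).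
  { intros a b w Hw. unfold cdisc in Hw.
    generalize (fst_le_Cmod (w - RtoC a)%C) (snd_le_Cmod (w - RtoC a)%C). simpl.
    replace (snd w + - 0) with (snd w) by ring. unfold Rminus. lra. }
  destruct (Hclose _ _ _ Hz) as [Hx Hy]. destruct (Hclose _ _ _ Hz') as [Hx' Hy'].
  simpl in Hx', Hy'. fold x in Hx, Hx'. replace (snd z + 0) with (snd z) in Hy' by ring.
  set (R1 := Rmin (d / 2) (d' / 2)).
  assert (HR1 : Rabs (snd z) < R1) by now apply Rmin_glb_lt.
  assert (HR : R1 <= d / 2) by apply Rmin_l. assert (HR' : R1 <= d' / 2) by apply Rmin_r.
  assert (Hy0 := Rabs_pos (snd z)).
  assert (Hsub : forall w, cdisc (RtoC x) R1 w -> cdisc (RtoC t) d w).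
  { intros w Hw. unfold cdisc in *. generalize (Cmod_minus_triangle w (RtoC x) (RtoC t)).
    rewrite <- (RtoC_minus x t), Cmod_R. lra. }
  assert (Hsub' : forall w, cdisc (RtoC x) R1 w -> cdisc (RtoC t') d' (w + RtoC p)%C).
  { intros w Hw. unfold cdisc in *. generalize (Cmod_triangle (w - RtoC x) (RtoC (x + p - t'))).
    rewrite Cmod_R, RtoC_minus, RtoC_plus.
    replace (w - RtoC x + (RtoC x + RtoC p - RtoC t'))%C with (w + RtoC p - RtoC t')%C by ring. lra. }
  apply (identity_on_reals H (fun w => H' (w + RtoC p)%C) x R1 R1).
  - now apply holomorphic_subset with (2 := HH).
  - apply (holomorphic_comp H' (fun w => w + RtoC p)%C _ (cdisc (RtoC t') d')); trivial.
    apply holomorphic_of_Cderiv. intros w _. exists (1 + 0)%C.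
    apply (Cderiv_plus (fun w => w) (fun _ => RtoC p)); [apply Cderiv_id|apply Cderiv_const].
  - lra.
  - intros s Hs. apply cdisc_RtoC in Hs.
    rewrite HHh by (apply cdisc_RtoC; now apply Hsub).
    apply Hsub' in Hs. rewrite <- RtoC_plus in *. rewrite HHh' by (now apply cdisc_RtoC).
    symmetry. apply Hper.
  - unfold cdisc. replace (z - RtoC x)%C with (Ci * RtoC (snd z))%C.
    + rewrite Cmod_mult, Cmod_Ci, Cmod_R. lra.
    + unfold x. apply injective_projections; simpl; ring.
Qed.

Lemma continued_value_unique (w v v' : C) :
  continued_value w v -> continued_value w v' -> v = v'.
Proof.
  intros (t & d & H & z & Hd & HH & Hz & Hsz & Hw & <-)
    (t' & d' & H' & z' & Hd' & HH' & Hz' & Hsz' & Hw' & <-).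
  destruct (param_eq phi r z' z Hphi Hsz' Hsz) as [k ->]; [congruence|].
  now apply (local_continuations_agree t d H t' d' H').
Qed.

Definition continuation (w : C) : C := epsilon (inhabits (RtoC 0)) (continued_value w).

Lemma continuation_eq (w v : C) : continued_value w v -> continuation w = v.
Proof.
  intros Hv. apply continued_value_unique with w; [|exact Hv].
  unfold continuation. apply epsilon_spec. now exists v.
Qed.

(** Near [w] the continuation is [H] composed with a local inverse of [param]. *)
Lemma continuation_locally (w : C) : (exists v, continued_value w v) ->
  exists e l, 0 < e /\ Cderiv continuation w l /\
    forall w', cdisc w e w' -> exists v, continued_value w' v.
Proof.
  intros (v & t & d & H & z & Hd & HH & Hz & Hsz & Hw & Hv).
  destruct (param_locally_conformal phi r _ z Hphi (cdisc_is_open (RtoC t) (d / 2)) Hz Hsz)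
    as (e1 & He1 & Hconf & Hs).
  destruct (conformal_local_inverse _ z e1 He1 Hconf) as (e & Q & He & HQ & HQe).
  rewrite Hw in HQ, HQe.
  assert (Hval : forall w', cdisc w e w' -> continued_value w' (H (Q w'))).
  { intros w' Hw'. destruct (HQe w' Hw') as [H1 H2]. destruct (Hs _ H1) as [H3 H4].
    exists t, d, H, (Q w'). exact (conj Hd (conj HH (conj H3 (conj H4 (conj H2 eq_refl))))). }
  assert (HHQ : holomorphic_on (cdisc w e) (fun w' => H (Q w'))).
  { apply (holomorphic_comp H Q _ (cdisc (RtoC t) d)); [exact HQ|apply HH|].
    intros w' Hw'. destruct (HQe w' Hw') as [H1 _]. destruct (Hs _ H1) as [H3 _].
    apply cdisc_subset with (2 := H3). lra. }
  destruct (holomorphic_Cderiv _ _ w HHQ (cdisc_center w e He)) as [l Hl].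
  exists e, l. split; [exact He|]. split.
  - apply Cderiv_congr_disc with (fun w' => H (Q w')) w e; trivial; [|now apply cdisc_center].
    intros w' Hw'. symmetry. now apply continuation_eq, Hval.
  - intros w' Hw'. exists (H (Q w')). now apply Hval.
Qed.

Lemma continued_value_on_curve (t : R) : continued_value (phi (cis t)) (h t).
Proof.
  destruct (proj1 (real_analytic_iff h) Hh t) as (d & H & Hd & HH).
  exists t, d, H, (RtoC t). split; [exact Hd|]. split; [exact HH|].
  split; [apply cdisc_center; lra|]. split; [now apply half_plane_RtoC|].
  split; [unfold param; now rewrite cisC_RtoC|]. apply HH.
  replace (t - t) with 0 by ring. now rewrite Rabs_R0.
Qed.
End Gluing.

Lemma analytic_parameter_extends (gamma : C -> Prop) (phi f : C -> C) (r : R) :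
  1 < r -> conformal_on (open_disc r) phi ->
  (forall w, gamma w -> exists t, phi (cis t) = w) ->
  real_analytic (fun t => f (phi (cis t))) -> extends_holomorphically gamma f.
Proof.
  intros Hr Hphi Hgamma Hh. set (h := fun t => f (phi (cis t))) in *.
  assert (Hper : forall (t : R) (k : Z), h (t + 2 * IZR k * PI) = h t).
  { intros t k. unfold h. now rewrite cis_period. }
  assert (Hloc := continuation_locally phi r h Hphi Hper).
  exists (fun w => exists v, continued_value phi r h w v), (continuation phi r h).
  split; [|split; [|split]].
  - apply open_C_iff. intros w Hw. destruct (Hloc w Hw) as (e & l & He & _ & H). now exists e.
  - intros w Hw. destruct (Hgamma w Hw) as [t <-]. exists (h t).
    now apply continued_value_on_curve.
  - apply holomorphic_of_Cderiv. intros w Hw. destruct (Hloc w Hw) as (e & l & _ & Hl & _). now exists l.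
  - intros w Hw. destruct (Hgamma w Hw) as [t <-].
    apply (continuation_eq phi r h Hphi Hper (phi (cis t)) (h t)).
    now apply continued_value_on_curve.
Qed.

Lemma extension_analytic_parameter (gamma : C -> Prop) (phi f : C -> C) (r : R) :
  1 < r -> conformal_on (open_disc r) phi -> (forall t, gamma (phi (cis t))) ->
  extends_holomorphically gamma f -> real_analytic (fun t => f (phi (cis t))).
Proof.
  intros Hr Hphi Hgamma (V & g & HV & HgV & Hg & Hgf). apply real_analytic_iff. intros t0.
  destruct (param_locally_conformal phi r _ (RtoC t0) Hphi (half_plane_open r)) as (d1 & Hd1 & [Hp _] & _);
    [now apply half_plane_RtoC..|].
  destruct (holomorphic_maps_into (param phi) (RtoC t0) d1 V Hd1 Hp HV) as (d & Hd & HdV).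
  { unfold param. rewrite cisC_RtoC. apply HgV, Hgamma. }
  exists d, (fun z => g (param phi z)). split; [lra|]. split.
  - apply (holomorphic_comp g (param phi) _ V); trivial.
    apply holomorphic_subset with (2 := Hp). apply cdisc_subset. lra.
  - intros t _. unfold param. rewrite cisC_RtoC. apply Hgf, Hgamma.
Qed.

(** * Arc length *)

Lemma increment_formula (f df : R -> R) (a b : R) :
  a < b -> (forall x, is_derive f x (df x)) -> exists c, f b - f a = df c * (b - a).
Proof.
  intros Hab Hf. destruct (MVT_gen f a b df) as (c & _ & Hc).
  - intros x _. apply Hf.
  - intros x _. apply continuity_pt_filterlim.
    apply (ex_derive_continuous (V := R_NormedModule)). now exists (df x).
  - now exists c.
Qed.

Lemma Rderiv_zero_constant (c : R -> C) (t0 d : R) :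
  (forall t, Rabs (t - t0) < d -> Rderiv c t 0) ->
  forall t, Rabs (t - t0) < d -> c t = c t0.
Proof.
  intros Hc.
  assert (Hle : forall a b, a <= b -> Rabs (a - t0) < d -> Rabs (b - t0) < d -> c b = c a).
  { intros a b Hab Ha Hb. apply Cminus_eq_0.
    assert (HI := is_CInt_derive c (fun _ => RtoC 0) a b Hab).
    apply CInt_unique in HI.
    - rewrite <- HI. apply CInt_unique.
      assert (H0 := is_RInt_const (V := C_R_NormedModule) a b (RtoC 0)).
      now rewrite scal_R_Cmult, Cmult_0_r in H0.
    - intros t Ht. apply Hc. apply Rabs_def2 in Ha, Hb. apply Rabs_def1; lra.
    - intros t _. apply continuous_Cconst. }
  intros t Ht. assert (H0 : Rabs (t0 - t0) < d).
  { replace (t0 - t0) with 0 by ring. rewrite Rabs_R0. generalize (Rabs_pos (t - t0)). lra. }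
  destruct (Rle_dec t0 t) as [h|h]; [now apply Hle|]. symmetry. apply Hle; trivial. lra.
Qed.

(** Over every interval of length [T] the function gains the same positive amount, so it
    is unbounded in both directions. *)
Lemma increasing_surjective (s ds : R -> R) (T : R) :
  0 < T -> (forall t, is_derive s t (ds t)) -> (forall t, 0 < ds t) ->
  (forall t, ds (t + T) = ds t) ->
  (forall t u, t < u -> s t < s u) /\ (forall y, exists t, s t = y).
Proof.
  intros HT Hs Hpos Hper.
  assert (Hinc : forall t u, t < u -> s t < s u).
  { intros t u Htu. destruct (increment_formula s ds t u Htu Hs) as [c Hc].
    assert (0 < ds c * (u - t)) by (apply Rmult_lt_0_compat; [apply Hpos|lra]). lra. }
  split; [exact Hinc|].
  set (g := fun t => s (t + T) - s t).
  assert (Hg : forall t, is_derive g t ((fun _ => 0) t)).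
  { intros t. replace 0 with (1 * ds (t + T) - ds t) by (rewrite Hper; ring).
    apply (is_derive_minus (V := R_NormedModule)); [|apply Hs].
    apply (is_derive_comp (V := R_NormedModule) s (fun t => t + T)); [apply Hs|].
    replace 1 with (1 + 0) by ring. apply (is_derive_plus (V := R_NormedModule)).
    - apply is_derive_Reals, derivable_pt_lim_id.
    - apply is_derive_Reals, derivable_pt_lim_const. }
  assert (Hconst : forall t, g t = g 0).
  { intros t. destruct (Rtotal_order 0 t) as [h|[<-|h]]; trivial.
    - destruct (increment_formula g _ 0 t h Hg) as [c Hc]. lra.
    - destruct (increment_formula g _ t 0 h Hg) as [c Hc]. lra. }
  set (L := g 0). assert (HL : 0 < L) by (unfold L, g; generalize (Hinc 0 (0 + T)); lra).
  assert (Hup : forall n, s (INR n * T) = s 0 + INR n * L).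
  { induction n as [|n IH]; [simpl; now rewrite 2!Rmult_0_l, Rplus_0_r|].
    rewrite S_INR. generalize (Hconst (INR n * T)). unfold g at 1. fold L.
    replace (INR n * T + T) with ((INR n + 1) * T) by ring. lra. }
  assert (Hdown : forall n, s (- (INR n * T)) = s 0 - INR n * L).
  { induction n as [|n IH]; [simpl; rewrite 2!Rmult_0_l, Ropp_0; ring|].
    rewrite S_INR. generalize (Hconst (- ((INR n + 1) * T))). unfold g at 1. fold L.
    replace (- ((INR n + 1) * T) + T) with (- (INR n * T)) by ring. lra. }
  intros y. destruct (INR_unbounded (Rabs (y - s 0) / L)) as [n Hn].
  assert (HnL : Rabs (y - s 0) < INR n * L).
  { replace (Rabs (y - s 0)) with (Rabs (y - s 0) / L * L) by (field; lra).
    apply Rmult_lt_compat_r; lra. }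
  apply Rabs_def2 in HnL.
  destruct (IVT_gen s (- (INR n * T)) (INR n * T) y) as (t & _ & Ht); [| |now exists t].
  - intros t. apply continuity_pt_filterlim.
    apply (ex_derive_continuous (V := R_NormedModule)). now exists (ds t).
  - rewrite Hup, Hdown, Rmin_left, Rmax_right; lra.
Qed.

(** Reflection of both the variable and the value (Schwarz): conjugation is additive,
    multiplicative and preserves the modulus. *)
Lemma conj_derive (f : C -> C) (z l : C) :
  Cderiv f (Cconj z) l -> Cderiv (fun w => Cconj (f (Cconj w))) z (Cconj l).
Proof.
  intros H eps He. destruct (H eps He) as (d & Hd & Hw). exists d. split; [exact Hd|].
  intros w Hwd. specialize (Hw (Cconj w)).
  rewrite <- Cminus_conj, Cmod_conj in Hw. specialize (Hw Hwd).
  rewrite <- Cminus_conj. rewrite <- (Cconj_conj (w - z)%C) at 1.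
  rewrite <- Cmult_conj, <- Cminus_conj, Cmod_conj.
  now rewrite Cminus_conj in *.
Qed.

Lemma Cconj_RtoC (x : R) : Cconj (RtoC x) = RtoC x.
Proof. unfold Cconj, RtoC. simpl. f_equal. ring. Qed.

Lemma Cmult_conj_self (z : C) : (z * Cconj z)%C = RtoC (Cmod z * Cmod z).
Proof.
  destruct z as [x y]. unfold Cmod. simpl fst; simpl snd. rewrite sqrt_sqrt by nra.
  unfold Cconj, Cmult, RtoC. simpl. f_equal; ring.
Qed.

(** Squaring is injective on the half plane of positive real part, so a local inverse of
    it at [a^2] selects there the root of positive real part; where [A] is positive
    this is the positive root. *)
Lemma holomorphic_sqrt (A : C -> C) (t0 d a : R) :
  0 < a -> 0 < d -> holomorphic_on (cdisc (RtoC t0) d) A -> A (RtoC t0) = RtoC (a * a) ->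
  exists d' q, 0 < d' <= d /\ holomorphic_on (cdisc (RtoC t0) d') q /\
    forall t m, Rabs (t - t0) < d' -> 0 < m -> A (RtoC t) = RtoC (m * m) -> q (RtoC t) = RtoC m.
Proof.
  intros Ha Hd HA HA0.
  assert (Hpos : forall z, cdisc (RtoC a) a z -> 0 < fst z).
  { intros z Hz. unfold cdisc in Hz. generalize (fst_le_Cmod (z - RtoC a)%C). simpl. intros H.
    assert (H2 : Rabs (fst z + - a) < a) by lra. apply Rabs_def2 in H2. lra. }
  assert (Hroot : forall z w, 0 < fst z -> 0 < fst w -> (z * z = w * w)%C -> z = w).
  { intros z w Hz Hw E. apply Cminus_eq_0.
    assert (N : (z + w)%C <> 0).
    { intros N. apply (f_equal fst) in N. simpl in N. lra. }
    replace (z - w)%C with ((z * z - w * w) / (z + w))%C by (now field).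
    rewrite E. unfold Cdiv. ring. }
  assert (Hsq : conformal_on (cdisc (RtoC a) a) (fun z => z * z)%C).
  { split.
    - apply holomorphic_of_Cderiv. intros z _. exists (1 * z + z * 1)%C.
      apply (Cderiv_mult (fun w => w) (fun w => w)); apply Cderiv_id.
    - intros z w Hz Hw. apply Hroot; now apply Hpos. }
  destruct (conformal_local_inverse _ (RtoC a) a Ha Hsq) as (e & Q & He & HQ & HQe).
  rewrite <- RtoC_mult in HQ, HQe.
  destruct (holomorphic_maps_into A (RtoC t0) d _ Hd HA (cdisc_is_open (RtoC (a * a)) e)) as (d' & Hd' & Hmap).
  { rewrite HA0. now apply cdisc_center. }
  exists d', (fun z => Q (A z)). split; [exact Hd'|]. split.
  - apply (holomorphic_comp Q A _ (cdisc (RtoC (a * a)) e)); trivial.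
    apply holomorphic_subset with (2 := HA). apply cdisc_subset. lra.
  - intros t m Ht Hm Hmt. apply cdisc_RtoC in Ht. destruct (HQe _ (Hmap _ Ht)) as [H1 H2].
    apply Hroot; [now apply Hpos|exact Hm|]. now rewrite H2, Hmt, RtoC_mult.
Qed.

Section ArcLength.
Context (phi : C -> C) (r : R) (s : R -> R).
Hypothesis Hr : 1 < r.
Hypothesis Hphi : conformal_on (open_disc r) phi.
Hypothesis Hs : is_arc_length (fun t => phi (cis t)) s.

(** The speed of the curve is the modulus of the complex derivative of [param]. *)
Lemma arc_length_derive (t : R) (l : C) :
  Cderiv (param phi) (RtoC t) l -> is_derive s t (Cmod l).
Proof.
  intros Hl. destruct (Hs t) as (v & Hv & Hsv).
  assert (H := Rderiv_comp (param phi) RtoC t l 1 Hl (RtoC_derive t)). rewrite Cmult_1_r in H.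
  assert (E : v = l).
  { apply (Rderiv_unique (fun t => phi (cis t)) t); [exact Hv|].
    apply (is_derive_ext (V := C_R_NormedModule)) with (2 := H).
    intros u. unfold param. now rewrite cisC_RtoC. }
  now rewrite <- E.
Qed.

Lemma param_derivative (t : R) : exists l, Cderiv (param phi) (RtoC t) l /\ l <> 0.
Proof.
  destruct (param_locally_conformal phi r _ (RtoC t) Hphi (half_plane_open r)) as (d & Hd & Hc & _);
    [now apply half_plane_RtoC..|].
  destruct (holomorphic_Cderiv _ _ _ (proj1 Hc) (cdisc_center _ d Hd)) as [l Hl].
  exists l. split; [exact Hl|]. exact (conformal_derivative_neq_0 _ _ _ _ Hd Hc Hl).
Qed.

Lemma arc_length_bijective :
  (forall t u, t < u -> s t < s u) /\ (forall y, exists t, s t = y).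
Proof.
  assert (HD : forall t, exists l, Cderiv (param phi) (RtoC t) l /\ l <> 0 /\ Derive s t = Cmod l).
  { intros t. destruct (param_derivative t) as (l & Hl & H0). exists l.
    split; [exact Hl|]. split; [exact H0|]. now apply is_derive_unique, arc_length_derive. }
  apply (increasing_surjective s (Derive s) (2 * PI)).
  - generalize PI_RGT_0. lra.
  - intros t. apply Derive_correct. destruct (HD t) as (l & Hl & _).
    exists (Cmod l). now apply arc_length_derive.
  - intros t. destruct (HD t) as (l & _ & H0 & ->). now apply Cmod_pos.
  - intros t. destruct (HD t) as (l & Hl & _ & ->). destruct (HD (t + 2 * PI)) as (m & Hm & _ & ->).
    f_equal. apply (Cderiv_unique (param phi) (RtoC t)); [|exact Hl].
    assert (Hadd : Cderiv (fun z => z + RtoC (2 * PI))%C (RtoC t) (1 + 0)%C).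
    { apply (Cderiv_plus (fun w => w) (fun _ => RtoC (2 * PI))); [apply Cderiv_id|apply Cderiv_const]. }
    rewrite RtoC_plus in Hm.
    assert (H := Cderiv_comp (param phi) (fun z => z + RtoC (2 * PI))%C (RtoC t) m _ Hm Hadd).
    replace (m * (1 + 0))%C with m in H by ring.
    apply Cderiv_ext_loc with (3 := H) (d := 1); [lra|].
    intros w _. unfold param. now rewrite cisC_plus, (cisC_RtoC (2 * PI)), cis_2PI, Cmult_1_r.
Qed.

Lemma arc_length_inverse_l (t : R) : inverse_fun s (s t) = t.
Proof.
  destruct arc_length_bijective as [Hinc _]. unfold inverse_fun.
  assert (E := epsilon_spec (inhabits 0) (fun u => s u = s t) (ex_intro _ t eq_refl)).
  cbv beta in E. set (u := epsilon _ _) in *.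
  destruct (Rtotal_order u t) as [h|[h|h]]; [|exact h|]; apply Hinc in h; lra.
Qed.

Lemma arc_length_inverse_r (y : R) : s (inverse_fun s y) = y.
Proof. unfold inverse_fun. apply epsilon_spec. apply arc_length_bijective. Qed.

(** On the real axis [|P'|^2 = P' * conj P'], and [conj P'] is there the restriction of
    the reflected derivative, which is holomorphic.  So [s' = |P'|] continues
    holomorphically, and a primitive of the continuation that takes the value [s t0] at
    [t0] continues [s]. *)
Lemma arc_length_extension (t0 : R) :
  exists d S l, 0 < d /\ extends_near (fun t => RtoC (s t)) t0 d S /\
    Cderiv S (RtoC t0) l /\ l <> 0.
Proof.
  destruct (param_locally_conformal phi r _ (RtoC t0) Hphi (half_plane_open r)) as (d0 & Hd0 & Hc & _);
    [now apply half_plane_RtoC..|].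
  destruct (derivative_holomorphic (param phi) (RtoC t0) d0 (d0 / 2) (proj1 Hc)) as (P1 & HP1 & HdP); [lra|].
  set (A := fun z => (P1 z * Cconj (P1 (Cconj z)))%C).
  assert (HA : holomorphic_on (cdisc (RtoC t0) (d0 / 2)) A).
  { apply holomorphic_of_Cderiv. intros z Hz.
    assert (Hz' : cdisc (RtoC t0) (d0 / 2) (Cconj z)).
    { unfold cdisc in *. rewrite <- (Cconj_RtoC t0), <- Cminus_conj, Cmod_conj. exact Hz. }
    destruct (holomorphic_Cderiv _ _ _ HP1 Hz) as [l Hl].
    destruct (holomorphic_Cderiv _ _ _ HP1 Hz') as [m Hm].
    exists (l * Cconj (P1 (Cconj z)) + P1 z * Cconj m)%C.
    apply (Cderiv_mult P1 (fun w => Cconj (P1 (Cconj w)))); [exact Hl|now apply conj_derive]. }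
  assert (HAreal : forall t, A (RtoC t) = RtoC (Cmod (P1 (RtoC t)) * Cmod (P1 (RtoC t)))).
  { intros t. unfold A. rewrite Cconj_RtoC. apply Cmult_conj_self. }
  assert (Hnz : forall t, Rabs (t - t0) < d0 / 2 -> 0 < Cmod (P1 (RtoC t))).
  { intros t Ht. apply Cmod_pos. destruct (param_derivative t) as (l & Hl & H0).
    apply cdisc_RtoC in Ht. now rewrite (Cderiv_unique _ _ _ _ (HdP _ Ht) Hl). }
  assert (Hc0 : Rabs (t0 - t0) < d0 / 2) by (replace (t0 - t0) with 0 by ring; rewrite Rabs_R0; lra).
  destruct (holomorphic_sqrt A t0 (d0 / 2) (Cmod (P1 (RtoC t0))) (Hnz t0 Hc0)) as (d1 & q & Hd1 & Hq & Hqreal);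
    [lra|exact HA|apply HAreal|].
  destruct (holomorphic_primitive q (RtoC t0) (RtoC (s t0)) d1 (d1 / 2) Hq) as (S & HS0 & HS); [lra|].
  assert (Hqt : forall t, Rabs (t - t0) < d1 / 2 -> q (RtoC t) = RtoC (Cmod (P1 (RtoC t)))).
  { intros t Ht. apply Hqreal; [lra|apply Hnz; lra|apply HAreal]. }
  assert (Hct : cdisc (RtoC t0) (d1 / 2) (RtoC t0)) by (apply cdisc_center; lra).
  exists (d1 / 2), S, (q (RtoC t0)). split; [lra|]. split; [split|split].
  - apply holomorphic_of_Cderiv. intros z Hz. exists (q z). now apply HS.
  - intros t Ht. apply Cminus_eq_0.
    rewrite (Rderiv_zero_constant (fun t => S (RtoC t) - RtoC (s t))%C t0 (d1 / 2)); [|clear t Ht|exact Ht].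
    { rewrite HS0. ring. }
    intros t Ht.
    assert (Hin : cdisc (RtoC t0) (d1 / 2) (RtoC t)) by now apply cdisc_RtoC.
    assert (H1 := Rderiv_comp S RtoC t _ 1 (HS _ Hin) (RtoC_derive t)). rewrite Cmult_1_r, (Hqt t Ht) in H1.
    assert (H2 : Rderiv (fun t => RtoC (s t)) t (RtoC (Cmod (P1 (RtoC t))))).
    { apply (Rderiv_pair s (fun _ => 0)).
      - apply arc_length_derive, HdP, cdisc_RtoC. lra.
      - apply is_derive_Reals, derivable_pt_lim_const. }
    assert (H := is_derive_minus (V := C_R_NormedModule) _ _ _ _ _ H1 H2).
    refine (eq_ind _ (Rderiv _ t) H _ _).
    change (RtoC (Cmod (P1 (RtoC t))) - RtoC (Cmod (P1 (RtoC t))) = 0)%C. ring.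
  - now apply HS.
  - rewrite Hqt by (replace (t0 - t0) with 0 by ring; rewrite Rabs_R0; lra).
    apply RtoC_neq_0. specialize (Hnz t0 Hc0). lra.
Qed.

(** The continuation [S] of [s] has non-zero derivative, so a local inverse [Q] of it
    exists; on the real axis [Q] is the inverse of [s], as [S] is injective and both
    are sent by [S] to the same point. *)
Lemma analytic_in_arc_length (h : R -> C) :
  real_analytic h -> real_analytic (fun tau => h (inverse_fun s tau)).
Proof.
  rewrite 2!real_analytic_iff. intros Hh tau0. set (t0 := inverse_fun s tau0).
  destruct (Hh t0) as (d1 & H & Hd1 & HH & Hext).
  destruct (arc_length_extension t0) as (d2 & S & l & Hd2 & [HS HSs] & Hl & H0).
  assert (Hm : 0 < Rmin d1 d2) by now apply Rmin_glb_lt.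
  destruct (locally_conformal S (RtoC t0) l (Rmin d1 d2) Hm) as (d & Hd & Hconf); trivial.
  { apply holomorphic_subset with (2 := HS). apply cdisc_subset, Rmin_r. }
  assert (Rmin d1 d2 <= d1) by apply Rmin_l. assert (Rmin d1 d2 <= d2) by apply Rmin_r.
  destruct (conformal_local_inverse S (RtoC t0) d ltac:(lra) Hconf) as (e & Q & He & HQ & HQe).
  assert (HSt0 : S (RtoC t0) = RtoC tau0).
  { rewrite HSs by (replace (t0 - t0) with 0 by ring; rewrite Rabs_R0; lra).
    unfold t0. now rewrite arc_length_inverse_r. }
  rewrite HSt0 in HQ, HQe.
  destruct arc_length_bijective as [Hinc _].
  assert (Hst0 : s t0 = tau0) by apply arc_length_inverse_r.
  set (e' := Rmin e (Rmin (tau0 - s (t0 - d)) (s (t0 + d) - tau0))).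
  assert (He' : 0 < e').
  { assert (s (t0 - d) < s t0) by (apply Hinc; lra). assert (s t0 < s (t0 + d)) by (apply Hinc; lra).
    repeat apply Rmin_glb_lt; lra. }
  assert (He'e : e' <= e) by apply Rmin_l.
  assert (He'1 : e' <= tau0 - s (t0 - d)) by (eapply Rle_trans; [apply Rmin_r|apply Rmin_l]).
  assert (He'2 : e' <= s (t0 + d) - tau0) by (eapply Rle_trans; [apply Rmin_r|apply Rmin_r]).
  exists e', (fun w => H (Q w)). split; [exact He'|]. split.
  - apply (holomorphic_comp H Q _ (cdisc (RtoC t0) d1)); trivial.
    + apply holomorphic_subset with (2 := HQ). now apply cdisc_subset.
    + intros w Hw. apply cdisc_subset with (r := d); [lra|]. apply HQe.
      now apply cdisc_subset with (r := e').
  - intros tau Htau.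
    assert (Hin : cdisc (RtoC tau0) e (RtoC tau)) by (apply cdisc_RtoC; lra).
    destruct (HQe _ Hin) as [HQ1 HQ2]. set (t := inverse_fun s tau).
    assert (Hst : s t = tau) by apply arc_length_inverse_r.
    assert (Ht : Rabs (t - t0) < d).
    { apply Rabs_def2 in Htau. apply Rabs_def1.
      - destruct (Rle_lt_dec (t0 + d) t) as [[g|g]|g]; [apply Hinc in g; lra|rewrite g in *; lra|lra].
      - destruct (Rle_lt_dec t (t0 - d)) as [[g|g]|g]; [apply Hinc in g; lra|rewrite <- g in *; lra|lra]. }
    assert (E : Q (RtoC tau) = RtoC t).
    { apply (proj2 Hconf); [exact HQ1|now apply cdisc_RtoC|].
      rewrite HQ2, HSs by lra. now rewrite Hst. }
    rewrite E. apply Hext. lra.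
Qed.

Lemma analytic_from_arc_length (k : R -> C) :
  real_analytic k -> real_analytic (fun t => k (s t)).
Proof.
  rewrite 2!real_analytic_iff. intros Hk t0.
  destruct (Hk (s t0)) as (d1 & K & Hd1 & HK & Hext).
  destruct (arc_length_extension t0) as (d2 & S & l & Hd2 & [HS HSs] & _).
  destruct (holomorphic_maps_into S (RtoC t0) d2 _ Hd2 HS (cdisc_is_open (RtoC (s t0)) d1)) as (d & Hd & Hmap).
  { rewrite HSs by (replace (t0 - t0) with 0 by ring; rewrite Rabs_R0; lra). now apply cdisc_center. }
  exists d, (fun z => K (S z)). split; [lra|]. split.
  - apply (holomorphic_comp K S _ (cdisc (RtoC (s t0)) d1)); trivial.
    apply holomorphic_subset with (2 := HS). apply cdisc_subset. lra.
  - intros t Ht. assert (Hin := Hmap (RtoC t) (proj2 (cdisc_RtoC t0 d t) Ht)).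
    rewrite HSs in * by lra. apply Hext. now apply cdisc_RtoC.
Qed.
End ArcLength.

Theorem mainTheorem4 :
  forall (gamma Omega : C -> Prop) (phi : C -> C) (r : R) (s : R -> R),
    analytic_Jordan_curve gamma ->
    is_interior gamma Omega ->
    1 < r ->
    conformal_on (open_disc r) phi ->
    same_set (image phi (open_disc 1)) Omega ->
    is_arc_length (fun t : R => phi (cis t)) s ->
    forall f : C -> C,
      (real_analytic (fun t : R => f (phi (cis t)))
       <-> real_analytic (fun tau : R => f (phi (cis (inverse_fun s tau)))))
      /\
      (real_analytic (fun t : R => f (phi (cis t)))
       <-> extends_holomorphically gamma f).
Proof.
  intros gamma Omega phi r s Hgamma HOmega Hr Hphi HO Hs f.
  assert (Hon := circle_image_in_curve gamma Omega phi r HOmega Hr Hphi HO).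
  assert (Honto := curve_in_circle_image gamma phi r Hgamma Hr Hphi Hon).
  split; split.
  - apply (analytic_in_arc_length phi r s Hr Hphi Hs (fun t => f (phi (cis t)))).
  - intros H. apply (analytic_from_arc_length phi r s Hr Hphi Hs) in H.
    intros t0. destruct (H t0) as (a & d & Hd & Ha). exists a, d. split; [exact Hd|].
    intros t Ht. specialize (Ha t Ht). now rewrite (arc_length_inverse_l phi r s Hr Hphi Hs) in Ha.
  - now apply (analytic_parameter_extends gamma phi f r).
  - now apply (extension_analytic_parameter gamma phi f r).
Qed.
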